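(* Let $k$ be a nonnegative integer and let $C,\varepsilon$ be positive constants. Then there exist positive constants $c$ and $C'$ depending only on $k,C,\varepsilon$ such that the following holds for every positive integer $n$. Let $$P_n(x)=\sum_{i=0}^n\xi_i\cos(ix)+\sum_{i=1}^n\eta_i\sin(ix),$$ where $\xi_0,\dots,\xi_n,\eta_1,\dots,\eta_n$ are independent (not necessarily identically distributed) real random variables with mean $0$, variance $1$ and $(2+\varepsilon)$-moments bounded by $C$. Then for any real numbers $a_n<b_n$, the expected number of real zeros of the $k$-th derivative $P_n^{(k)}$ in $[a_n,b_n]$ satisfies $$\left|\mathbf{E}N_{P_n^{(k)}}(a_n,b_n)-\sqrt{\frac{2k+1}{2k+3}}\,\frac{(b_n-a_n)n}{\pi}\right|\le C'n^{-c}\left((b_n-a_n)n+1\right).$$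
   Context: $N_P(a,b)$ denotes the number of real roots of $P$ in the interval $[a,b]$, counted with multiplicity; by convention an identically zero function has no roots. ''$(2+\varepsilon)$-moments bounded by $C$'' means $\mathbf{E}|\xi_i|^{2+\varepsilon}\le C$ and $\mathbf{E}|\eta_i|^{2+\varepsilon}\le C$. *)

(* Defs.v *)
From HB Require Import structures.
From mathcomp Require Import all_boot all_order all_algebra.
From mathcomp Require Import all_classical all_reals all_analysis.

Set Implicit Arguments.
Unset Strict Implicit.
Unset Printing Implicit Defensive.

Import Order.TTheory GRing.Theory Num.Theory.
Import numFieldNormedType.Exports.

Local Open Scope classical_set_scope.
Local Open Scope ring_scope.

Definition mutually_independent (d : measure_display) (T : measurableType d)
    (R : realType) (P : probability T R) (I : finType)
    (X : I -> {RV P >-> R}) : Prop :=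
  forall (J : {set I}) (B : I -> set R),
    (forall i, measurable (B i)) ->
    P (\bigcap_(i in [set` J]) (X i @^-1` B i)) =
      (\prod_(i in J) P (X i @^-1` B i))%E.
Arguments mutually_independent {d T R} P {I} X.

(* Combines the xi's and eta's into one family, so that independence is joint. *)
Definition sum_family (A B S : Type) (xi : A -> S) (eta : B -> S)
    (i : A + B) : S :=
  match i with inl a => xi a | inr b => eta b end.

(* The sine coefficients are shifted: [eta j] is the coefficient of
   sin ((j + 1) x), for 0 <= j < n. *)
Definition trig_poly (R : realType) (n : nat)
    (xi : 'I_n.+1 -> R) (eta : 'I_n -> R) (x : R) : R :=
  \sum_(i < n.+1) xi i * cos (i%:R * x)
  + \sum_(j < n) eta j * sin (j.+1%:R * x).

(* Order of vanishing of [f] at [x]: the supremum of the [m] such that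
   f, f', ..., f^(m-1) all vanish at [x] (it is 0 if f x <> 0, and +oo if f is
   flat at [x]). *)
Definition root_multiplicity (R : realType) (f : R -> R) (x : R) : \bar R :=
  ereal_sup [set (m%:R : R)%:E | m in
    [set m : nat | forall j : nat, (j < m)%N -> f^`(j)%classic x = 0]].

(* Roots in the closed interval, with multiplicity; by convention the zero
   function has no roots. *)
Definition num_roots (R : realType) (f : R -> R) (a b : R) : \bar R :=
  if `[< forall x : R, f x = 0 >] then 0%E
  else \esum_(x in [set x : R | a <= x <= b /\ f x = 0])
         root_multiplicity f x.

(* Main.v *)
(* Cut [[a, b]] into intervals of length [D^-4 / n], where [D] is a small power of
   [n], so that there are about [(b - a) n D^4] of them. On one such interval the
   normalised derivative [F] of order [k] differs from its tangent at the left end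
   by [O(D^-5)], so that it has a root there, up to that error, when the pair
   [(F, F')] at the left end lies in a double wedge of angle about [D^-4].
   A central limit theorem on rectangles, with trigonometric polynomials as test
   functions, gives the probability of the wedge up to [O(D^-5)]; summing over the
   intervals gives the main term and a relative error [O(D^-1)].
   Two roots in one interval force both [F] and [F'] to be small, which has
   probability [O(D^-6)]. The number of roots is then still at most [D] outside an
   event of probability [O(n^-4)]: by Rolle's theorem many roots would make a
   derivative of order [m], with [m] of order [log(n)^2], tiny at the left end,
   whereas along an arithmetic progression of frequencies the coefficients of that
   derivative grow so fast that anticoncentration can be used for one coefficient
   after the other. On the exceptional event a deterministic bound is enough. *)
Require Import Defs.
From HB Require Import structures.
From mathcomp Require Import all_boot all_order all_algebra.
From mathcomp Require Import all_classical all_reals all_analysis measurable_realfun.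
From mathcomp Require Import lra ring zify.

Set Implicit Arguments.
Unset Strict Implicit.
Unset Printing Implicit Defensive.

Import Order.TTheory GRing.Theory Num.Theory.
Import numFieldNormedType.Exports.

Local Open Scope classical_set_scope.
Local Open Scope ring_scope.

(** * Counting zeros with multiplicity *)

Section ZeroLists.
Variable R : realType.
Implicit Types (F : nat -> R -> R) (a b x y : R) (l : seq (R * nat)).

(** The coefficients may be discrete, so there is no joint density to integrate: everything random
    is reduced to events about finitely many derivatives at one point. There the cosine and sine
    terms of equal frequency make the normalised F and F' exactly uncorrelated, with variances 1 and
    [la ^ 2] independent of the point, and [la ^ 2] tends to (2k+1)/(2k+3). For a Gaussian pair the
    double wedge of angle about [D ^ -4 * la] has mass close to [D ^ -4 * la / pi], which is the
    density of zeros. Since this mass is of order [D ^ -4], it must be known up to [D ^ -5], and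
    since a wedge is cut into [D ^ 4] rectangles, each rectangle up to [D ^ -9]. This fixes test
    polynomials of degree of order [D ^ 80] on a window of size [D ^ 6], hence characteristic
    functions up to frequencies of order [D ^ 74], where the error involves
    [(D ^ 74 / sqrt n) ^ (p - 2)]. For [p] close to 2 it beats the polynomial losses only if [n] is
    about [D ^ K] with [K] of order [1 / (p - 2)]; the final exponent is [c = 1 / K]. The integral
    of the root count is squeezed between expectations of explicit integrable functions. *)

Definition deriv_family F :=
  forall m x, is_derive x 1 (F m) (F m.+1 x).

Lemma deriv_family_shift F k : deriv_family F -> deriv_family (fun m => F (k + m)%N).
Proof. by move=> dF m x; rewrite addnS; exact: dF. Qed.

Lemma deriv_family_shift1 F : deriv_family F -> deriv_family (fun m => F m.+1).
Proof. by move=> dF m x; exact: dF. Qed.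

Lemma deriv_family_continuous F m : deriv_family F -> continuous (F m).
Proof.
move=> dF x; apply: differentiable_continuous; apply/derivable1_diffP.
by have [] := dF m x.
Qed.

Lemma deriv_familyE F m : deriv_family F -> (F 0%N)^`(m)%classic = F m.
Proof.
move=> dF; elim: m => [//|m IH]; rewrite derive1nS IH.
by apply/funext => x; rewrite derive1E; apply: derive_val.
Qed.

Lemma deriv_family_rolle F x y : deriv_family F -> x < y ->
  F 0%N x = 0 -> F 0%N y = 0 -> exists2 z, x < z < y & F 1%N z = 0.
Proof.
move=> dF xy Fx Fy.
have [|||z zxy dz] := @Rolle R (F 0%N) x y xy.
- by move=> z _; have [] := dF 0%N z.
- by apply: continuous_subspaceT; exact: deriv_family_continuous.
- by rewrite Fx Fy.
exists z; first by move: zxy; rewrite in_itv.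
have d0 := dF 0%N z.
by rewrite -(@derive_val _ _ _ _ _ _ _ d0) (@derive_val _ _ _ _ _ _ _ dz).
Qed.

(** A pair [(y, m)] records a zero together with some order of vanishing reached there, not
    necessarily the exact one. Only the previous point [x] is remembered, which is what an induction
    with Rolle's theorem needs. *)
Fixpoint zchain F b x l : Prop :=
  if l is (y, m) :: l' then
    [/\ x < y <= b, (0 < m)%N, forall j, (j < m)%N -> F j y = 0 & zchain F b y l']
  else True.

Definition ztot l := sumn (map snd l).

Lemma zchain_weak F b x y l : x <= y -> zchain F b y l -> zchain F b x l.
Proof.
case: l => [//|[z m] l] /= xy [/andP[yz zb] m0 Fm zl]; split => //.
by rewrite (le_lt_trans xy yz).
Qed.

(** Differentiation costs one unit of multiplicity at each listed zero, and Rolle's theorem on the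
    gap to its left gives it back. The zero at [x] supplies the first gap. *)
Lemma zchain_rolle F b x l : deriv_family F -> F 0%N x = 0 -> zchain F b x l ->
  exists2 l', zchain (fun m => F m.+1) b x l' & (ztot l <= ztot l')%N.
Proof.
move=> dF; elim: l x => [|[y m] l IH] x Fx /=; first by exists [::].
case=> /andP[xy yb] m0 Fm zl.
have Fy := Fm 0%N m0.
have [l' zl' tl] := IH _ Fy zl.
have [z /andP[xz zy] Fz] := deriv_family_rolle dF xy Fx Fy.
have zb : z <= b by rewrite (le_trans (ltW zy)).
(* A simple zero [y] is replaced by the Rolle point [z]; a multiple one stays, one order lower, next
   to [z]. *)
case: m m0 Fm => [//|[|m]] _ Fm.
- exists ((z, 1%N) :: l'); last by rewrite /ztot /= leq_add2l.
  split => //; first by rewrite xz.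
    by case.
  exact: zchain_weak (ltW zy) zl'.
exists ((z, 1%N) :: (y, m.+1) :: l').
  split => //; first by rewrite xz.
    by case.
  by split => //; [rewrite zy|move=> j jm; exact: Fm].
by rewrite /ztot /= add1n addSn ltnS leq_add2l.
Qed.

(* [F 0] has at least [N] zeros in [[a, b]], counted with multiplicity; the
   chain [l] lists the zeros to the right of the leftmost one. *)
Definition zeros_ge F a b (N : nat) :=
  exists x m l, [/\ a <= x <= b, (0 < m)%N, forall j, (j < m)%N -> F j x = 0,
    zchain F b x l & (N <= m + ztot l)%N].

Lemma zeros_ge_root F a b N : zeros_ge F a b N -> exists2 x, a <= x <= b & F 0%N x = 0.
Proof. by case=> x [m [l [xab m0 Fm _ _]]]; exists x => //; exact: Fm. Qed.

Lemma zeros_ge_le F a b M N : (M <= N)%N -> zeros_ge F a b N -> zeros_ge F a b M.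
Proof.
move=> MN [x [m [l [xab m0 Fm zl Nl]]]]; exists x, m, l; split => //.
exact: leq_trans Nl.
Qed.

(** The leftmost zero has no gap to its left, so one unit is lost. If it is taken with order 1, the
    head of the new chain becomes the leftmost zero. *)
Lemma zeros_ge_deriv F a b N : deriv_family F -> zeros_ge F a b N.+2 ->
  zeros_ge (fun m => F m.+1) a b N.+1.
Proof.
move=> dF [x [m [l [/andP[ax xb] m0 Fm zl Nl]]]].
have [l' zl' tl] := zchain_rolle dF (Fm 0%N m0) zl.
case: m m0 Fm Nl => [//|[|m]] _ Fm Nl.
- case: l' zl' tl => [_|[y m'] l' /= [/andP[xy yb] m'0 Fm' zl'] tl].
    by rewrite {2}/ztot /= leqn0 => /eqP l0; rewrite l0 in Nl.
  exists y, m', l'; split => //; first by rewrite yb (le_trans ax (ltW xy)).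
  by move: tl Nl; rewrite /ztot /=; lia.
exists x, m.+1, l'; split => //; first by rewrite ax xb.
  by move=> j jm; exact: Fm.
by move: tl Nl; lia.
Qed.

Lemma zeros_ge_deriv_root F a b N i : deriv_family F -> zeros_ge F a b N ->
  (i < N)%N -> exists2 x, a <= x <= b & F i x = 0.
Proof.
elim: i F N => [|i IH] F N dF zN iN; first exact: zeros_ge_root zN.
case: N zN iN => [//|[//|N]] zN iN.
exact: IH (deriv_family_shift1 dF) (zeros_ge_deriv dF zN) iN.
Qed.

Lemma zchain_of_sorted F b (mu : R -> nat) x (s : seq R) :
  path <%R x s -> (forall y, y \in s -> y <= b) -> (forall y, y \in s -> (0 < mu y)%N) ->
  (forall y j, y \in s -> (j < mu y)%N -> F j y = 0) ->
  zchain F b x [seq (y, mu y) | y <- s].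
Proof.
elim: s x => [//|y s IH] x /= /andP[xy ys] sb smu sF; split => //.
- by rewrite xy sb// mem_head.
- by rewrite smu// mem_head.
- by move=> j; apply: sF; rewrite mem_head.
- by apply: IH => // [z zs|z zs|z j zs]; [apply: sb|apply: smu|apply: sF];
    rewrite inE zs orbT.
Qed.

(** The points are sorted, and those to which [mu] assigns order 0 are dropped, because a chain only
    admits positive orders. *)
Lemma zeros_ge_seq F a b (mu : R -> nat) (s : seq R) N : uniq s -> (0 < N)%N ->
  (forall y, y \in s -> a <= y <= b) ->
  (forall y j, y \in s -> (j < mu y)%N -> F j y = 0) ->
  (N <= \sum_(y <- s) mu y)%N -> zeros_ge F a b N.
Proof.
move=> us N0 sab sF Ns.
pose s' := sort <=%R [seq y <- s | (0 < mu y)%N].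
have memE y : y \in s' = (y \in s) && (0 < mu y)%N by rewrite mem_sort mem_filter andbC.
have ss' : sorted <%R s'.
  by rewrite lt_sorted_uniq_le sort_uniq filter_uniq//= sort_sorted//; exact: le_total.
have sum' : (\sum_(y <- s') mu y = \sum_(y <- s) mu y)%N.
  rewrite (perm_big [seq y <- s | (0 < mu y)%N])/=; last by rewrite perm_sort.
  rewrite big_filter [RHS](bigID (fun y => (0 < mu y)%N)) /= [X in (_ + X)%N]big1 ?addn0//.
  by move=> y; rewrite -eqn0Ngt => /eqP.
case E : s' ss' sum' => [|x r]/=; first by rewrite big_nil => _ h; move: Ns N0; rewrite -h leqn0 => /eqP->.
move=> pr sum'.
have xs : x \in s' by rewrite E mem_head.
have rs y : y \in r -> y \in s' by move=> yr; rewrite E inE yr orbT.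
exists x, (mu x), [seq (y, mu y) | y <- r]; split.
- by apply: sab; move: xs; rewrite memE => /andP[].
- by move: xs; rewrite memE => /andP[].
- by move=> j; apply: sF; move: xs; rewrite memE => /andP[].
- apply: zchain_of_sorted => //.
  + by move=> y /rs; rewrite memE => /andP[/sab/andP[]].
  + by move=> y /rs; rewrite memE => /andP[].
  + by move=> y j /rs; rewrite memE => /andP[ys _]; exact: sF.
- rewrite (leq_trans Ns)// -sum' big_cons leq_add2l /ztot sumnE -map_comp big_map.
  by apply: leq_sum.
Qed.

End ZeroLists.

(** * Comparison of [num_roots] with chains of zeros *)

Section NumRoots.
Variable R : realType.
Implicit Types (F : nat -> R -> R) (a b x y : R) (f : R -> R).

Lemma root_multiplicity_ge0 f x : (0 <= root_multiplicity f x)%E.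
Proof. by apply: ereal_sup_ubound; exists 0%N. Qed.

Lemma root_multiplicity_ge f x m : (forall j, (j < m)%N -> f^`(j)%classic x = 0) ->
  (m%:R%:E <= root_multiplicity f x)%E.
Proof. by move=> h; apply: ereal_sup_ubound; exists m. Qed.

Lemma root_multiplicity_eq F x m : deriv_family F ->
  (forall j, (j < m)%N -> F j x = 0) -> F m x <> 0 ->
  root_multiplicity (F 0%N) x = m%:R%:E.
Proof.
move=> dF Fj Fm; apply/eqP; rewrite eq_le; apply/andP; split; last first.
  by apply: root_multiplicity_ge => j jm; rewrite deriv_familyE// Fj.
apply: ge_ereal_sup => _ [i /= ih <-]; rewrite lee_fin ler_nat leqNgt; apply/negP => mi.
by apply: Fm; rewrite -(deriv_familyE _ dF); apply: ih.
Qed.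

Lemma num_roots_ge0 f a b : (0 <= num_roots f a b)%E.
Proof.
rewrite /num_roots; case: asboolP => // _; apply: esum_ge0 => x _.
exact: root_multiplicity_ge0.
Qed.

(** The sum over the roots is a supremum over finite subsets; each finite subset is turned into a
    chain. *)
Lemma num_roots_le F a b N : deriv_family F -> ~ zeros_ge F a b N.+1 ->
  (num_roots (F 0%N) a b <= N%:R%:E)%E.
Proof.
move=> dF nz; rewrite /num_roots; case: asboolP => // _.
apply: ge_ereal_sup => _ [A [finA AS] <-].
rewrite fsbig_finite//=.
set s := finmap.enum_fset _.
have us : uniq s by exact: finmap.fset_uniq.
have sA y : y \in s -> A y.
  by move=> ys; apply/set_mem; rewrite -(in_fset_set finA).
have sab y : y \in s -> a <= y <= b by move=> /sA/AS[].
(* A single zero of order [N + 1] would already contradict [nz]. Hence every multiplicity is finite,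
   namely the least order whose derivative does not vanish. *)
have bnd y : y \in s -> ~ (forall j, (j < N.+1)%N -> F j y = 0).
  move=> ys h; apply: nz; exists y, N.+1, [::]; split => //; first exact: sab.
  by rewrite addn0.
have mux y : {m : nat | (y \in s) ->
    (forall j, (j < m)%N -> F j y = 0) /\ root_multiplicity (F 0%N) y = m%:R%:E}.
  apply: cid; case: (boolP (y \in s)) => [ys|ns]; last by exists 0%N.
  have ex : exists j, F j y != 0.
    have /existsNP[j /not_implyP[_ /eqP]] := bnd y ys; by exists j.
  exists (ex_minn ex); case: ex_minnP => m Fm mmin _.
  have Fj j : (j < m)%N -> F j y = 0.
    by move=> jm; apply/eqP; apply: contraTT jm => /mmin; rewrite -leqNgt.
  by split => //; apply: root_multiplicity_eq => //; apply/eqP.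
pose mu y := sval (mux y).
rewrite (eq_big_seq (fun y => (mu y)%:R%:E)); last first.
  by move=> y ys; rewrite /mu; case: (mux y) => m /= /(_ ys)[].
rewrite sumEFin lee_fin -natr_sum ler_nat leqNgt; apply/negP => Ns; apply: nz.
apply: (@zeros_ge_seq _ _ _ _ mu s) => //.
by move=> y j ys; rewrite /mu; case: (mux y) => m /= /(_ ys)[h _]; exact: h.
Qed.

(** Only an inequality, since a root at [c] is counted on both sides; upper bounds need this
    direction. *)
Lemma num_roots_split f a b c :
  (num_roots f a b <= num_roots f a c + num_roots f c b)%E.
Proof.
rewrite /num_roots; case: asboolP => [|_]; first by rewrite adde0.
set mu := root_multiplicity f.
have mu0 x : (0 <= mu x)%E by exact: root_multiplicity_ge0.
rewrite esum_mkcond [X in (_ <= X + _)%E]esum_mkcond [X in (_ <= _ + X)%E]esum_mkcond.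
rewrite -esumD; last 2 first.
- by move=> x _; case: ifP.
- by move=> x _; case: ifP.
apply: le_esum => x _; case: ifPn => [|_]; last by rewrite adde_ge0//; case: ifP.
rewrite inE => -[/andP[ax xb] fx].
have [xc|cx] := leP x c.
  rewrite mem_set/=; last by split => //; rewrite ax xc.
  by rewrite leeDl//; case: ifP.
rewrite [X in (_ <= _ + X)%E]ifT; last by rewrite inE; split => //; rewrite xb (ltW cx).
by rewrite leeDr//; case: ifP.
Qed.

Lemma num_roots_ge_seq f a b (s : seq R) : uniq s -> ~ (forall x, f x = 0) ->
  (forall y, y \in s -> a <= y <= b /\ f y = 0) ->
  ((size s)%:R%:E <= num_roots f a b)%E.
Proof.
move=> us nf sab; rewrite /num_roots; case: asboolP => // _.
apply: esum_ge; exists [set` s].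
  by split; [exact: finite_seq|move=> x /= /sab].
rewrite -fsbig_seq//.
have -> : (size s)%:R%:E = (\sum_(i <- s) 1%:E)%E :> \bar R.
  by rewrite sumEFin big_const_seq count_predT iter_addr_0.
rewrite big_seq [X in (_ <= X)%E]big_seq; apply: lee_sum => x /sab[_ fx].
by apply: (@root_multiplicity_ge f x 1) => -[].
Qed.

End NumRoots.

(** * Zeros of trigonometric sums *)

Section MeanValue.
Variable R : realType.
Implicit Types (F : nat -> R -> R) (a b x y : R).

Lemma deriv_family_lip F m a b B x y : deriv_family F ->
  (forall z, a <= z <= b -> `|F m.+1 z| <= B) -> a <= x <= b -> a <= y <= b ->
  `|F m x - F m y| <= B * `|x - y|.
Proof.
move=> dF FB; wlog yx : x y / y <= x.
  move=> H hx hy; case: (leP y x) => [|/ltW] h; first exact: H.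
  by rewrite distrC (distrC x); exact: H.
move=> /andP[ax xb] /andP[ay yb].
have [||c] := @MVT_segment R (F m) (F m.+1) y x yx.
- by move=> z _; exact: dF.
- by apply: continuous_subspaceT; exact: deriv_family_continuous.
rewrite in_itv/= => /andP[yc cx] ->; rewrite normrM ler_wpM2r// FB//.
by rewrite (le_trans ay yc) (le_trans cx xb).
Qed.

Lemma deriv_family_zero_bound F m a b B : deriv_family F ->
  (exists2 z, a <= z <= b & F m z = 0) ->
  (forall z, a <= z <= b -> `|F m.+1 z| <= B) ->
  forall x, a <= x <= b -> `|F m x| <= (b - a) * B.
Proof.
move=> dF [z zab Fz] FB x xab.
have := deriv_family_lip dF FB xab zab; rewrite Fz subr0 => /le_trans; apply.
have B0 : 0 <= B by apply: le_trans (FB _ zab); exact: normr_ge0.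
rewrite mulrC ler_wpM2r// ler_norml; move: xab zab => /andP[? ?] /andP[? ?].
by apply/andP; split; lra.
Qed.

(** By the mean value theorem each order that has a zero gains a factor [b - a] over the next one;
    different orders may vanish at different points. *)
Lemma deriv_family_zeros_bound F a b B N : deriv_family F -> a <= b ->
  (forall i, (i < N)%N -> exists2 z, a <= z <= b & F i z = 0) ->
  (forall z, a <= z <= b -> `|F N z| <= B) ->
  forall i x, (i <= N)%N -> a <= x <= b -> `|F i x| <= (b - a) ^+ (N - i) * B.
Proof.
move=> dF ab Fz FB.
suff H j i x : (i + j = N)%N -> a <= x <= b -> `|F i x| <= (b - a) ^+ j * B.
  by move=> i x iN; apply: H; rewrite subnKC.
elim: j i x => [|j IH] i x.
  by rewrite addn0 expr0 mul1r => ->; exact: FB.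
move=> ijN xab; rewrite exprS -mulrA; apply: (deriv_family_zero_bound dF) xab.
  by apply: Fz; lia.
by move=> z zab; apply: IH => //; lia.
Qed.

End MeanValue.

Section TrigSum.
Variables (R : realType) (I : finType) (fr : I -> nat) (ph : I -> R).
Implicit Types (c : I -> R) (a b x y : R).

(** Differentiating a cosine multiplies it by the frequency and advances its phase by a quarter
    turn, so all orders [m] of derivation share this closed formula. *)
Definition tsum c (m : nat) x : R :=
  \sum_i c i * ((fr i)%:R ^+ m * cos ((fr i)%:R * x + ph i + m%:R * (pi / 2))).

Lemma is_derive_big (r : seq I) (f : I -> R -> R) (df : I -> R) x :
  (forall i, is_derive x 1 (f i) (df i)) ->
  is_derive x 1 (fun y => \sum_(i <- r) f i y) (\sum_(i <- r) df i).
Proof.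
move=> h; elim: r => [|i r IH].
  rewrite big_nil (_ : (fun y => _) = cst 0); first exact: is_derive_cst.
  by apply/funext => y; rewrite big_nil.
rewrite big_cons (_ : (fun y => _) = f i + (fun y => \sum_(j <- r) f j y)).
  exact: is_deriveD.
by apply/funext => y; rewrite big_cons.
Qed.

Lemma cosDpihalf_ (x : R) : cos (x + pi / 2) = - sin x.
Proof. by rewrite cosD cos_pihalf sin_pihalf mulr0 mulr1 sub0r. Qed.

Lemma is_derive_cos_lin (j t x : R) :
  is_derive x 1 (fun y => cos (j * y + t)) (j * cos (j * x + t + pi / 2)).
Proof.
rewrite cosDpihalf_.
have H : is_derive x 1 (fun y => j * y + t) j.
  have -> : (fun y => j * y + t) = (fun y => j *: y) + cst t by apply/funext.
  rewrite -[X in is_derive _ _ _ X]addr0; apply: is_deriveD.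
  have H0 : is_derive x 1 (j \*: (@id R)) (j *: 1) by exact: is_deriveZ.
  by rewrite /GRing.scale/= mulr1 in H0.
have H2 := @is_derive_cos R (j * x + t).
have := @is_derive1_comp R cos (fun y => j * y + t) x _ _ H2 H.
by rewrite mulrC.
Qed.

Lemma tsum_deriv c : deriv_family (tsum c).
Proof.
move=> m x; rewrite /tsum; apply: is_derive_big => i.
set j := (fr i)%:R.
have H := is_derive_cos_lin j (ph i + m%:R * (pi / 2)) x.
have -> : (fun y => c i * (j ^+ m * cos (j * y + ph i + m%:R * (pi / 2)))) =
    (fun y => (c i * j ^+ m) *: cos (j * y + (ph i + m%:R * (pi / 2)))).
  by apply/funext => y; rewrite /GRing.scale/= mulrA addrA.
have -> : c i * (j ^+ m.+1 * cos (j * x + ph i + m.+1%:R * (pi / 2))) =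
    (c i * j ^+ m) *: (j * cos (j * x + (ph i + m%:R * (pi / 2)) + pi / 2)).
  rewrite /GRing.scale/= exprSr -!mulrA; congr (_ * (_ * (_ * cos _))).
  by rewrite -addn1 natrD; ring.
exact: is_deriveZ.
Qed.

Lemma tsum_le c m x (n : nat) B : (forall i, (fr i <= n)%N) ->
  (forall i, `|c i| <= B) -> `|tsum c m x| <= #|I|%:R * B * n%:R ^+ m.
Proof.
move=> frn cB; rewrite /tsum (le_trans (ler_norm_sum _ _ _))//.
apply: (@le_trans _ _ (\sum_(i : I) (B * n%:R ^+ m))); last first.
  by rewrite sumr_const -mulrA mulr_natl.
apply: ler_sum => i _; rewrite normrM ler_pM// normrM normrX ger0_norm//.
rewrite -[leRHS]mulr1 ler_pM ?exprn_ge0//.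
  by rewrite lerXn2r ?nnegrE// ler_nat.
by rewrite ler_norml cos_geN1 cos_le1.
Qed.

(* [opL m] composes the operators [D^2 + q^2] for [q < m]; a trigonometric sum
   with frequencies at most [n] is killed by [opL n.+1]. *)
Fixpoint opL (m : nat) (F : nat -> R -> R) (i : nat) (x : R) : R :=
  if m is q.+1 then opL q F i.+2 x + q%:R ^+ 2 * opL q F i x else F i x.

(** On a term of frequency [f], the operator [D^2 + q^2] is multiplication by [q^2 - f^2]. *)
Lemma opL_tsum c m i x : opL m (tsum c) i x =
  \sum_l c l * (\prod_(q < m) (q%:R ^+ 2 - (fr l)%:R ^+ 2)) *
     ((fr l)%:R ^+ i * cos ((fr l)%:R * x + ph l + i%:R * (pi / 2))).
Proof.
elim: m i => [|m IH] i /=.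
  by apply: eq_bigr => l _; rewrite big_ord0 mulr1.
rewrite !IH mulr_sumr -big_split /=; apply: eq_bigr => l _.
rewrite big_ord_recr /=.
have -> : cos ((fr l)%:R * x + ph l + i.+2%:R * (pi / 2)) =
    - cos ((fr l)%:R * x + ph l + i%:R * (pi / 2)).
  rewrite -(@cosDpi R); congr cos.
  by rewrite -[i.+2]addn2 natrD; field.
by rewrite !exprS; ring.
Qed.

Lemma opL_tsum0 c n i x : (forall l, (fr l <= n)%N) -> opL n.+1 (tsum c) i x = 0.
Proof.
move=> frn; rewrite opL_tsum big1// => l _.
have ln : (fr l < n.+1)%N by rewrite ltnS.
by rewrite (bigD1 (Ordinal ln))//= subrr mul0r mulr0 mul0r.
Qed.

(** When each lower order is smaller by a factor [tau], the pure derivative of order [2 m] dominates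
    the composition. The product minus 1 collects the relative weights of all other terms of the
    expansion. *)
Lemma opL_approx F (tau S : R) N m i x : 0 <= tau -> 0 <= S ->
  (forall j, (j <= N)%N -> `|F j x| <= tau ^+ (N - j) * S) -> (i + 2 * m <= N)%N ->
  `|opL m F i x - F (i + 2 * m)%N x| <=
    (\prod_(q < m) (1 + q%:R ^+ 2 * tau ^+ 2) - 1) * (tau ^+ (N - (i + 2 * m)) * S).
Proof.
move=> t0 S0 FB; elim: m i => [|m IH] i iN /=.
  by rewrite big_ord0 muln0 addn0 !subrr normr0 mul0r.
have H1 := IH i.+2 ltac:(lia); have H2 := IH i ltac:(lia).
rewrite (_ : (i.+2 + 2 * m = i + 2 * m.+1)%N) in H1; last by lia.
have H3 := FB (i + 2 * m)%N ltac:(lia).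
rewrite big_ord_recr /=.
set p := \prod_(_ < _) _ in H1 H2 *.
have E : tau ^+ (N - (i + 2 * m)) * S = tau ^+ 2 * (tau ^+ (N - (i + 2 * m.+1)) * S).
  by rewrite mulrA -exprD; congr (_ ^+ _ * _); lia.
rewrite E in H2 H3.
set T := tau ^+ (N - _) * S in H1 H2 H3 *.
set A := opL m F i.+2 x in H1 *; set B := opL m F i x in H2 *.
set A' := F _ x in H1 *; set B' := F _ x in H2 H3.
have HB : `|B| <= p * (tau ^+ 2 * T).
  have -> : B = (B - B') + B' by ring.
  rewrite (le_trans (ler_normD _ _))//; lra.
have -> : A + m%:R ^+ 2 * B - A' = (A - A') + m%:R ^+ 2 * B by ring.
rewrite (le_trans (ler_normD _ _))// normrM (ger0_norm (sqr_ge0 _)).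
have := ler_wpM2l (sqr_ge0 (m%:R : R)) HB; lra.
Qed.

Lemma prod_one_plus_le (A : R) (n m : nat) (u : nat -> R) : 0 <= A ->
  (forall q, (q < m)%N -> 0 <= u q <= A) -> 2 * m%:R * A <= 1 ->
  \prod_(q < m) (1 + u q) <= 1 + 2 * m%:R * A.
Proof.
move=> A0; elim: m => [|m IH] uA mA; first by rewrite big_ord0 mulr0 mul0r addr0.
have mA' : 2 * m%:R * A <= 1.
  by move: mA; rewrite -natr1; lra.
have H := IH (fun q qm => uA q (ltnW qm)) mA'.
have /andP[u0 u1] := uA m (ltnSn m).
rewrite big_ord_recr /= (@le_trans _ _ ((1 + 2 * m%:R * A) * (1 + A)))//.
  rewrite ler_pM//; [|lra|lra].
  by apply: prodr_ge0 => i _; have /andP[? ?] := uA i (ltnW (ltn_ord i)); lra.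
have m0 : 0 <= m%:R * A by rewrite mulr_ge0.
have := ler_wpM2r A0 mA'; rewrite -natr1; lra.
Qed.

(** Take a point [z] where the derivative of order [2 (n + 1)] has its maximal absolute value [S].
    There it differs by at most [S / 4] from [opL n.+1], which vanishes; so [S = 0], and the bounds
    by powers of [b - a] kill all lower orders. *)
Lemma tsum_short_zero c (n : nat) a b : (0 < n)%N -> (forall l, (fr l <= n)%N) ->
  a <= b -> (b - a) * (4 * n%:R ^+ 2) <= 1 ->
  (forall i, (i < 2 * n.+1)%N -> exists2 z, a <= z <= b & tsum c i z = 0) ->
  forall i x, (i <= 2 * n.+1)%N -> a <= x <= b -> tsum c i x = 0.
Proof.
move=> n0 frn ab tau_le zF.
have dF := tsum_deriv c.
set N := (2 * n.+1)%N in zF *; set F := tsum c in dF zF *.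
have cN : continuous (fun x => `|F N x|).
  move=> x; apply: continuous_comp; first exact: deriv_family_continuous.
  exact: norm_continuous.
have [z zab Fmax] := EVT_max ab (continuous_subspaceT cN).
move: zab; rewrite in_itv /= => zab.
have FB y : a <= y <= b -> `|F N y| <= `|F N z|.
  by move=> yab; apply: Fmax; rewrite in_itv.
have B := deriv_family_zeros_bound dF ab zF FB.
set S := `|F N z| in FB B *.
set tau := b - a in tau_le B.
have t0 : 0 <= tau by rewrite subr_ge0.
have n1 : 1 <= n%:R :> R by rewrite ler1n.
have nt : (n%:R * tau) ^+ 2 * (16 * n%:R ^+ 2) <= 1.
  have -> : (n%:R * tau) ^+ 2 * (16 * n%:R ^+ 2) = (tau * (4 * n%:R ^+ 2)) ^+ 2 by ring.
  by rewrite expr_le1// mulr_ge0// mulr_ge0// sqr_ge0.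
have nt' : (n%:R * tau) ^+ 2 * (8 * n.+1%:R) <= 1.
  rewrite (le_trans _ nt)// ler_wpM2l ?sqr_ge0// -natr1.
  have : n%:R * 1 <= n%:R * n%:R :> R by rewrite ler_wpM2l// ler0n.
  by rewrite expr2; lra.
have S0 : S = 0.
  have H := @opL_approx F tau S N n.+1 0%N z t0 (normr_ge0 _)
    (fun j jN => B j z jN zab) ltac:(rewrite add0n; exact: leqnn).
  move: H; rewrite (opL_tsum0 _ _ _ frn) add0n subnn expr0 mul1r sub0r normrN -/S.
  have P : \prod_(q < n.+1) (1 + q%:R ^+ 2 * tau ^+ 2) <= 1 + 2 * n.+1%:R * (n%:R * tau) ^+ 2.
    apply: (@prod_one_plus_le _ n n.+1 (fun q => q%:R ^+ 2 * tau ^+ 2)); first exact: sqr_ge0.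
      move=> q qn; rewrite mulr_ge0 ?sqr_ge0//= exprMn ler_wpM2r ?sqr_ge0//.
      by rewrite lerXn2r ?nnegrE// ler_nat.
    by lra.
  have S1 : 0 <= S by exact: normr_ge0.
  have : (\prod_(q < n.+1) (1 + q%:R ^+ 2 * tau ^+ 2) - 1) * S <= (1 / 4) * S.
    by rewrite ler_wpM2r//; lra.
  by move=> h1 h2; apply/le_anti; rewrite S1 andbT; lra.
move=> i x iN xab; apply/normr0_eq0/le_anti; rewrite normr_ge0 andbT.
by have := B i x iN xab; rewrite S0 mulr0.
Qed.

(** Once all orders up to [2 (n + 1)] vanish at a point, [tsum_short_zero] applies to every short
    interval ending there, so the vanishing propagates along the line in steps of length at most
    [1 / (4 n ^ 2)]. *)
Lemma tsum_eq0 c (n : nat) a b : (0 < n)%N -> (forall l, (fr l <= n)%N) ->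
  a <= b -> (b - a) * (4 * n%:R ^+ 2) <= 1 ->
  (forall i, (i < 2 * n.+1)%N -> exists2 z, a <= z <= b & tsum c i z = 0) ->
  forall x, tsum c 0 x = 0.
Proof.
move=> n0 frn ab tau_le zF.
have Fa i : (i <= 2 * n.+1)%N -> tsum c i a = 0.
  by move=> iN; apply: (tsum_short_zero n0 frn ab tau_le zF iN); rewrite lexx.
have n4 : 0 < 4 * n%:R ^+ 2 :> R by rewrite mulr_gt0// exprn_gt0// ltr0n.
have key (k : nat) x i : (i <= 2 * n.+1)%N -> `|x - a| * (4 * n%:R ^+ 2) <= k%:R -> tsum c i x = 0.
  elim: k x i => [|k IH] x i iN xk.
    have : `|x - a| * (4 * n%:R ^+ 2) = 0.
      by apply/le_anti; rewrite xk mulr_ge0// ltW.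
    by move/eqP; rewrite mulf_eq0 (gt_eqF n4) orbF normr_eq0 subr_eq0 => /eqP ->; exact: Fa.
  (* The point reached after [k] of the [k + 1] equal steps from [a] to [x]. *)
  pose y := a + (x - a) * (k%:R / k.+1%:R).
  have k1 : k.+1%:R != 0 :> R by rewrite pnatr_eq0.
  have Fy j : (j <= 2 * n.+1)%N -> tsum c j y = 0.
    move=> jN; apply: IH => //.
    rewrite /y addrC addKr normrM [`|k%:R / _|]ger0_norm; last by rewrite divr_ge0.
    rewrite -mulrA [_ / _ * _]mulrC mulrA (le_trans (ler_wpM2r _ xk)) ?divr_ge0//.
    by rewrite mulrC divfK.
  have xy : `|x - y| * (4 * n%:R ^+ 2) <= 1.
    have -> : x - y = (x - a) / k.+1%:R by rewrite /y -natr1; field; rewrite natr1.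
    rewrite normrM [`|_^-1|]ger0_norm ?invr_ge0// mulrAC ler_pdivrMr ?ltr0n// mul1r.
    exact: xk.
  have [yx|xy'] := leP y x.
    apply: (@tsum_short_zero c n y x) => //.
    - by rewrite -(@ger0_norm _ (x - y)) ?subr_ge0.
    - by move=> j jN; exists y; [rewrite lexx|exact/Fy/ltnW].
    - by rewrite lexx andbT.
  apply: (@tsum_short_zero c n x y) => //.
  - exact: ltW.
  - by move: xy; rewrite distrC gtr0_norm ?subr_gt0.
  - by move=> j jN; exists y; [rewrite lexx (ltW xy')|exact/Fy/ltnW].
  - by rewrite lexx (ltW xy').
move=> x; pose z := `|x - a| * (4 * n%:R ^+ 2).
apply: (key (Num.truncn z).+1) => //.
by apply: ltW; apply: truncnS_gt.
Qed.

Lemma num_roots_tsum_short c (n : nat) a b : (0 < n)%N -> (forall l, (fr l <= n)%N) ->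
  a <= b -> (b - a) * (4 * n%:R ^+ 2) <= 1 ->
  (num_roots (tsum c 0) a b <= (2 * n.+1)%:R%:E)%E.
Proof.
move=> n0 frn ab tau_le.
have [z|nz] := pselect (forall x, tsum c 0 x = 0).
  by rewrite /num_roots asboolT// lee_fin.
apply: num_roots_le (tsum_deriv c) _ => zg; apply: nz.
apply: (tsum_eq0 n0 frn ab tau_le) => i iN.
apply: (zeros_ge_deriv_root (tsum_deriv c) zg); exact: leqW.
Qed.

Lemma num_roots_pieces (f : R -> R) (t : nat -> R) q (B : nat -> \bar R) :
  (0 < q)%N -> (forall i, (i < q)%N -> (num_roots f (t i) (t i.+1) <= B i)%E) ->
  (num_roots f (t 0%N) (t q) <= \sum_(i < q) B i)%E.
Proof.
case: q => // q _; elim: q => [|q IH] h.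
  by rewrite big_ord_recr big_ord0 /= add0e h.
rewrite big_ord_recr /= (le_trans (num_roots_split _ _ _ (t q.+1)))//.
by rewrite leeD ?h// IH// => i iq; apply: h; rewrite ltnS ltnW.
Qed.

(** The deterministic bound used on the exceptional event and for bounded [n]. *)
Lemma num_roots_tsum c (n : nat) a b : (0 < n)%N -> (forall l, (fr l <= n)%N) ->
  a <= b -> (num_roots (tsum c 0) a b <=
     (((b - a) * (4 * n%:R ^+ 2) + 1) * (2 * n.+1)%:R)%:E)%E.
Proof.
move=> n0 frn ab; set z := (b - a) * _.
have z0 : 0 <= z by rewrite mulr_ge0 ?subr_ge0// mulr_ge0// sqr_ge0.
pose q := (Num.truncn z).+1.
have zq : z <= q%:R by apply: ltW; exact: truncnS_gt.
have qz : q%:R <= z + 1 by rewrite /q -natr1 lerD2r truncn_le.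
have q0 : 0 < q%:R :> R by rewrite ltr0n.
pose t i := a + (b - a) * (i%:R / q%:R).
have -> : a = t 0%N by rewrite /t mul0r mulr0 addr0.
rewrite [X in num_roots _ _ X](_ : b = t q); last by rewrite /t divff ?gt_eqF// mulr1 addrC subrK.
have tS i : t i.+1 - t i = (b - a) / q%:R.
  by rewrite /t -natr1; field; rewrite gt_eqF.
apply: (@le_trans _ _ (\sum_(i < q) (2 * n.+1)%:R%:E)%E).
  apply: (@num_roots_pieces _ t q (fun=> (2 * n.+1)%:R%:E)) => // i iq.
  apply: num_roots_tsum_short => //.
    by rewrite -subr_ge0 tS divr_ge0 ?subr_ge0// ltW.
  by rewrite tS mulrAC ler_pdivrMr// mul1r.
by rewrite sumEFin lee_fin sumr_const card_ord -[leLHS]mulr_natl ler_wpM2r.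
Qed.

End TrigSum.

(** * Expectations, probabilities and independence *)

(** The sigma-algebra is arbitrary, because [indep_lin] uses the one generated by the variables with
    index in [Q]. *)
Lemma meas_lin_on d (T : measurableType d) (R : realType) (I : finType)
    (X : I -> T -> R) (c : I -> R) (Q : {set I}) :
  (forall j, j \in Q -> measurable_fun setT (X j)) ->
  measurable_fun setT (fun w => \sum_(j in Q) c j * X j w).
Proof.
move=> mX; have -> : (fun w => \sum_(j in Q) c j * X j w) =
    (fun w => \sum_j (if j \in Q then c j * X j w else 0)).
  by apply/funext => w; rewrite big_mkcond.
apply: measurable_sum => j; case: (boolP (j \in Q)) => // jQ.
by apply: measurable_funM => //; exact: mX.
Qed.

Section Expectation.
Context d (T : measurableType d) (R : realType) (P : probability T R).
Implicit Types (f g : T -> R) (A B : set T).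

Definition intg f := P.-integrable setT (EFin \o f).
Definition Ex f : R := fine (\int[P]_w (f w)%:E)%E.
Definition Pr A : R := fine (P A).

Lemma intg_meas f : intg f -> measurable_fun setT f.
Proof. by move=> /integrableP[/measurable_EFinP]. Qed.

Lemma intg_bdd f (B : R) : measurable_fun setT f -> (forall w, `|f w| <= B) -> intg f.
Proof.
move=> mf fB; apply: measurable_bounded_integrable => //.
  by apply: (le_lt_trans (probability_le1 _ _)) => //; rewrite ltry.
exists B; split; first by rewrite num_real.
by move=> M BM w _; apply: (le_trans (fB w)); exact: ltW.
Qed.

Lemma intg_le f g : measurable_fun setT f -> intg g -> (forall w, `|f w| <= g w) -> intg f.
Proof.
move=> mf ig fg; apply: (@le_integrable _ _ _ P setT measurableT _ (EFin \o g)) => //.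
  exact/measurable_EFinP.
by move=> w _ /=; rewrite lee_fin (le_trans (fg w))// ler_norm.
Qed.

Lemma intg_cst c : intg (cst c).
Proof. by apply: (@intg_bdd _ `|c|). Qed.

Lemma intgD f g : intg f -> intg g -> intg (fun w => f w + g w).
Proof. by move=> i1 i2; exact: (@integrableD _ _ _ P setT measurableT _ _ i1 i2). Qed.

Lemma intgB f g : intg f -> intg g -> intg (fun w => f w - g w).
Proof. by move=> i1 i2; exact: (@integrableB _ _ _ P setT measurableT _ _ i1 i2). Qed.

Lemma intgZ c f : intg f -> intg (fun w => c * f w).
Proof. by move=> i1; exact: (@integrableZl _ _ _ P setT measurableT c _ i1). Qed.

Lemma intg_norm f : intg f -> intg (fun w => `|f w|).
Proof. exact: integrable_norm. Qed.

Lemma intg_sum (I : Type) (r : seq I) (Q : pred I) (f : I -> T -> R) :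
  (forall i, Q i -> intg (f i)) -> intg (fun w => \sum_(i <- r | Q i) f i w).
Proof.
move=> fi; elim: r => [|i r IH].
  by rewrite (_ : (fun w => _) = cst 0); [exact: intg_cst|apply/funext => w; rewrite big_nil].
case: (boolP (Q i)) => Qi.
  rewrite (_ : (fun w => _) = (fun w => f i w + \sum_(i <- r | Q i) f i w)).
    by apply: intgD => //; exact: fi.
  by apply/funext => w; rewrite big_cons Qi.
by rewrite (_ : (fun w => _) = (fun w => \sum_(i <- r | Q i) f i w))//;
  apply/funext => w; rewrite big_cons (negbTE Qi).
Qed.

Lemma intg_indic A : measurable A -> intg (\1_A).
Proof.
move=> mA; apply: (@intg_bdd _ 1).
  by apply: measurable_indic.
by move=> w; rewrite indicE; case: (_ \in _); rewrite ?normr1 ?normr0.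
Qed.

Lemma intg_fin f : intg f -> (\int[P]_w (f w)%:E)%E \is a fin_num.
Proof. exact: integrable_fin_num. Qed.

Lemma ExE f : intg f -> (\int[P]_w (f w)%:E)%E = (Ex f)%:E.
Proof. by move=> fi; rewrite /Ex fineK// intg_fin. Qed.

Lemma eq_Ex f g : f =1 g -> Ex f = Ex g.
Proof. by move=> fg; congr Ex; apply/funext. Qed.

Lemma Ex_cst c : Ex (cst c) = c.
Proof.
rewrite /Ex -[(\int[P]_w _)%E]/(\int[P]_(w in setT) cst c%:E w)%E integral_cst//=.
by rewrite -[P _]/(P setT) probability_setT mule1.
Qed.

Lemma ExD f g : intg f -> intg g -> Ex (fun w => f w + g w) = Ex f + Ex g.
Proof. by move=> i1 i2; exact: (@RintegralD _ _ _ P setT f g measurableT). Qed.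

Lemma ExB f g : intg f -> intg g -> Ex (fun w => f w - g w) = Ex f - Ex g.
Proof. by move=> i1 i2; exact: (@RintegralB _ _ _ P setT f g measurableT). Qed.

Lemma ExZ c f : intg f -> Ex (fun w => c * f w) = c * Ex f.
Proof. by move=> i1; exact: (@RintegralZl _ _ _ P setT f c measurableT). Qed.

Lemma Ex_sum (I : Type) (r : seq I) (Q : pred I) (f : I -> T -> R) :
  (forall i, Q i -> intg (f i)) ->
  Ex (fun w => \sum_(i <- r | Q i) f i w) = \sum_(i <- r | Q i) Ex (f i).
Proof.
move=> fi; elim: r => [|i r IH].
  rewrite big_nil -[RHS](Ex_cst 0); apply: eq_Ex => w; rewrite big_nil//.
rewrite big_cons; case: (boolP (Q i)) => Qi.
  rewrite -IH -ExD; [|exact: fi|exact: intg_sum].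
  by apply: eq_Ex => w; rewrite big_cons Qi.
by rewrite -IH; apply: eq_Ex => w; rewrite big_cons (negbTE Qi).
Qed.

Lemma Ex_le f g : intg f -> intg g -> (forall w, f w <= g w) -> Ex f <= Ex g.
Proof. by move=> i1 i2 fg; apply: le_Rintegral. Qed.

Lemma Ex_ge0 f : (forall w, 0 <= f w) -> 0 <= Ex f.
Proof. by move=> f0; apply: Rintegral_ge0. Qed.

Lemma Ex_abs_le f g : measurable_fun setT f -> intg g -> (forall w, `|f w| <= g w) ->
  `|Ex f| <= Ex g.
Proof.
move=> mf ig fg; have fi := intg_le mf ig fg.
rewrite ler_norml -mulN1r -ExZ//; apply/andP; split; apply: Ex_le => //.
- exact: intgZ.
- by move=> w; rewrite mulN1r; have := fg w; rewrite ler_norml => /andP[].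
- by move=> w; have := fg w; rewrite ler_norml => /andP[].
Qed.

Lemma Ex_indic A : measurable A -> Ex (\1_A) = Pr A.
Proof. by move=> mA; rewrite /Ex integral_indic// setIT. Qed.

Lemma PrE A : measurable A -> P A = (Pr A)%:E.
Proof.
by move=> mA; rewrite /Pr fineK// fin_num_measure.
Qed.

Lemma Pr_ge0 A : 0 <= Pr A.
Proof. by rewrite fine_ge0. Qed.

Lemma Pr_setT : Pr setT = 1.
Proof. by rewrite /Pr probability_setT. Qed.

Lemma Pr_mono A B : measurable A -> measurable B -> A `<=` B -> Pr A <= Pr B.
Proof.
by move=> mA mB AB; rewrite -lee_fin -!PrE//; apply: le_measure => //; rewrite inE.
Qed.

Lemma Pr_le1 A : measurable A -> Pr A <= 1.
Proof. by move=> mA; rewrite -Pr_setT; apply: Pr_mono. Qed.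

Lemma Pr_cover (I : finType) (A : set T) (B : I -> set T) : measurable A ->
  (forall i, measurable (B i)) -> (forall w, A w -> exists i, B i w) ->
  Pr A <= \sum_i Pr (B i).
Proof.
move=> mA mB AB; rewrite -Ex_indic//.
under eq_bigr do rewrite -Ex_indic//.
rewrite -Ex_sum; last by move=> i _; exact: intg_indic.
apply: Ex_le; [exact: intg_indic|by apply: intg_sum => i _; exact: intg_indic|].
move=> w; rewrite indicE; case: (boolP (w \in A)) => [/set_mem /AB[i Bi]|_]; last first.
  by apply: sumr_ge0 => i _; rewrite indicE.
rewrite (bigD1 i)//= [X in X + _]indicE mem_set// lerDl.
by apply: sumr_ge0 => j _; rewrite indicE.
Qed.

Lemma Pr_setU (A B C : set T) : measurable A -> measurable B -> measurable C ->
  (forall w, A w -> B w \/ C w) -> Pr A <= Pr B + Pr C.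
Proof.
move=> mA mB mC AB.
have := @Pr_cover bool A (fun b => if b then B else C) mA; rewrite big_bool; apply.
  by case.
by move=> w /AB[]; [exists true|exists false].
Qed.

Lemma Pr_disj (I : finType) (A : set T) (B : I -> set T) : measurable A ->
  (forall i, measurable (B i)) -> (forall i, B i `<=` A) ->
  (forall i j w, B i w -> B j w -> i = j) ->
  \sum_i Pr (B i) <= Pr A.
Proof.
move=> mA mB AB dB; rewrite -Ex_indic//.
under eq_bigr do rewrite -Ex_indic//.
rewrite -Ex_sum; last by move=> i _; exact: intg_indic.
apply: Ex_le; [by apply: intg_sum => i _; exact: intg_indic|exact: intg_indic|].
move=> w; have [[i Bi]|nB] := pselect (exists i, B i w).
  rewrite (bigD1 i)//= big1 ?addr0; last first.
    move=> j ji; rewrite indicE memNset// => Bj; move: ji.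
    by rewrite (dB _ _ _ Bj Bi) eqxx.
  by rewrite !indicE !mem_set//; exact: (AB i).
rewrite big1; first by rewrite indicE.
by move=> i _; rewrite indicE memNset// => Bi; apply: nB; exists i.
Qed.

Lemma meas_le f g : measurable_fun setT f -> measurable_fun setT g ->
  measurable [set w | f w <= g w].
Proof.
move=> mf mg.
have -> : [set w | f w <= g w] = (fun w => g w - f w) @^-1` `[0, +oo[%classic.
  by apply/seteqP; split => w /=; rewrite in_itv/= andbT subr_ge0.
rewrite -[X in measurable X]setTI.
exact: (measurable_funB mg mf).
Qed.

Lemma meas_lt f g : measurable_fun setT f -> measurable_fun setT g ->
  measurable [set w | f w < g w].
Proof.
move=> mf mg.
have -> : [set w | f w < g w] = (fun w => g w - f w) @^-1` `]0, +oo[%classic.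
  by apply/seteqP; split => w /=; rewrite in_itv/= andbT subr_gt0.
rewrite -[X in measurable X]setTI.
exact: (measurable_funB mg mf).
Qed.

Lemma meas_itv f (a b : R) : measurable_fun setT f -> measurable [set w | a <= f w <= b].
Proof.
move=> mf; have -> : [set w | a <= f w <= b] = [set w | a <= f w] `&` [set w | f w <= b].
  by apply/seteqP; split => w /=; move/andP.
by apply: measurableI; apply: meas_le.
Qed.

Lemma Pr_markov f t : intg f -> (forall w, 0 <= f w) -> 0 < t ->
  Pr [set w | t <= f w] <= Ex f / t.
Proof.
move=> fi f0 t0.
have mA : measurable [set w | t <= f w] by apply: meas_le => //; exact: intg_meas.
rewrite -Ex_indic// mulrC -ExZ//; apply: Ex_le; [exact: intg_indic|exact: intgZ|].
move=> w; rewrite indicE; case: (boolP (w \in _)) => [|_].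
  by rewrite inE/= => tf; rewrite mulrC ler_pdivlMr// mul1r.
by rewrite mulr_ge0// invr_ge0 ltW.
Qed.

Lemma meas_lin (I : finType) (X : I -> {RV P >-> R}) (c : I -> R) (Q : pred I) :
  measurable_fun setT (fun w => \sum_(i | Q i) c i * X i w).
Proof.
have -> : (fun w => \sum_(i | Q i) c i * X i w) =
    (fun w => \sum_i (if Q i then c i * X i w else 0)).
  by apply/funext => w; rewrite big_mkcond.
by apply: measurable_sum => i; case: (Q i) => //; apply: measurable_funM.
Qed.

Definition indep (U V : T -> R) := forall A B : set R, measurable A -> measurable B ->
  Pr (U @^-1` A `&` V @^-1` B) = Pr (U @^-1` A) * Pr (V @^-1` B).

(** By independence the joint law agrees with the product of the marginal laws on measurable
    rectangles, hence everywhere. Integrability then comes from Tonelli's theorem and the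
    factorisation from Fubini's. *)
Lemma Ex_indep (U V : T -> R) (g h : R -> R) :
  measurable_fun setT U -> measurable_fun setT V -> indep U V ->
  measurable_fun setT g -> measurable_fun setT h ->
  intg (g \o U) -> intg (h \o V) ->
  intg (fun w => g (U w) * h (V w)) /\
  Ex (fun w => g (U w) * h (V w)) = Ex (g \o U) * Ex (h \o V).
Proof.
move=> mU mV UV mg mh igU ihV.
have mP (A : set R) (mA : measurable A) : measurable (U @^-1` A).
  by rewrite -[X in measurable X]setTI; apply: (mU measurableT A mA).
have mPV (A : set R) (mA : measurable A) : measurable (V @^-1` A).
  by rewrite -[X in measurable X]setTI; apply: (mV measurableT A mA).
have mW : measurable_fun setT (fun w => (U w, V w)) by exact: measurable_fun_pair.
pose U' : {RV P >-> R} := mfun_Sub (mem_set mU).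
pose V' : {RV P >-> R} := mfun_Sub (mem_set mV).
pose W : {RV P >-> (R * R)%type} := mfun_Sub (mem_set mW).
pose f (z : R * R) : \bar R := (g z.1 * h z.2)%:E.
have mf : measurable_fun setT f.
  apply/measurable_EFinP; apply: measurable_funM.
    by apply: measurableT_comp => //; exact: measurable_fst.
  by apply: measurableT_comp => //; exact: measurable_snd.
have mEg := proj2 (measurable_EFinP _ _) mg.
have mEh := proj2 (measurable_EFinP _ _) mh.
have dWE (A : set (R * R)) : measurable A -> distribution P W A = (distribution P U' \x distribution P V')%E A.
  move=> mA; apply/esym; apply: product_measure_unique => // C D mC mD.
  transitivity (P (U @^-1` C `&` V @^-1` D)) => //.
  rewrite PrE; last by apply: measurableI; [exact: mP|exact: mPV].
  by rewrite UV// EFinM -!PrE//; [exact: mPV|exact: mP].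
have iabs (Z : {RV P >-> R}) (k : R -> R) : measurable_fun setT (EFin \o k) -> intg (k \o Z) ->
    exists2 M : R, 0 <= M & (\int[distribution P Z]_y (`|k y|%R)%:E = M%:E)%E.
  move=> mk ik; exists (Ex (fun w => `|k (Z w)|)); first exact: Ex_ge0.
  rewrite (@ge0_integral_distribution _ _ _ _ _ P Z (fun y => (`|k y|%R)%:E))//.
    by rewrite -(ExE (intg_norm ik)).
  by apply: (@measurableT_comp _ _ _ _ _ _ abse _ (EFin \o k)).
have [Mg Mg0 MgE] := iabs U' g mEg igU.
have [Mh Mh0 MhE] := iabs V' h mEh ihV.
have ifp : (distribution P U' \x distribution P V')%E.-integrable setT f.
  apply/(integrable12ltyP _ _ mf).
  under eq_integral => x _.
    rewrite /f /=.
    under eq_integral do rewrite normrM EFinM.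
    rewrite ge0_integralZl//; last exact: (@measurableT_comp _ _ _ _ _ _ abse _ (EFin \o h)).
    rewrite MhE muleC.
    over.
  rewrite ge0_integralZl//; last exact: (@measurableT_comp _ _ _ _ _ _ abse _ (EFin \o g)).
  by rewrite MgE -EFinM ltry.
have ifW : intg (fun w => g (U w) * h (V w)).
  apply/integrableP; split.
    apply/measurable_EFinP; apply: measurable_funM.
      exact: (intg_meas igU).
    exact: (intg_meas ihV).
  have -> : (\int[P]_w `|(EFin \o (fun w => (g (U w) * h (V w))%R)) w| =
      \int[distribution P W]_z `|f z|)%E.
    rewrite (@ge0_integral_distribution _ _ _ _ _ P W (fun y => `|f y|%E))//.
    by apply: measurableT_comp.
  rewrite (eq_measure_integral (distribution P U' \x distribution P V')%E); last first.
    by move=> A mA _; exact: dWE.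
  by move/integrableP : ifp => [].
split=> //.
have EW : (\int[P]_w (g (U w) * h (V w))%:E =
    \int[(distribution P U' \x distribution P V')%E]_z f z)%E.
  transitivity (\int[distribution P W]_z f z)%E.
    by rewrite integral_distribution.
  by apply: eq_measure_integral => A mA _; exact: dWE.
have EFu := @integral_distribution _ _ _ _ _ P U' (EFin \o g) mEg igU.
have EFv := @integral_distribution _ _ _ _ _ P V' (EFin \o h) mEh ihV.
have intd (Z : {RV P >-> R}) (k : R -> R) (M : R) : measurable_fun setT (EFin \o k) ->
    (\int[distribution P Z]_y (`|k y|%R)%:E = M%:E)%E ->
    (distribution P Z).-integrable setT (EFin \o k).
  by move=> mk E; apply/integrableP; split => //; rewrite E ltry.
have ih' := intd _ _ _ mEh MhE.
have ig' := intd _ _ _ mEg MgE.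
have ihE : (\int[distribution P V']_y (h y)%:E)%E = (Ex (h \o V))%:E.
  by rewrite -(ExE ihV); exact: EFv.
have igE : (\int[distribution P U']_y (g y)%:E)%E = (Ex (g \o U))%:E.
  by rewrite -(ExE igU); exact: EFu.
rewrite {1}/Ex EW -integral12_prod_meas1// /fubini_F /f /=.
under eq_integral => x _.
  under eq_integral do rewrite EFinM.
  rewrite integralZl// ihE muleC.
  over.
by rewrite integralZl// igE /= mulrC.
Qed.

(** A pi-system argument. For fixed [B], the finite measures [P (E and X i in B)] and
    [P (X i in B) * P E] of [E] agree on the intersections of events of the single [X j] with [j] in
    [Q], hence on the sigma-algebra these generate, for which the sum is measurable. *)
Lemma indep_lin (I : finType) (X : I -> {RV P >-> R}) (c : I -> R) (Q : {set I}) i :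
  mutually_independent P X -> i \notin Q ->
  indep (fun w => \sum_(j in Q) c j * X j w) (X i).
Proof.
move=> iX iQ A B mA mB.
pose G := [set E : set T | exists S : I -> set R, (forall j, measurable (S j)) /\
  E = \bigcap_(j in [set` Q]) (X j @^-1` S j)].
have mXS j (S : set R) : measurable S -> measurable (X j @^-1` S).
  by move=> mS; rewrite -[X in measurable X]setTI; exact: (measurable_funP (X j)).
have Gm : G `<=` measurable.
  move=> E [S [mS ->]]; apply: fin_bigcap_measurable; first exact: finite_finset.
  by move=> j _; exact: mXS.
have GI : setI_closed G.
  move=> _ _ [S [mS ->]] [S' [mS' ->]]; exists (fun j => S j `&` S' j); split.
    by move=> j; exact: measurableI.
  by rewrite -bigcapI; apply: eq_bigcapr => j _.
have GT : G setT.
  exists (fun=> setT); split => //; apply/esym; rewrite -subTset => w _ j _ //.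
pose m1 := mrestr P (mXS i B mB).
pose m2 := mscale (NngNum (Pr_ge0 (X i @^-1` B))) P.
have m12 E : G E -> m1 E = m2 E.
  move=> [S [mS ->]].
  pose S' j := if j == i then B else S j.
  have mS' j : measurable (S' j) by rewrite /S'; case: ifP.
  have SS' j : j \in Q -> S' j = S j.
    by move=> jQ; rewrite /S'; case: eqP => // ji; rewrite ji in jQ; rewrite jQ in iQ.
  have := iX (i |: Q) S' mS'; rewrite big_setU1//= {2}/S' eqxx.
  have -> : \bigcap_(j in [set` (i |: Q)%SET]) (X j @^-1` S' j) =
      \bigcap_(j in [set` Q]) (X j @^-1` S j) `&` X i @^-1` B.
    apply/seteqP; split => w /=.
      move=> h; split.
        by move=> j jQ; rewrite -(SS' j jQ); apply: h; exact: setU1r.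
      by have := h i (setU11 i Q); rewrite /S' /= eqxx.
    move=> [h hB] j /=; move=> /setU1P[->|jQ]; first by rewrite /S' eqxx.
    by rewrite /= SS'//; exact: h.
  rewrite /m1 /m2 /mrestr /mscale /= => ->; rewrite -PrE; last exact: (mXS i B mB).
  congr (_ * _)%E; rewrite (iX Q S mS); apply: eq_bigr => j jQ.
  by rewrite SS'.
have gcov : \bigcup_(k in (setT : set nat)) ((fun=> setT) k) = [set: T].
  by apply/seteqP; split => // w _; exists 0%N.
have mfin (k : nat) : (m1 ((fun=> setT) k) < +oo)%E.
  by rewrite /m1 /mrestr /= setTI PrE ?ltry//; exact: (mXS i B mB).
have U := @g_sigma_algebra_measure_unique _ R T G Gm (fun=> setT) (fun=> GT)
  gcov m1 m2 GI m12 mfin.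
have mS : <<s G >> ((fun w => \sum_(j in Q) c j * X j w) @^-1` A).
  have mXG (j : I) : j \in Q -> measurable_fun (setT : set (g_sigma_algebraType G)) (X j).
    move=> jQ _ S mS; rewrite setTI; apply: (@sub_sigma_algebra T setT G).
    exists (fun k => if k == j then S else setT); split; first by move=> k; case: ifP.
    apply/seteqP; split => w /=.
      by move=> h k _ /=; case: eqP => // ->.
    by move=> /(_ j jQ); rewrite /= eqxx.
  have := @meas_lin_on _ (g_sigma_algebraType G) R I (fun j => X j) c Q mXG.
  by move=> /(_ measurableT A mA); rewrite setTI.
have E := U _ mS.
have mP : measurable ((fun w => \sum_(j in Q) c j * X j w) @^-1` A).
  exact: (smallest_sub (@sigma_algebra_measurable _ T) Gm) mS.
rewrite mulrC; apply: EFin_inj; rewrite EFinM -!PrE//.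
- by rewrite (PrE (mXS i B mB)); apply: E.
- exact: (mXS i B mB).
- by apply: measurableI => //; exact: (mXS i B mB).
Qed.

End Expectation.

(** * Anticoncentration *)

Section PeelArith.
Variable R : realFieldType.

Lemma cell_bounds (rho u wd m : R) : m * wd <= u + rho -> u + rho < (m + 1) * wd ->
  (- rho + m * wd <= u) && (u < - rho + m * wd + wd).
Proof. by move=> *; apply/andP; split; lra. Qed.

Lemma cell_dist (u y r n um : R) : `|u + y| <= r -> r <= n / 4 -> um <= u ->
  u < um + n / 4 -> `|(u + y) - (u - um)| <= n * (1/2).
Proof.
move=> h1 h2 h3 h4; rewrite (le_trans (ler_normB _ _))// [X in _ + X]ger0_norm; last by lra.
by lra.
Qed.

Lemma cell_lt (rho u wd i j : R) : - rho + i * wd <= u -> u < - rho + j * wd + wd ->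
  i * wd < (j + 1) * wd.
Proof. by move=> *; lra. Qed.

Lemma cell_range (rho u : R) : - rho <= u -> u <= rho -> 0 <= u + rho <= 2 * rho.
Proof. by move=> *; apply/andP; split; lra. Qed.

Lemma geom_step (q t A : R) : q < 1 ->
  q * (A + t / (1 - q)) + t = q * A + t / (1 - q).
Proof. by move=> q1; field; apply: lt0r_neq0; lra. Qed.

End PeelArith.

Section Moments.
Context d (T : measurableType d) (R : realType) (P : probability T R).
Implicit Types (X U : T -> R) (p C : R).

Record std_moments p C X : Prop := StdMoments {
  std_meas : measurable_fun setT X;
  std_intg : intg P X;
  std_intg2 : intg P (fun w => X w ^+ 2);
  std_intgp : intg P (fun w => `|X w| `^ p);
  std_Ex : Ex P X = 0;
  std_Ex2 : Ex P (fun w => X w ^+ 2) = 1;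
  std_Exp : Ex P (fun w => `|X w| `^ p) <= C }.

Lemma sqr_le_truncated (p L x : R) : 2 <= p -> 0 < L -> L < `|x| ->
  x ^+ 2 * L `^ (p - 2) <= `|x| `^ p.
Proof.
move=> p2 L0 Lx; have x0 : 0 < `|x| by exact: lt_trans Lx.
have -> : `|x| `^ p = `|x| `^ (2%:R + (p - 2)) by congr (_ `^ _); ring.
rewrite [leRHS]powRD; last by apply/implyP => _; rewrite gt_eqF.
rewrite powR_mulrn ?normr_ge0// real_normK ?num_real// ler_wpM2l ?sqr_ge0//.
by rewrite ge0_ler_powR ?nnegrE ?subr_ge0// ltW.
Qed.

End Moments.

(* A variable concentrated near [x] has variance coming from a small event,
   which the moment of order [p > 2] forbids. *)
Lemma Pr_concentration (R : realType) (p C : R) : 2 < p -> 1 <= C -> exists2 q, 0 < q < 1 &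
  forall d (T : measurableType d) (P : probability T R) (X : T -> R),
    std_moments P p C X -> forall x, Pr P [set w | `|X w - x| <= 1/2] <= q.
Proof.
(* With [L ^ (p - 2) = 16 C], the part of the second moment coming from [|X| > L] is at most
   [1/16]. *)
move=> p2 C1; pose L := (16 * C) `^ (p - 2)^-1.
have C0 : 0 < 16 * C by rewrite mulr_gt0//; lra.
have L0 : 0 < L by rewrite powR_gt0.
have Lp : L `^ (p - 2) = 16 * C.
  by rewrite /L -powRrM mulVf ?powRr1 ?ltW//; apply: lt0r_neq0; lra.
have L1 : 1 <= L.
  have : 1 `^ (p - 2)^-1 <= L.
    by apply: ge0_ler_powR; rewrite ?nnegrE ?invr_ge0//; lra.
  by rewrite powR1.
have L2 : 1 <= L ^+ 2 by rewrite exprn_ege1.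
exists (1 - (16 * L ^+ 2)^-1).
  have : 0 < (16 * L ^+ 2)^-1 by rewrite invr_gt0; lra.
  have : (16 * L ^+ 2)^-1 <= 1/16.
    by rewrite div1r lef_pV2 ?posrE; lra.
  by move=> h1 h2; apply/andP; split; lra.
move=> d T P X [mX iX iX2 iXp EX EX2 EXp] x.
set A := [set w | _].
have mA : measurable A.
  apply: meas_le => //; apply: measurableT_comp => //.
  by apply: measurable_funB.
rewrite leNgt; apply/negP => hA.
pose B := ~` A; have mB : measurable B by exact: measurableC.
have AB : 1 <= Pr P A + Pr P B.
  rewrite -(Pr_setT P); apply: Pr_setU => // w _; have [|] := pselect (A w); by [left|right].
have iA := intg_indic P mA; have iB := intg_indic P mB.
have AB' : Pr P A + Pr P B = 1.
  rewrite -!Ex_indic// -ExD// -[RHS](Ex_cst P 1); apply: eq_Ex => w.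
  by rewrite /B !indicE in_setC; case: (w \in A); rewrite /= ?addr0 ?add0r.
have PB : Pr P B < (16 * L ^+ 2)^-1 by lra.
have PB0 := Pr_ge0 P B.
have PB2 : L ^+ 2 * Pr P B <= 1/16.
  have : 16 * L ^+ 2 * Pr P B <= 16 * L ^+ 2 * (16 * L ^+ 2)^-1 by rewrite ler_wpM2l; lra.
  by rewrite divff; [lra|apply: lt0r_neq0; lra].
have PB3 : Pr P B <= 1/16.
  by have := ler_wpM2r PB0 L2; lra.
have E1 : Ex P (fun w => X w ^+ 2 + (x ^+ 2 + (- (2 * x)) * X w)) = 1 + x ^+ 2.
  rewrite ExD//; last by apply: intgD; [exact: intg_cst|exact: intgZ].
  rewrite ExD//; [|exact: intg_cst|exact: intgZ].
  have := ExZ (- (2 * x)) iX; rewrite EX mulr0 => ->.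
  by rewrite EX2 addr0 (Ex_cst P (x ^+ 2)).
have E2 : Ex P (fun w => 1/4 + ((2 * (L ^+ 2 + x ^+ 2)) * \1_B w + (1 / (8 * C)) * `|X w| `^ p)) <=
    1/4 + (2 * (L ^+ 2 + x ^+ 2) * Pr P B + (1 / (8 * C)) * C).
  rewrite ExD//; [|exact: intg_cst|by apply: intgD; exact: intgZ].
  rewrite (Ex_cst P (1/4)) lerD2l ExD//; [|exact: intgZ|exact: intgZ].
  rewrite !ExZ// Ex_indic// lerD2l ler_wpM2l// divr_ge0//; lra.
(* The left side is the second moment of [X - x]. On [A] its integrand is at most [1/4]; off [A] it
   is at most [2 X ^ 2 + 2 x ^ 2], where [X ^ 2] is split at the level [L]. As [Pr B] is below
   [1 / (16 L ^ 2)], the right side is at most [1/2 + x ^ 2 / 8], a contradiction. *)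
have : 1 + x ^+ 2 <= 1/4 + (2 * (L ^+ 2 + x ^+ 2) * Pr P B + (1 / (8 * C)) * C).
  rewrite -E1 (le_trans _ E2)//; apply: Ex_le.
  - by apply: intgD => //; apply: intgD; [exact: intg_cst|exact: intgZ].
  - by apply: intgD; [exact: intg_cst|apply: intgD; exact: intgZ].
  move=> w; have Xp0 : 0 <= (1 / (8 * C)) * `|X w| `^ p.
    by rewrite mulr_ge0 ?powR_ge0// divr_ge0//; lra.
  have -> : X w ^+ 2 + (x ^+ 2 + (- (2 * x)) * X w) = (X w - x) ^+ 2 by ring.
  rewrite /B indicE in_setC; case: (boolP (w \in A)) => [|] /=.
    rewrite inE /A /= => h; rewrite mulr0 add0r.
    have : (X w - x) ^+ 2 <= 1/4.
      by rewrite -(@real_normK _ (X w - x)) ?num_real// expr2;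
        have := ler_pM (normr_ge0 _) (normr_ge0 _) h h; lra.
    lra.
  move=> _; rewrite mulr1.
  have h1 : (X w - x) ^+ 2 <= 2 * (X w ^+ 2 + x ^+ 2).
    by have := sqr_ge0 (X w + x); rewrite !expr2; lra.
  suff : X w ^+ 2 <= L ^+ 2 + 1 / (16 * C) * `|X w| `^ p.
    have -> : 1 / (8 * C) * `|X w| `^ p = 2 * (1 / (16 * C) * `|X w| `^ p).
      by field; apply: lt0r_neq0; lra.
    lra.
  have [XL|LX] := leP `|X w| L.
    have : X w ^+ 2 <= L ^+ 2.
      by rewrite -(@real_normK _ (X w)) ?num_real// lerXn2r ?nnegrE// ltW.
    have : 0 <= 1 / (16 * C) * `|X w| `^ p by rewrite mulr_ge0 ?powR_ge0// divr_ge0//; lra.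
    lra.
  have := sqr_le_truncated (ltW p2) L0 LX; rewrite Lp => h2.
  have : X w ^+ 2 <= 1 / (16 * C) * `|X w| `^ p.
    by rewrite div1r mulrC ler_pdivlMr.
  by have := sqr_ge0 L; lra.
have -> : 1 / (8 * C) * C = 1/8 by field; apply: lt0r_neq0; lra.
have : x ^+ 2 * Pr P B <= x ^+ 2 * (1/16) by rewrite ler_wpM2l ?sqr_ge0.
by have := sqr_ge0 x; lra.
Qed.

(** * Peeling off one coefficient at a time *)

Section Peel.
Context d (T : measurableType d) (R : realType) (P : probability T R).

(** The range of [U] is cut into cells of width [|c| / 4]. On one cell the event confines [X] to
    within [1/2] of a fixed point, which by independence gives a factor [q]; the disjoint cells add
    up to the event [|U| <= rho]. *)
Lemma Pr_peel U X (c r rho q : R) : measurable_fun setT U -> measurable_fun setT X ->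
  indep P U X -> c != 0 -> 0 <= rho -> r <= `|c| / 4 -> 0 <= q ->
  (forall x, Pr P [set w | `|X w - x| <= 1/2] <= q) ->
  Pr P ([set w | `|U w + c * X w| <= r] `&` [set w | `|U w| <= rho]) <=
    q * Pr P [set w | `|U w| <= rho].
Proof.
move=> mU mX UX c0 rho0 rc q0 qX.
have nc0 : 0 < `|c| by rewrite normr_gt0.
pose wd := `|c| / 4; have wd0 : 0 < wd by rewrite divr_gt0.
pose N := (Num.truncn (2 * rho / wd)).+1.
have Nrho : 2 * rho < N%:R * wd by rewrite -ltr_pdivrMr// truncnS_gt.
pose u (m : 'I_N) := - rho + m%:R * wd.
(* Half-open to make the cells disjoint, and cut at [rho] to keep them inside the event on the
   right-hand side. *)
pose J (m : 'I_N) : set R := `[u m, u m + wd[%classic `&` `[- rho, rho]%classic.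
pose V (m : 'I_N) : set R := `[- (u m / c) - 1/2, - (u m / c) + 1/2]%classic.
have mJ m : measurable (J m) by apply: measurableI.
have mV m : measurable (V m) by exact: measurable_itv.
have mpU (A : set R) : measurable A -> measurable (U @^-1` A).
  by move=> mA; rewrite -[X in measurable X]setTI; apply: mU.
have mpX (A : set R) : measurable A -> measurable (X @^-1` A).
  by move=> mA; rewrite -[Y in measurable Y]setTI; apply: mX.
have mnU : measurable [set w | `|U w| <= rho].
  by apply: meas_le => //; apply: measurableT_comp.
apply: (@le_trans _ _ (\sum_m Pr P (U @^-1` J m `&` X @^-1` V m))).
  apply: Pr_cover.
  - apply: measurableI => //; apply: meas_le => //; apply: measurableT_comp => //.
    by apply: measurable_funD => //; apply: measurable_funM.
  - by move=> m; apply: measurableI; [exact: mpU|exact: mpX].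
  move=> w [/= h1 h2].
  have h2' : - rho <= U w <= rho by rewrite -ler_norml.
  move/andP: h2' => [h2a h2b].
  have /andP[h3 h4] := cell_range h2a h2b.
  have t0 : 0 <= (U w + rho) / wd by rewrite divr_ge0// ltW.
  have tN : (Num.truncn ((U w + rho) / wd) < N)%N.
    by rewrite ltnS; apply: le_truncn; rewrite ler_pM2r ?invr_gt0.
  exists (Ordinal tN); rewrite /J /V /u /=.
  set m := Num.truncn _; have /andP[m1 m2] := truncn_itv t0.
  rewrite -/m ler_pdivlMr// in m1; rewrite -/m ltr_pdivrMr// -natr1 in m2.
  have /andP[m3 m4] := cell_bounds m1 m2.
  split; first by split; rewrite /= in_itv/= ?m3 ?m4 ?h2a ?h2b.
  rewrite /= in_itv /= -ler_distl -(@ler_pM2l _ `|c|)// -normrM.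
  have -> : c * (X w - - ((- rho + m%:R * wd) / c)) =
     (U w + c * X w) - (U w - (- rho + m%:R * wd)) by field.
  exact: (cell_dist h1 rc m3 m4).
have -> : \sum_m Pr P (U @^-1` J m `&` X @^-1` V m) =
    \sum_m Pr P (U @^-1` J m) * Pr P (X @^-1` V m).
  by apply: eq_bigr => m _; exact: UX.
apply: (@le_trans _ _ (\sum_m q * Pr P (U @^-1` J m))).
  apply: ler_sum => m _; rewrite mulrC ler_wpM2r ?Pr_ge0//.
  have -> : X @^-1` V m = [set w | `|X w - - (u m / c)| <= 1/2].
    by apply/seteqP; split => w; rewrite /V /= in_itv /= -ler_distl.
  exact: qX.
rewrite -mulr_sumr ler_wpM2l//; apply: Pr_disj => //.
- by move=> m; exact: mpU.
- by move=> m w [_]; rewrite /= in_itv/= -ler_norml.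
move=> i j w [/= + _] [/= + _]; rewrite !in_itv /= /u => /andP[i1 i2] /andP[j1 j2].
have lt_cell (m m' : nat) : m%:R * wd < (m'%:R + 1) * wd -> (m <= m')%N.
  by rewrite ltr_pM2r// natr1 ltr_nat ltnS.
apply/val_inj/eqP; rewrite /= eqn_leq.
by rewrite (lt_cell _ _ (cell_lt i1 j2)) (lt_cell _ _ (cell_lt j1 i2)).
Qed.

(** The chosen coefficients are added in decreasing order of size. If the partial sum including
    [c (i l)] is at most [|c (i l)| / 4] and [|X (i l)| <= beta], lacunarity makes the preceding
    partial sum at most [|c (i (l - 1))| / 4]. So each step multiplies the probability by [q] and
    adds [t], and the [t] form a geometric series. *)
Lemma Pr_anticoncentration (I : finType) (X : I -> {RV P >-> R}) (c : I -> R)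
    (i : nat -> I) (K : nat) (q beta t : R) :
  mutually_independent P X -> (0 < K)%N ->
  (forall l l', (l < K)%N -> (l' < K)%N -> i l = i l' -> l = l') ->
  0 <= beta -> 0 <= q < 1 -> 0 <= t ->
  (forall j x, Pr P [set w | `|X j w - x| <= 1/2] <= q) ->
  (forall j, Pr P [set w | beta < `|X j w|] <= t) ->
  (forall l, (l < K)%N -> c (i l) != 0) ->
  (forall l, (l.+1 < K)%N -> (4 * beta + 1) * `|c (i l.+1)| <= `|c (i l)|) ->
  Pr P [set w | `|\sum_j c j * X j w| <= `|c (i K.-1)| / 4] <= q ^+ K + t / (1 - q).
Proof.
move=> iX K0 inj_i beta0 /andP[q0 q1] t0 qX tX c0 cc.
(* [Q l] contains all indices outside the chain together with [i 0], ..., [i (l - 1)]. *)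
pose Q l : {set I} := [set j | [forall l' : 'I_K, (l <= l')%N ==> (i l' != j)]]%SET.
pose S l w := \sum_(j in Q l) c j * X j w.
(* At [l = 0] there is no preceding coefficient, and the value is just large enough for the first
   step. *)
pose r l : R := if l is l'.+1 then `|c (i l')| / 4 else `|c (i 0%N)| / 4 + beta * `|c (i 0%N)|.
have iQ l : (l < K)%N -> i l \notin Q l.
  move=> lK; rewrite inE; apply/forallPn; exists (Ordinal lK).
  by rewrite negb_imply leqnn /= eqxx.
have QS l : (l < K)%N -> Q l.+1 = i l |: Q l.
  move=> lK; apply/setP => j; rewrite !inE; apply/forallP/orP.
    move=> h; have [->|ji] := eqVneq j (i l); [by left|right].
    apply/forallP => l'; apply/implyP; rewrite leq_eqVlt => /orP[/eqP ll'|ll'].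
      by rewrite -ll' eq_sym.
    exact: (implyP (h l')).
  case=> [/eqP ->|/forallP h] l'; apply/implyP => ll'; last first.
    by apply: (implyP (h l')); exact: ltnW.
  apply/eqP => /inj_i; move/(_ (ltn_ord l') lK) => E; by rewrite E ltnn in ll'.
have SS l w : (l < K)%N -> S l.+1 w = S l w + c (i l) * X (i l) w.
  by move=> lK; rewrite /S QS// big_setU1 ?iQ//= addrC.
have mS l : measurable_fun setT (S l) by exact: meas_lin.
have mHS l : measurable [set w | `|S l w| <= r l].
  by apply: meas_le => //; apply: measurableT_comp.
have mXb j : measurable [set w | beta < `|X j w|].
  by apply: meas_lt => //; apply: measurableT_comp.
have r0 l : 0 <= r l by case: l => [|l] /=; rewrite ?addr_ge0 ?mulr_ge0 ?divr_ge0.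
have rc l : (l < K)%N -> `|c (i l)| / 4 + beta * `|c (i l)| <= r l.
  case: l => [|l] lK; first by rewrite /=.
  by rewrite /=; have := cc _ lK; lra.
have key l : (l <= K)%N -> Pr P [set w | `|S l w| <= r l] <= q ^+ l + t / (1 - q).
  elim: l => [|l IH] lK.
    rewrite expr0; apply: (le_trans (Pr_le1 P (mHS 0%N))).
    by rewrite lerDl; apply: divr_ge0 => //; rewrite subr_ge0 ltW.
  have mE : measurable ([set w | `|S l w + c (i l) * X (i l) w| <= r l.+1]
       `&` [set w | `|S l w| <= r l]).
    apply: measurableI => //; apply: meas_le => //; apply: measurableT_comp => //.
    by apply: measurable_funD => //; apply: measurable_funM.
  apply: (@le_trans _ _ (Pr P ([set w | `|S l w + c (i l) * X (i l) w| <= r l.+1]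
       `&` [set w | `|S l w| <= r l]) + Pr P [set w | beta < `|X (i l) w|])).
    apply: Pr_setU => // w /= h; have [hb|hb] := ltP beta `|X (i l) w|; first by right.
    left; split; first by rewrite /= -SS.
    have -> : S l w = S l.+1 w - c (i l) * X (i l) w by rewrite SS// addrK.
    rewrite (le_trans (ler_normB _ _))// (le_trans _ (rc l lK))//.
    by rewrite lerD// normrM mulrC ler_wpM2r.
  have H := @Pr_peel (S l) (X (i l)) (c (i l)) (r l.+1) (r l) q (mS l) (measurable_funP _)
    (indep_lin c iX (iQ l lK)) (c0 l lK) (r0 l) (lexx _) q0 (qX (i l)).
  have H2 := ler_wpM2l q0 (IH (ltnW lK)).
  have -> : q ^+ l.+1 + t / (1 - q) = q * (q ^+ l + t / (1 - q)) + t.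
    by rewrite exprS geom_step.
  exact: lerD (le_trans H H2) (tX _).
have QK : Q K = [set: I]%SET.
  by apply/setP => j; rewrite !inE; apply/forallP => l'; rewrite leqNgt ltn_ord.
have SE w : S K w = \sum_j c j * X j w.
  by rewrite /S QK; apply: eq_bigl => j; rewrite inE.
have := key K (leqnn _); rewrite (_ : r K = `|c (i K.-1)| / 4); last by rewrite -(prednK K0).
by under eq_fun do rewrite SE.
Qed.

End Peel.

(** * Taylor bounds and characteristic functions *)

Section TaylorTrig.
Variable R : realType.
Implicit Types (x s t p : R).

(** Applied repeatedly, it turns [cos <= 1] into the trigonometric Taylor bounds below, each
    difference being the derivative of the next one. *)
Lemma ge0_of_deriv (f df : R -> R) : (forall x, is_derive x 1 f (df x)) ->
  (forall x, 0 <= x -> 0 <= df x) -> 0 <= f 0 -> forall x, 0 <= x -> 0 <= f x.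
Proof.
move=> fd df0 f0 x x0.
have cf : {within `[0, x], continuous f}.
  apply: continuous_subspaceT => z; apply: differentiable_continuous.
  by apply/derivable1_diffP; have [] := fd z.
have [c] := @MVT_segment R f df 0 x x0 (fun z _ => fd z) cf.
rewrite in_itv/= subr0 => /andP[c0 _] E.
have : 0 <= f x - f 0 by rewrite E mulr_ge0// df0.
by move=> h; lra.
Qed.

Lemma is_derive_pow n (c x : R) : is_derive x 1 (fun y : R => c * y ^+ n.+1) (c * (n.+1%:R * x ^+ n)).
Proof.
have -> : (fun y : R => c * y ^+ n.+1) = c \*: ((@id R) ^+ n.+1).
  by apply/funext => y; rewrite /= exprfctE.
have H := @is_deriveZ _ _ _ _ c x 1 _ (@is_deriveX _ _ (@id R) n.+1 x 1 1 (is_derive_id x 1)).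
by apply: (is_derive_eq H); rewrite /GRing.scale /= mulr1 mulr_natl.
Qed.

Lemma derD (f g : R -> R) (a b x : R) : is_derive x 1 f a -> is_derive x 1 g b ->
  is_derive x 1 (fun y => f y + g y) (a + b).
Proof. exact: is_deriveD. Qed.

Lemma derN (f : R -> R) (a x : R) : is_derive x 1 f a -> is_derive x 1 (fun y => - f y) (- a).
Proof. exact: is_deriveN. Qed.

Lemma derZ (c : R) (f : R -> R) (a x : R) : is_derive x 1 f a ->
  is_derive x 1 (fun y => c * f y) (c * a).
Proof. exact: is_deriveZ. Qed.

Lemma der_eq (f g : R -> R) (a b x : R) : is_derive x 1 f a -> f =1 g -> a = b ->
  is_derive x 1 g b.
Proof. by move=> H /funext <- <-. Qed.

Lemma derid (x : R) : is_derive x 1 (fun y : R => y) 1.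
Proof. exact: is_derive_id. Qed.

Lemma dercst (c x : R) : is_derive x 1 (fun y : R => c) 0.
Proof. exact: is_derive_cst. Qed.

Lemma sin_lex x : 0 <= x -> sin x <= x.
Proof.
move=> x0; rewrite -subr_ge0.
have H (y : R) : is_derive y 1 (fun y => y - sin y) ((fun y => 1 - cos y) y).
  exact: (derD (derid y) (derN (is_derive_sin y))).
suff [H0 H1] : 0 <= (fun y : R => y - sin y) 0 /\ (forall y : R, 0 <= y -> 0 <= (fun y : R => 1 - cos y) y).
  exact: (ge0_of_deriv H H1 H0).
split => /=.
- by rewrite sin0 subr0.
- by move=> y _; rewrite subr_ge0 cos_le1.
Qed.

Lemma cos_ge_quad x : 0 <= x -> 1 - x ^+ 2 / 2 <= cos x.
Proof.
move=> x0; rewrite -subr_ge0.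
have H (y : R) : is_derive y 1 (fun y => cos y - (1 - y ^+ 2 / 2)) ((fun y => y - sin y) y).
  apply: (der_eq (derD (derD (is_derive_cos y) (is_derive_pow 1 2^-1 y)) (dercst (-1) y))).
    by move=> z /=; ring.
  by rewrite ?subr0 ?expr1; field.
suff [H0 H1] : 0 <= (fun y : R => cos y - (1 - y ^+ 2 / 2)) 0 /\ (forall y : R, 0 <= y -> 0 <= (fun y : R => y - sin y) y).
  exact: (ge0_of_deriv H H1 H0).
split => /=.
- by rewrite cos0 expr0n /=; lra.
- by move=> y y0; rewrite subr_ge0 sin_lex.
Qed.

Lemma sin_ge_cube x : 0 <= x -> x - x ^+ 3 / 6 <= sin x.
Proof.
move=> x0; rewrite -subr_ge0.
have H (y : R) : is_derive y 1 (fun y => sin y - (y - y ^+ 3 / 6)) ((fun y => cos y - (1 - y ^+ 2 / 2)) y).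
  apply: (der_eq (derD (derD (is_derive_sin y) (is_derive_pow 2 6^-1 y)) (derN (derid y)))).
    by move=> z /=; ring.
  by rewrite ?subr0 ?expr1; field.
suff [H0 H1] : 0 <= (fun y : R => sin y - (y - y ^+ 3 / 6)) 0 /\ (forall y : R, 0 <= y -> 0 <= (fun y : R => cos y - (1 - y ^+ 2 / 2)) y).
  exact: (ge0_of_deriv H H1 H0).
split => /=.
- by rewrite sin0 expr0n /=; lra.
- by move=> y y0; rewrite subr_ge0 cos_ge_quad.
Qed.

Lemma cos_le_quart x : 0 <= x -> cos x <= 1 - x ^+ 2 / 2 + x ^+ 4 / 24.
Proof.
move=> x0; rewrite -subr_ge0.
have H (y : R) : is_derive y 1 (fun y => 1 - y ^+ 2 / 2 + y ^+ 4 / 24 - cos y) ((fun y => sin y - (y - y ^+ 3 / 6)) y).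
  apply: (der_eq (derD (derD (derD (dercst 1 y) (is_derive_pow 1 (- 2^-1) y))
    (is_derive_pow 3 24^-1 y)) (derN (is_derive_cos y)))).
    by move=> z /=; ring.
  by rewrite ?subr0 ?expr1; field.
suff [H0 H1] : 0 <= (fun y : R => 1 - y ^+ 2 / 2 + y ^+ 4 / 24 - cos y) 0 /\ (forall y : R, 0 <= y -> 0 <= (fun y : R => sin y - (y - y ^+ 3 / 6)) y).
  exact: (ge0_of_deriv H H1 H0).
split => /=.
- by rewrite cos0 !expr0n /=; lra.
- by move=> y y0; rewrite subr_ge0 sin_ge_cube.
Qed.

Lemma is_derive_expRN (y : R) : is_derive y 1 (fun z : R => expR (- z)) (- expR (- y)).
Proof.
have := @is_derive1_comp R expR (fun z => - z) y _ _ (is_derive_expR _) (derN (derid y)).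
by rewrite mulrN1.
Qed.

Lemma expRN_quad s : 0 <= s -> 1 - s <= expR (- s) <= 1 - s + s ^+ 2 / 2.
Proof.
move=> s0; apply/andP; split; first by rewrite expR_ge1Dx.
rewrite -subr_ge0.
have H (y : R) : is_derive y 1 (fun y => 1 - y + y ^+ 2 / 2 - expR (- y)) ((fun y => y - 1 + expR (- y)) y).
  apply: (der_eq (derD (derD (derD (dercst 1 y) (derN (derid y)))
    (is_derive_pow 1 2^-1 y)) (derN (is_derive_expRN y)))).
    by move=> z /=; ring.
  by rewrite ?subr0 ?expr1; field.
suff [H0 H1] : 0 <= (fun y : R => 1 - y + y ^+ 2 / 2 - expR (- y)) 0 /\ (forall y : R, 0 <= y -> 0 <= (fun y : R => y - 1 + expR (- y)) y).
  exact: (ge0_of_deriv H H1 H0).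
split => /=.
- by rewrite !expr0n /= oppr0 expR0; lra.
- by move=> y y0; have := @expR_ge1Dx R (- y); lra.
Qed.

Lemma sqr_le_powR p t : 2 <= p -> 1 <= `|t| -> t ^+ 2 <= `|t| `^ p.
Proof.
move=> p2 t1; rewrite -real_normK ?num_real// -powR_mulrn//.
by apply: ler_powR.
Qed.

Lemma powR_le1_exp p q t : p <= q -> 0 < t <= 1 -> t `^ q <= t `^ p.
Proof.
move=> pq /andP[t0 t1]; rewrite /powR gt_eqF// ler_expR.
by rewrite ler_wnM2r// ln_le0.
Qed.

Lemma cube_le_powR p t : p <= 3 -> `|t| <= 1 -> `|t| ^+ 3 <= `|t| `^ p.
Proof.
move=> p3 t1; have [->|t0] := eqVneq `|t| 0; first by rewrite expr0n/= powR_ge0.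
by rewrite -powR_mulrn// powR_le1_exp// t1 lt0r t0 normr_ge0.
Qed.

(** The remainder is bounded by a square for [|t| >= 1] and by a cube for [|t| <= 1]; with
    [2 <= p <= 3] both are below [|t| ^ p] in their range. This is why the exponent is capped at
    3. *)
Lemma cos_taylor p t : 2 <= p <= 3 -> `|cos t - (1 - t ^+ 2 / 2)| <= `|t| `^ p.
Proof.
move=> /andP[p2 p3]; wlog t0 : t / 0 <= t.
  move=> H; have [/H//|/ltW tn] := leP 0 t.
  by have := H (- t); rewrite cosN sqrrN normrN oppr_ge0; exact.
have h1 := cos_ge_quad t0; have h2 := cos_le_quart t0.
rewrite ger0_norm; last by lra.
have [t1|t1] := leP 1 `|t|.
  by apply: le_trans (sqr_le_powR p2 t1); have := cos_le1 t; have := sqr_ge0 t; lra.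
apply: le_trans (cube_le_powR p3 (ltW t1)).
rewrite ger0_norm// in t1 *.
have : t ^+ 4 <= t ^+ 3 by rewrite exprSr ler_piMr ?exprn_ge0// ltW.
have : 0 <= t ^+ 4 by rewrite exprn_ge0.
lra.
Qed.

Lemma sin_taylor p t : 2 <= p <= 3 -> `|sin t - t| <= 2 * `|t| `^ p.
Proof.
move=> /andP[p2 p3]; wlog t0 : t / 0 <= t.
  move=> H; have [/H//|/ltW tn] := leP 0 t.
  have : 0 <= - t by rewrite oppr_ge0.
  by move/H; rewrite sinN normrN opprK -opprB normrN addrC.
have h1 := sin_lex t0; have h2 := sin_ge_cube t0.
rewrite ler0_norm; last by lra.
have [t1|t1] := leP 1 `|t|.
  have := sqr_le_powR p2 t1; rewrite ger0_norm// in t1 *.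
  have := sin_geN1 t; have : t * 1 <= t * t by rewrite ler_wpM2l.
  by rewrite -expr2; lra.
have := cube_le_powR p3 (ltW t1); rewrite ger0_norm//.
have : 0 <= t ^+ 3 by rewrite exprn_ge0.
lra.
Qed.

Lemma expR_taylor p c : 2 <= p <= 3 -> `|c| <= 1 ->
  `|expR (- (c ^+ 2 / 2)) - (1 - c ^+ 2 / 2)| <= `|c| `^ p.
Proof.
move=> /andP[p2 p3] c1.
have s0 : 0 <= c ^+ 2 / 2 by rewrite divr_ge0 ?sqr_ge0.
have /andP[h1 h2] := expRN_quad s0.
apply: le_trans (cube_le_powR p3 c1).
rewrite ger0_norm; last by lra.
have : `|c| ^+ 4 <= `|c| ^+ 3 by rewrite exprSr ler_piMr ?exprn_ge0.
have -> : `|c| ^+ 4 = (c ^+ 2) ^+ 2 by rewrite -(@real_normK _ c) ?num_real// -exprM.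
have E : (c ^+ 2 / 2) ^+ 2 = (c ^+ 2) ^+ 2 / 4 by field.
rewrite E in h2.
by have := sqr_ge0 (c ^+ 2); lra.
Qed.

End TaylorTrig.

(** * Characteristic functions and second moments of linear combinations *)

Section CharacteristicFunction.
Context d (T : measurableType d) (R : realType) (P : probability T R).
Implicit Types (X U : T -> R) (p C c th : R).

Lemma measurable_cos_lin (c th : R) : measurable_fun setT (fun x : R => cos (c * x + th)).
Proof.
apply: measurableT_comp; first exact: continuous_measurable_fun (@continuous_cos R).
by apply: measurable_funD => //; exact: measurable_funM.
Qed.

Lemma measurable_sin_lin (c th : R) : measurable_fun setT (fun x : R => sin (c * x + th)).
Proof.
apply: measurableT_comp; first exact: continuous_measurable_fun (@continuous_sin R).
by apply: measurable_funD => //; exact: measurable_funM.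
Qed.

Lemma norm_cos_le1 (x : R) : `|cos x| <= 1.
Proof. by rewrite ler_norml cos_geN1 cos_le1. Qed.

Lemma norm_sin_le1 (x : R) : `|sin x| <= 1.
Proof. by rewrite ler_norml sin_geN1 sin_le1. Qed.

Lemma intg_cos_lin X c th : measurable_fun setT X -> intg P (fun w => cos (c * X w + th)).
Proof.
move=> mX; apply: (@intg_bdd _ _ _ _ _ 1); last by move=> w; exact: norm_cos_le1.
exact: (measurableT_comp (measurable_cos_lin c th) mX).
Qed.

Lemma intg_sin_lin X c th : measurable_fun setT X -> intg P (fun w => sin (c * X w + th)).
Proof.
move=> mX; apply: (@intg_bdd _ _ _ _ _ 1); last by move=> w; exact: norm_sin_le1.
exact: (measurableT_comp (measurable_sin_lin c th) mX).
Qed.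

(** Both terms agree with [1 - c ^ 2 / 2] up to a multiple of [|c| ^ p], because the variance is
    1. *)
Lemma Ex_cos_single p C X c : 2 <= p <= 3 -> std_moments P p C X -> `|c| <= 1 ->
  `|Ex P (fun w => cos (c * X w + 0)) - expR (- (c ^+ 2 / 2))| <= (C + 1) * `|c| `^ p.
Proof.
move=> p23 [mX iX iX2 iXp EX EX2 EXp] c1.
have ic := @intg_cos_lin X c 0 mX.
have i2 : intg P (fun w => 1 - (c ^+ 2 / 2) * X w ^+ 2).
  by apply: intgB; [exact: intg_cst|exact: intgZ].
have E2 : Ex P (fun w => 1 - (c ^+ 2 / 2) * X w ^+ 2) = 1 - c ^+ 2 / 2.
  rewrite ExB ?(Ex_cst P 1)//; [|exact: intg_cst|exact: intgZ].
  by have := ExZ (c ^+ 2 / 2) iX2; rewrite EX2 mulr1 => ->.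
have H : `|Ex P (fun w => cos (c * X w + 0)) - (1 - c ^+ 2 / 2)| <= C * `|c| `^ p.
  rewrite -E2 -ExB//.
  apply: (@le_trans _ _ (Ex P (fun w => `|c| `^ p * `|X w| `^ p))).
    apply: Ex_abs_le => [| |w]; [exact: intg_meas (intgB ic i2)|exact: intgZ|].
    rewrite -powRM// -normrM addr0.
    have -> : c ^+ 2 / 2 * X w ^+ 2 = (c * X w) ^+ 2 / 2 by rewrite exprMn; ring.
    exact: cos_taylor.
  by rewrite ExZ// mulrC ler_wpM2r ?powR_ge0.
have H2 := expR_taylor p23 c1.
rewrite mulrDl mul1r.
set a := Ex _ _ in H *; set b := expR _ in H2 *; set t := 1 - _ in H H2.
have -> : a - b = (a - t) - (b - t) by ring.
by rewrite (le_trans (ler_normB _ _))// lerD.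
Qed.

Lemma Ex_sin_single p C X c : 2 <= p <= 3 -> std_moments P p C X ->
  `|Ex P (fun w => sin (c * X w + 0))| <= 2 * C * `|c| `^ p.
Proof.
move=> p23 [mX iX iX2 iXp EX EX2 EXp].
have ic := @intg_sin_lin X c 0 mX.
have E2 : Ex P (fun w => c * X w) = 0 by rewrite ExZ// EX mulr0.
have -> : Ex P (fun w => sin (c * X w + 0)) = Ex P (fun w => sin (c * X w + 0) - c * X w).
  by rewrite (ExB ic (intgZ c iX)) E2 subr0.
apply: (@le_trans _ _ (Ex P (fun w => (2 * `|c| `^ p) * `|X w| `^ p))).
  apply: Ex_abs_le => [| |w]; [|exact: intgZ|].
    exact: (intg_meas (intgB ic (intgZ c iX))).
  rewrite -mulrA -powRM// -normrM addr0; exact: sin_taylor.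
by rewrite ExZ// [leRHS]mulrAC ler_wpM2l// mulr_ge0// powR_ge0.
Qed.

(** One summand is replaced by its Gaussian factor. The free phase [th] lets real cosines do the
    work of complex exponentials; the addition formula brings in [E sin (c X)], which is of order
    [|c| ^ p] because the mean is 0. *)
Lemma Ex_cos_step p C U X c th : 2 <= p <= 3 -> 1 <= C -> std_moments P p C X ->
  `|c| <= 1 -> measurable_fun setT U -> indep P U X ->
  `|Ex P (fun w => cos (U w + c * X w + th)) -
     expR (- (c ^+ 2 / 2)) * Ex P (fun w => cos (1 * U w + th))| <= 4 * C * `|c| `^ p.
Proof.
move=> p23 C1 sX c1 mU UX; have mX := std_meas sX.
have iU1 := @intg_cos_lin U 1 th mU; have iU2 := @intg_sin_lin U 1 th mU.
have iX1 := @intg_cos_lin X c 0 mX; have iX2 := @intg_sin_lin X c 0 mX.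
have [j1 e1] := Ex_indep mU mX UX (measurable_cos_lin 1 th) (measurable_cos_lin c 0) iU1 iX1.
have [j2 e2] := Ex_indep mU mX UX (measurable_sin_lin 1 th) (measurable_sin_lin c 0) iU2 iX2.
have -> : Ex P (fun w => cos (U w + c * X w + th)) =
    Ex P (fun w => cos (1 * U w + th)) * Ex P (fun w => cos (c * X w + 0)) -
    Ex P (fun w => sin (1 * U w + th)) * Ex P (fun w => sin (c * X w + 0)).
  rewrite -[X in X - _]e1 -[X in _ - X]e2 -ExB//; apply: eq_Ex => w /=.
  by rewrite addrAC -cosD mul1r addr0.
have b1 : `|Ex P (fun w => cos (1 * U w + th))| <= 1.
  rewrite -[leRHS](Ex_cst P 1); apply: Ex_abs_le => [| |w]; [exact: (intg_meas iU1)|exact: (intg_cst P 1)|].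
  exact: norm_cos_le1.
have b2 : `|Ex P (fun w => sin (1 * U w + th))| <= 1.
  rewrite -[leRHS](Ex_cst P 1); apply: Ex_abs_le => [| |w]; [exact: (intg_meas iU2)|exact: (intg_cst P 1)|].
  exact: norm_sin_le1.
have h1 := Ex_cos_single p23 sX c1; have h2 := Ex_sin_single c p23 sX.
set a := Ex _ _ in b1 *; set b := Ex _ _ in h1 *; set a' := Ex _ _ in b2 *; set b' := Ex _ _ in h2 *.
set e := expR _ in h1 *.
have -> : a * b - a' * b' - e * a = a * (b - e) - a' * b' by ring.
rewrite (le_trans (ler_normB _ _))// !normrM.
apply: (@le_trans _ _ ((C + 1) * `|c| `^ p + 2 * C * `|c| `^ p)).
  by apply: lerD; [apply: le_trans h1|apply: le_trans h2]; rewrite ler_piMl.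
by rewrite -mulrDl ler_wpM2r ?powR_ge0//; lra.
Qed.

Lemma set_ind_card (I : finType) (K : {set I} -> Prop) : K (finset.set0) ->
  (forall i (Q : {set I}), i \notin Q -> K Q -> K (i |: Q)%SET) -> forall Q, K Q.
Proof.
move=> K0 KS Q; move: {2}#|Q| (erefl #|Q|) => n; elim: n Q => [|n IH] Q.
  by move/eqP; rewrite cards_eq0 => /eqP ->.
move=> Qn; have /card_gt0P[i iQ] : (0 < #|Q|)%N by rewrite Qn.
rewrite -(finset.setD1K iQ); apply: KS; first by rewrite !inE eqxx.
by apply: IH; move: Qn; rewrite (cardsD1 i) iQ => -[].
Qed.

Variables (I : finType) (X : I -> {RV P >-> R}) (p C : R).
Hypotheses (iX : mutually_independent P X) (p23 : 2 <= p <= 3) (C1 : 1 <= C).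
Hypothesis sX : forall i, std_moments P p C (X i).

(** The summands are replaced one after the other; the Gaussian factors are at most 1, so the errors
    add up without being magnified. *)
Lemma Ex_cos_lin_approx (c : I -> R) th : (forall i, `|c i| <= 1) -> forall Q : {set I},
  `|Ex P (fun w => cos (1 * (\sum_(i in Q) c i * X i w) + th)) -
    expR (- ((\sum_(i in Q) c i ^+ 2) / 2)) * cos th| <= 4 * C * \sum_(i in Q) `|c i| `^ p.
Proof.
move=> c1; apply: set_ind_card => [|i Q iQ IH].
  rewrite !big_set0 mul0r oppr0 expR0 mul1r mulr0.
  have -> : Ex P (fun w => cos (1 * (\sum_(i in finset.set0) c i * X i w) + th)) = cos th.
    rewrite -[RHS](Ex_cst P); apply: eq_Ex => w.
    by rewrite big_set0 mulr0 add0r.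
  by rewrite subrr normr0.
have mU : measurable_fun setT (fun w => \sum_(j in Q) c j * X j w) by exact: meas_lin.
have H := @Ex_cos_step p C _ (X i) (c i) th p23 C1 (sX i) (c1 i) mU (indep_lin c iX iQ).
have -> : Ex P (fun w => cos (1 * (\sum_(j in i |: Q) c j * X j w) + th)) =
    Ex P (fun w => cos (\sum_(j in Q) c j * X j w + c i * X i w + th)).
  by apply: eq_Ex => w; rewrite mul1r big_setU1//= [c i * _ + _]addrC.
rewrite !big_setU1//=.
set A := \sum_(j in Q) c j ^+ 2 in IH *.
rewrite (_ : - ((c i ^+ 2 + A) / 2) = - (c i ^+ 2 / 2) + - (A / 2)); last by field.
rewrite expRD.
set e := expR _ in H *; set f := expR _ in IH *.
set E1 := Ex _ _ in H *; set E2 := Ex _ _ in H IH.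
have -> : E1 - e * f * cos th = (E1 - e * E2) + e * (E2 - f * cos th) by ring.
rewrite [leRHS]mulrDr (le_trans (ler_normD _ _))// lerD// normrM.
apply: le_trans IH; rewrite ler_piMl// ger0_norm ?expR_ge0//.
by rewrite -expR0 ler_expR oppr_le0 divr_ge0// sqr_ge0.
Qed.

Lemma lin_moments (c : I -> R) (Q : {set I}) :
  [/\ intg P (fun w => \sum_(i in Q) c i * X i w),
      intg P (fun w => (\sum_(i in Q) c i * X i w) ^+ 2),
      Ex P (fun w => \sum_(i in Q) c i * X i w) = 0 &
      Ex P (fun w => (\sum_(i in Q) c i * X i w) ^+ 2) = \sum_(i in Q) c i ^+ 2].
Proof.
move: Q; apply: set_ind_card => [|i Q iQ [i1 i2 e1 e2]].
  have E0 : (fun w => \sum_(i in finset.set0) c i * X i w) = cst 0.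
    by apply/funext => w; rewrite big_set0.
  have E02 : (fun w => (\sum_(i in finset.set0) c i * X i w) ^+ 2) = cst 0.
    by apply/funext => w; rewrite big_set0 expr0n.
  rewrite E0 E02 big_set0 (Ex_cst P 0).
  by split => //; exact: intg_cst.
have [mX jX jX2 _ EX EX2 _] := sX i.
have mU : measurable_fun setT (fun w => \sum_(j in Q) c j * X j w) by exact: meas_lin.
have [j3 e3] := Ex_indep mU mX (indep_lin c iX iQ) (@measurable_id _ _ setT)
  (@measurable_id _ _ setT) i1 jX.
have e3' : Ex P (fun w => (\sum_(j in Q) c j * X j w) * X i w) = 0.
  by rewrite [LHS]e3 /= [X in X * _]e1 mul0r.
have E0 : (fun w => \sum_(j in i |: Q) c j * X j w) =
   (fun w => c i * X i w + \sum_(j in Q) c j * X j w).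
  by apply/funext => w; rewrite big_setU1.
have E02 : (fun w => (\sum_(j in i |: Q) c j * X j w) ^+ 2) =
   (fun w => c i ^+ 2 * X i w ^+ 2 + ((2 * c i) * ((\sum_(j in Q) c j * X j w) * X i w) +
      (\sum_(j in Q) c j * X j w) ^+ 2)).
  by apply/funext => w; rewrite big_setU1//=; ring.
rewrite E0 E02; split.
- by apply: intgD => //; exact: intgZ.
- by apply: intgD; [exact: intgZ|apply: intgD => //; exact: intgZ].
- by rewrite ExD ?ExZ ?EX ?mulr0 ?add0r//; exact: intgZ.
rewrite ExD; [|exact: intgZ|by apply: intgD => //; exact: intgZ].
rewrite ExD//; last exact: intgZ.
have := ExZ (c i ^+ 2) jX2; rewrite EX2 mulr1 => ->.
have := ExZ (2 * c i) j3; rewrite e3' mulr0 => ->.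
by rewrite add0r e2 big_setU1.
Qed.

Lemma Pr_lin_ge (c : I -> R) (t V : R) : 0 < t -> \sum_i c i ^+ 2 <= V ->
  Pr P [set w | t <= `|\sum_i c i * X i w|] <= V / t ^+ 2.
Proof.
move=> t0 cV; have [_ i2 _ e2] := lin_moments c [set: I]%SET.
have E w : \sum_(i in [set: I]%SET) c i * X i w = \sum_i c i * X i w.
  by apply: eq_bigl => i; rewrite inE.
have -> : [set w | t <= `|\sum_i c i * X i w|] =
    [set w | t ^+ 2 <= (\sum_(i in [set: I]%SET) c i * X i w) ^+ 2].
  apply/seteqP; split => w /=; rewrite E -(@real_normK _ (\sum_i c i * X i w)) ?num_real//;
    by rewrite ler_pXn2r// nnegrE (ltW t0).
apply: le_trans (Pr_markov i2 _ _) _; [by move=> w; exact: sqr_ge0|by rewrite exprn_gt0|].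
rewrite e2 ler_wpM2r ?invr_ge0 ?sqr_ge0//.
by rewrite (eq_bigl xpredT)// => i; rewrite inE.
Qed.

Lemma Pr_coef_gt (beta : R) i : 0 < beta ->
  Pr P [set w | beta < `|X i w|] <= (beta ^+ 2)^-1.
Proof.
move=> b0; have [mX iX0 iX2 _ _ EX2 _] := sX i.
rewrite -[leRHS]mul1r -EX2.
apply: le_trans (Pr_markov iX2 _ _); [|by move=> w; exact: sqr_ge0|by rewrite exprn_gt0].
apply: Pr_mono.
- by apply: meas_lt => //; apply: measurableT_comp.
- by apply: meas_le => //; exact: (intg_meas iX2).
move=> w /= /ltW h; rewrite -(@real_normK _ (X i w)) ?num_real//.
by rewrite lerXn2r ?nnegrE ?(ltW b0).
Qed.

End CharacteristicFunction.

Section StdIntro.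
Context d (T : measurableType d) (R : realType) (P : probability T R).

(** The exponent is lowered to at most 3 for the Taylor bounds. From
    [|x| ^ p <= 1 + |x| ^ (2 + eps)] the moment bound becomes [1 + C], which is moreover at least
    1. *)
Lemma std_moments_intro (C eps : R) (X : {RV P >-> R}) : 0 < eps ->
  ('E_P[X] = 0)%E -> ('V_P[X] = 1)%E -> ('E_P[fun w => (`|X w| `^ (2 + eps))%R] <= C%:E)%E ->
  std_moments P (Num.min (2 + eps) 3) (1 + C) X.
Proof.
move=> e0 EX VX EXp; have mX : measurable_fun setT X by exact: measurable_funP.
set p := Num.min _ _.
have mpow q : measurable_fun setT (fun w => `|X w| `^ q).
  apply: (@measurableT_comp _ _ _ _ _ _ (fun x : R => x `^ q)); first exact: measurable_powR.
  exact: measurableT_comp.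
have ipe : intg P (fun w => `|X w| `^ (2 + eps)).
  apply/integrableP; split; first exact/measurable_EFinP.
  rewrite unlock in EXp; apply: le_lt_trans (ltry C); apply: le_trans EXp.
  by under eq_integral do rewrite /= ger0_norm ?powR_ge0//.
have EXpR : Ex P (fun w => `|X w| `^ (2 + eps)) <= C.
  by rewrite -lee_fin -ExE//; rewrite unlock in EXp.
have C0 : 0 <= C by apply: le_trans EXpR; apply: Ex_ge0 => w; exact: powR_ge0.
have pe : p <= 2 + eps by rewrite /p ge_min lexx.
have p2 : 2 <= p by rewrite /p le_min; apply/andP; split; lra.
have bnd q w : 0 <= q -> q <= 2 + eps -> `|X w| `^ q <= 1 + `|X w| `^ (2 + eps).
  move=> q0 qe; have := powR_ge0 `|X w| (2 + eps); have [x1|x1] := leP 1 `|X w|.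
    by have := ler_powR x1 qe; lra.
  have : `|X w| `^ q <= 1 `^ q by rewrite ge0_ler_powR ?nnegrE// ltW.
  by rewrite powR1; lra.
have ib : intg P (fun w => 1 + `|X w| `^ (2 + eps)) by apply: intgD => //; exact: intg_cst.
have iX2 : intg P (fun w => X w ^+ 2).
  apply: (intg_le _ ib) => [|w]; first exact: measurable_funX.
  rewrite normrX -powR_mulrn//; apply: bnd; lra.
have iX1 : intg P X.
  apply: (intg_le _ ib) => // w; rewrite -[leLHS]powRr1//; apply: bnd; lra.
have ipp : intg P (fun w => `|X w| `^ p).
  apply: (intg_le _ ib) => // w; rewrite ger0_norm ?powR_ge0//; apply: bnd => //; lra.
have EX0 : Ex P X = 0 by apply: EFin_inj; rewrite -ExE//; move: EX; rewrite unlock.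
split => //.
- apply: EFin_inj; rewrite -ExE//; move: VX; rewrite /variance unlock EX => <-.
  rewrite unlock; apply: eq_integral => w _; congr EFin.
  by transitivity ((X w - 0) * (X w - 0)); first by rewrite subr0 expr2.
- apply: (@le_trans _ _ (Ex P (fun w => 1 + `|X w| `^ (2 + eps)))).
    by apply: Ex_le => // w; apply: bnd => //; lra.
  by rewrite ExD ?(Ex_cst P 1) ?lerD2l//; exact: intg_cst.
Qed.

End StdIntro.

(** * Gaussian integrals *)

Section Gaussian.
Variable R : realType.
Local Notation mu := (@lebesgue_measure R).
Implicit Types (f g : R -> R) (a b t u x : R).

Definition phi0 : R := (Num.sqrt (2 * pi))^-1.
Definition phi x : R := phi0 * expR (- (x ^+ 2 / 2)).
(** A Gaussian profile of variance 2, not normalised. It dominates [phi] times [|x|] or [x ^ 2] up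
    to a constant and serves as integrable majorant. *)
Definition wide x : R := expR (- (x ^+ 2 / 4)).

Lemma phi0_gt0 : 0 < phi0.
Proof. by rewrite invr_gt0 sqrtr_gt0 mulr_gt0// pi_gt0. Qed.

Lemma phi0_sqr : phi0 ^+ 2 = (2 * pi)^-1.
Proof. by rewrite /phi0 exprVn sqr_sqrtr// mulr_ge0// pi_ge0. Qed.

Lemma phi_pdf : phi = normal_pdf 0 1.
Proof.
apply/funext => x; rewrite normal_pdfE ?oner_eq0// /phi /phi0 /normal_peak /normal_fun.
rewrite expr1n mul1r subr0 mulrnAr; congr (_^-1 * expR _).
  by congr Num.sqrt; rewrite mulr_natl.
by rewrite mulNr.
Qed.

Lemma wide_pdf : wide = (fun x => Num.sqrt (4 * pi) * normal_pdf 0 (Num.sqrt 2) x).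
Proof.
have s2 : Num.sqrt 2 != 0 :> R by rewrite gt_eqF// sqrtr_gt0.
apply/funext => x; rewrite normal_pdfE// /wide /normal_peak /normal_fun subr0.
rewrite sqr_sqrtr// (_ : 2 * pi *+ 2 = 4 * pi); last by rewrite -mulr_natr; ring.
rewrite mulrA divff ?mul1r; last by rewrite gt_eqF// sqrtr_gt0 mulr_gt0// pi_gt0.
by congr expR; rewrite mulNr; congr (- (_ / _)); rewrite -mulr_natr; ring.
Qed.

Lemma phi_gt0 x : 0 < phi x. Proof. by rewrite mulr_gt0 ?phi0_gt0// expR_gt0. Qed.
Lemma phi_ge0 x : 0 <= phi x. Proof. exact: ltW (phi_gt0 x). Qed.
Lemma wide_ge0 x : 0 <= wide x. Proof. exact: expR_ge0. Qed.

Lemma phi_le x : phi x <= phi0.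
Proof.
rewrite ler_piMr ?(ltW phi0_gt0)// -expR0 ler_expR oppr_le0.
by rewrite divr_ge0// sqr_ge0.
Qed.

Lemma phi_0 : phi 0 = phi0.
Proof. by rewrite /phi expr0n /= mul0r oppr0 expR0 mulr1. Qed.

Lemma phi_ge x : phi0 * (1 - x ^+ 2 / 2) <= phi x.
Proof. by rewrite ler_wpM2l ?(ltW phi0_gt0)// expR_ge1Dx. Qed.

Lemma integrable_phi : mu.-integrable setT (EFin \o phi).
Proof. by rewrite phi_pdf; exact: integrable_normal_pdf. Qed.

Lemma integrable_wide : mu.-integrable setT (EFin \o wide).
Proof.
rewrite wide_pdf; apply: (@integrableZl _ _ _ mu setT measurableT (Num.sqrt (4 * pi))
  (EFin \o normal_pdf 0 (Num.sqrt 2))).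
exact: integrable_normal_pdf.
Qed.

Lemma integral_phi : Rintegral mu setT phi = 1.
Proof. by rewrite /Rintegral phi_pdf integral_normal_pdf. Qed.

Lemma integral_wide : Rintegral mu setT wide = Num.sqrt (4 * pi).
Proof.
rewrite wide_pdf RintegralZl//; last exact: integrable_normal_pdf.
by rewrite /Rintegral integral_normal_pdf mulr1.
Qed.

Lemma measurable_phi : measurable_fun setT phi.
Proof. by case/integrableP : integrable_phi => /measurable_EFinP. Qed.

Lemma is_derive_phi x : is_derive x 1 phi (- (x * phi x)).
Proof.
have H1 := is_derive_pow 1 (- 2^-1) x.
have H := derZ phi0 (@is_derive1_comp R expR _ x _ _ (is_derive_expR _) H1).
apply: (der_eq H) => [y|]; rewrite /phi /=.
  by congr (_ * expR _); field.
have -> : - 2^-1 * x ^+ 2 = - (x ^+ 2 / 2) by field.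
by rewrite expr1; field.
Qed.

Lemma continuous_phi : continuous phi.
Proof.
move=> x; apply: differentiable_continuous; apply/derivable1_diffP.
by have [] := is_derive_phi x.
Qed.

(* [|x| phi x] decays like [wide]: [y <= exp y] with [y = x^2/4]. *)
Lemma absx_phi_le x : `|x| * phi x <= 3 * phi0 * wide x.
Proof.
have -> : phi x = phi0 * (expR (- (x ^+ 2 / 4)) * wide x).
  by rewrite /phi /wide -expRD; congr (_ * expR _); field.
rewrite (_ : `|x| * _ = (`|x| * expR (- (x ^+ 2 / 4))) * (phi0 * wide x)); last by ring.
rewrite -[leRHS]mulrA ler_wpM2r ?mulr_ge0 ?wide_ge0 ?(ltW phi0_gt0)//.
rewrite expRN ler_pdivrMr ?expR_gt0//.
have := @expR_ge1Dx R (x ^+ 2 / 4); have := expR_ge0 (x ^+ 2 / 4).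
set E := expR _ => E0 E1.
have h : x ^+ 2 = `|x| * `|x| by rewrite -expr2 real_normK ?num_real.
have : 0 <= (`|x| / 2 - 1) * (`|x| / 2 - 1) by rewrite -expr2 sqr_ge0.
by rewrite h in E1; lra.
Qed.

Lemma phi_tail_le t x : t ^+ 2 <= x ^+ 2 -> phi x <= phi0 * expR (- (t ^+ 2 / 4)) * wide x.
Proof.
move=> tx; rewrite /phi /wide -mulrA -expRD ler_wpM2l ?(ltW phi0_gt0)// ler_expR; lra.
Qed.

Definition intgm f := mu.-integrable setT (EFin \o (fun x => f x * phi x)).
Definition GE f := Rintegral mu setT (fun x => f x * phi x).

Lemma intgm_bdd f (B : R) : measurable_fun setT f -> (forall x, `|f x| <= B) -> intgm f.
Proof.
move=> mf fB.
have iB : mu.-integrable setT (EFin \o (fun x => B * phi x)).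
  exact: (@integrableZl _ _ _ mu setT measurableT B _ integrable_phi).
apply: (le_integrable measurableT _ _ iB).
  by apply/measurable_EFinP; apply: measurable_funM => //; exact: measurable_phi.
move=> x _ /=; rewrite lee_fin normrM [`|phi x|]ger0_norm ?phi_ge0//.
by rewrite (le_trans _ (ler_norm _))// ler_wpM2r ?phi_ge0.
Qed.

Lemma eq_GE f g : f =1 g -> GE f = GE g.
Proof. by move=> fg; congr GE; apply/funext. Qed.

Lemma GE_D f g : intgm f -> intgm g -> GE (fun x => f x + g x) = GE f + GE g.
Proof.
move=> i1 i2; rewrite /GE -RintegralD//; congr Rintegral.
by apply/funext => x; rewrite mulrDl.
Qed.

Lemma GE_Z c f : intgm f -> GE (fun x => c * f x) = c * GE f.
Proof.
move=> i1; rewrite /GE -RintegralZl//; congr Rintegral.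
by apply/funext => x; rewrite mulrA.
Qed.

Lemma intgmD f g : intgm f -> intgm g -> intgm (fun x => f x + g x).
Proof.
move=> i1 i2; rewrite /intgm (_ : _ \o _ = (EFin \o (fun x => f x * phi x)) \+
  (EFin \o (fun x => g x * phi x))); first exact: integrableD.
by apply/funext => x /=; rewrite mulrDl EFinD.
Qed.

Lemma intgmZ c f : intgm f -> intgm (fun x => c * f x).
Proof.
move=> i1; rewrite /intgm (_ : _ \o _ = (fun x => c%:E * (EFin \o (fun x => (f x * phi x)%R)) x)%E).
  exact: integrableZl.
by apply/funext => x /=; rewrite -mulrA EFinM.
Qed.

Lemma GE_le f g : intgm f -> intgm g -> (forall x, f x <= g x) -> GE f <= GE g.
Proof.
by move=> i1 i2 fg; apply: le_Rintegral => // x _; rewrite ler_wpM2r ?phi_ge0.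
Qed.

Lemma GE_cst c : GE (cst c) = c.
Proof. by rewrite /GE RintegralZl ?integral_phi ?mulr1//; exact: integrable_phi. Qed.

Lemma GE_abs_le1 f : measurable_fun setT f -> (forall x, `|f x| <= 1) -> `|GE f| <= 1.
Proof.
move=> mf f1; have i1 := intgm_bdd mf f1.
have ic c : intgm (cst c) by apply: (@intgm_bdd _ `|c|).
rewrite ler_norml -{1}(GE_cst (-1)) -{2}(GE_cst 1); apply/andP; split; apply: GE_le => //.
  by move=> x; have := f1 x; rewrite ler_norml => /andP[].
by move=> x; have := f1 x; rewrite ler_norml => /andP[].
Qed.

Definition ivl a b x : R := (a <= x <= b)%R%:R.

Lemma ivlE a b : ivl a b = \1_`[a, b]%classic.
Proof.
apply/funext => x; rewrite /ivl indicE; congr (nat_of_bool _)%:R.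
by apply/idP/idP; rewrite inE /= in_itv.
Qed.

Lemma measurable_ivl a b : measurable_fun setT (ivl a b).
Proof. by rewrite ivlE; apply: measurable_indic. Qed.

Lemma ivl_ge0 a b x : 0 <= ivl a b x. Proof. by rewrite /ivl ler0n. Qed.
Lemma ivl_le1 a b x : ivl a b x <= 1. Proof. by rewrite /ivl lern1 leq_b1. Qed.

Lemma norm_ivl_le1 a b x : `|ivl a b x| <= 1.
Proof. by rewrite ger0_norm ?ivl_ge0 ?ivl_le1. Qed.

Lemma intgm_ivl a b : intgm (ivl a b).
Proof. exact: intgm_bdd (measurable_ivl a b) (norm_ivl_le1 a b). Qed.

Definition gm a b := GE (ivl a b).

Lemma gm_ge0 a b : 0 <= gm a b.
Proof. by apply: Rintegral_ge0 => x _; rewrite mulr_ge0 ?ivl_ge0 ?phi_ge0. Qed.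

Lemma gm_le1 a b : gm a b <= 1.
Proof.
have := GE_abs_le1 (measurable_ivl a b) (norm_ivl_le1 a b).
by rewrite ler_norml => /andP[].
Qed.

Lemma gmE a b : gm a b = Rintegral mu `[a, b]%classic phi.
Proof.
rewrite /gm /GE [RHS]Rintegral_mkcond; congr Rintegral; apply/funext => x.
by rewrite ivlE patchE indicE; case: ifPn => _; rewrite ?mul1r ?mul0r.
Qed.

Lemma integrable_phiS (A : set R) : measurable A -> mu.-integrable A (EFin \o phi).
Proof. by move=> mA; apply: (@integrableS _ _ _ mu setT A) => //; exact: integrable_phi. Qed.

Lemma Rintegral_cst_itv c a b : a <= b ->
  Rintegral mu `[a, b]%classic (fun=> c) = c * (b - a).
Proof.
move=> ab; rewrite Rintegral_cst//= lebesgue_measure_itv/= lte_fin.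
have [lt_ab|le_ba] := ltP a b; first by rewrite -EFinD.
by rewrite (@le_anti _ R a b) ?ab// subrr.
Qed.

Lemma integrable_cst_itv c a b : mu.-integrable `[a, b]%classic (EFin \o (fun=> c)).
Proof.
apply: continuous_compact_integrable; first exact: segment_compact.
by apply: continuous_subspaceT => x; exact: cvg_cst.
Qed.

Lemma gm_le a b : a <= b -> gm a b <= phi0 * (b - a).
Proof.
move=> ab; rewrite gmE -Rintegral_cst_itv//.
apply: le_Rintegral => //; [exact: integrable_phiS|exact: integrable_cst_itv|].
by move=> x _; exact: phi_le.
Qed.

Lemma gm_ge a b (B : R) : a <= b -> (forall x, a <= x <= b -> x ^+ 2 <= B) ->
  phi0 * (1 - B / 2) * (b - a) <= gm a b.
Proof.
move=> ab xB; rewrite gmE -Rintegral_cst_itv//.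
apply: le_Rintegral => //; [exact: integrable_cst_itv|exact: integrable_phiS|].
move=> x /=; rewrite in_itv/= => /xB h; apply: le_trans (phi_ge x).
by rewrite ler_wpM2l ?(ltW phi0_gt0)//; lra.
Qed.

Lemma FTC2R f g a b : a <= b -> continuous f -> (forall x : R, is_derive x 1 g (f x)) ->
  Rintegral mu `[a, b]%classic f = g b - g a.
Proof.
rewrite le_eqVlt => /orP[/eqP ->|ab] cf dg.
  by rewrite set_itv1 Rintegral_set1 subrr.
have cg : continuous g.
  move=> x; apply: differentiable_continuous; apply/derivable1_diffP.
  by have [] := dg x.
rewrite /Rintegral (@continuous_FTC2 _ _ g)//.
- exact: continuous_subspaceT.
- split; first by move=> x _; have [] := dg x.
    by apply: cvg_at_right_filter; exact: cg.
  by apply: cvg_at_left_filter; exact: cg.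
- by move=> x _; rewrite derive1E; exact: derive_val.
Qed.

Lemma continuous_xphi : continuous (fun x => x * phi x).
Proof. by move=> x; apply: cvgM; [exact: cvg_id|exact: continuous_phi]. Qed.

(** [- phi] is a primitive of [x * phi x], so these bounds telescope when summed over adjacent
    intervals. *)
Lemma gm_xphi a b : a <= b -> a * gm a b <= phi a - phi b <= b * gm a b.
Proof.
move=> ab.
have E : Rintegral mu `[a, b]%classic (fun x => x * phi x) = phi a - phi b.
  have dN (x : R) : is_derive x 1 (fun x => - phi x) (x * phi x).
    by apply: (der_eq (derN (is_derive_phi x))) => //; rewrite opprK.
  by rewrite (FTC2R ab continuous_xphi dN); ring.
have ix : mu.-integrable `[a, b]%classic (EFin \o (fun x => x * phi x)).
  apply: continuous_compact_integrable; first exact: segment_compact.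
  by apply: continuous_subspaceT; exact: continuous_xphi.
have ic c : mu.-integrable `[a, b]%classic (EFin \o (fun x => c * phi x)).
  have mI : measurable `[a, b]%classic by exact: measurable_itv.
  exact: (@integrableZl _ _ _ mu _ mI c _ (integrable_phiS mI)).
rewrite -E !gmE -!RintegralZl//; [|exact: integrable_phiS|exact: integrable_phiS].
apply/andP; split; apply: le_Rintegral => // x /=; rewrite in_itv/= => /andP[ax xb];
  by rewrite ler_wpM2r ?phi_ge0.
Qed.

End Gaussian.

(** * The Gaussian characteristic function *)

Section GaussianCharacteristic.
Variable R : realType.
Local Notation mu := (@lebesgue_measure R).
Local Notation phi := (@phi R).
Local Notation phi0 := (@phi0 R).
Local Notation wide := (@wide R).
Implicit Types (f g : R -> R) (a b t u th x : R).

Lemma sqr_phi_le x : x ^+ 2 * phi x <= 4 * phi0 * wide x.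
Proof.
have -> : phi x = phi0 * (expR (- (x ^+ 2 / 4)) * wide x).
  by rewrite /phi /wide -expRD; congr (_ * expR _); field.
rewrite (_ : x ^+ 2 * _ = (x ^+ 2 * expR (- (x ^+ 2 / 4))) * (phi0 * wide x)); last by ring.
rewrite -[leRHS]mulrA ler_wpM2r ?mulr_ge0 ?wide_ge0 ?(ltW (phi0_gt0 R))//.
rewrite expRN ler_pdivrMr ?expR_gt0//.
by have := @expR_ge1Dx R (x ^+ 2 / 4); lra.
Qed.

Lemma phi_le_wide x : phi x <= phi0 * wide x.
Proof.
have := @phi_tail_le R 0 x; rewrite expr0n/= sqr_ge0 mul0r oppr0 expR0 mulr1; exact.
Qed.

Lemma Rintegral_le_wide f (K : R) : measurable_fun setT f -> (forall x, `|f x| <= K * wide x) ->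
  mu.-integrable setT (EFin \o f) /\ `|Rintegral mu setT f| <= K * Num.sqrt (4 * pi).
Proof.
move=> mf fK.
have iK : mu.-integrable setT (EFin \o (fun x => K * wide x)).
  exact: (@integrableZl _ _ _ mu setT measurableT K _ (integrable_wide R)).
have if_ : mu.-integrable setT (EFin \o f).
  apply: (le_integrable measurableT _ _ iK); first exact/measurable_EFinP.
  by move=> x _ /=; rewrite lee_fin (le_trans (fK x))// ler_norm.
split=> //; apply: (le_trans (le_normr_Rintegral measurableT if_)).
rewrite -integral_wide -RintegralZl//; last exact: integrable_wide.
by apply: le_Rintegral => //; exact: integrable_norm.
Qed.

Lemma wide_mass : phi0 * Num.sqrt (4 * pi) <= 2.
Proof.
have p0 := pi_gt0 R.
rewrite /phi0 mulrC ler_pdivrMr ?sqrtr_gt0 ?mulr_gt0//.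
rewrite -(@ler_pXn2r _ 2) ?nnegrE ?mulr_ge0 ?sqrtr_ge0// exprMn !sqr_sqrtr ?mulr_ge0 ?pi_ge0//.
by lra.
Qed.

Definition outside t x : R := (t < `|x|)%R%:R.

Lemma measurable_outside t : measurable_fun setT (outside t).
Proof.
have -> : outside t = \1_[set x | t < `|x|].
  by apply/funext => x; rewrite /outside indicE; congr (nat_of_bool _)%:R;
    apply/idP/idP; rewrite inE.
apply: measurable_indic; apply: meas_lt => //; exact: measurableT_comp.
Qed.

Lemma norm_outside_le1 t x : `|outside t x| <= 1.
Proof. by rewrite /outside ger0_norm// lern1 leq_b1. Qed.

Lemma GE_tail t : 0 < t -> GE (outside t) <= 8 / t ^+ 2.
Proof.
move=> t0.
have [||i1] := @Rintegral_le_wide (fun x => outside t x * phi x) (phi0 * expR (- (t ^+ 2 / 4))).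
- by apply: measurable_funM; [exact: measurable_outside|exact: measurable_phi].
- move=> x; rewrite /outside; case: ltP => [tx|_].
    rewrite mul1r ger0_norm ?phi_ge0//; apply: phi_tail_le.
    by rewrite -[x ^+ 2]real_normK ?num_real// lerXn2r ?nnegrE// ltW.
  by rewrite mul0r normr0 mulr_ge0 ?wide_ge0// mulr_ge0 ?expR_ge0 ?(ltW (phi0_gt0 R)).
move=> H; apply: le_trans (le_trans (ler_norm _) H) _.
rewrite mulrAC (@le_trans _ _ (2 * expR (- (t ^+ 2 / 4))))//.
  by rewrite ler_wpM2r ?expR_ge0// wide_mass.
rewrite expRN ler_pdivrMr ?expR_gt0// mulrAC ler_pdivlMr ?exprn_gt0//.
by have := @expR_ge1Dx R (t ^+ 2 / 4); lra.
Qed.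

Lemma measurable_cos_phi u th : measurable_fun setT (fun x => cos (u * x + th) * phi x).
Proof. by apply: measurable_funM; [exact: measurable_cos_lin|exact: measurable_phi]. Qed.

Lemma measurable_sin_phi u th : measurable_fun setT (fun x => x * sin (u * x + th) * phi x).
Proof.
apply: measurable_funM; last exact: measurable_phi.
by apply: measurable_funM => //; exact: measurable_sin_lin.
Qed.

Lemma is_derive_sin_lin (j t x : R) :
  is_derive x 1 (fun y => sin (j * y + t)) (j * cos (j * x + t)).
Proof.
have H := @is_derive_cos_lin R j (t - pi / 2) x.
apply: (der_eq H) => [y|]; last by congr (_ * cos _); lra.
by rewrite addrA cosD cosN sinN cos_pihalf sin_pihalf mulr0 mulrN1 opprK add0r.
Qed.

Lemma cos_phi_bound u th x : `|cos (u * x + th) * phi x| <= phi0 * wide x.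
Proof.
rewrite normrM [`|phi x|]ger0_norm ?phi_ge0//; apply: le_trans (phi_le_wide x).
by rewrite ler_piMl ?phi_ge0// norm_cos_le1.
Qed.

Lemma sin_phi_bound u th x : `|x * sin (u * x + th) * phi x| <= 3 * phi0 * wide x.
Proof.
rewrite normrM [`|phi x|]ger0_norm ?phi_ge0// normrM; apply: le_trans (absx_phi_le x).
by rewrite ler_wpM2r ?phi_ge0// ler_piMr// norm_sin_le1.
Qed.

(* Stein's identity, from the vanishing of the integral of the derivative of
   [sin (u x + th) * phi x]. *)
Lemma gaussian_stein u th :
  Rintegral mu setT (fun x => x * sin (u * x + th) * phi x) =
  u * Rintegral mu setT (fun x => cos (u * x + th) * phi x).
Proof.
have [ic _] := Rintegral_le_wide (measurable_cos_phi u th) (cos_phi_bound u th).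
have [is_ _] := Rintegral_le_wide (measurable_sin_phi u th) (sin_phi_bound u th).
pose h x := sin (u * x + th) * phi x.
pose dh x := u * (cos (u * x + th) * phi x) - x * sin (u * x + th) * phi x.
have iuc : mu.-integrable setT (EFin \o (fun x => u * (cos (u * x + th) * phi x))).
  exact: (@integrableZl _ _ _ mu setT measurableT u _ ic).
suff : Rintegral mu setT dh = 0.
  by rewrite RintegralB// RintegralZl// => /eqP; rewrite subr_eq0 => /eqP.
have dhE x : is_derive x 1 h (dh x).
  have H := @is_deriveM _ _ _ _ x 1 _ _ (is_derive_sin_lin u th x) (is_derive_phi x).
  apply: (der_eq H) => //; rewrite /dh /GRing.scale /=; ring.
have cdh : continuous dh.
  have cl : continuous (fun x => u * x + th).
    move=> x; apply: cvgD; last exact: cvg_cst.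
    by apply: cvgM; [exact: cvg_cst|exact: cvg_id].
  move=> x; apply: cvgB.
    apply: cvgM; first exact: cvg_cst.
    apply: cvgM; last exact: continuous_phi.
    exact: (continuous_comp (cl x) (@continuous_cos R _)).
  apply: cvgM; last exact: continuous_phi.
  apply: cvgM; first exact: cvg_id.
  exact: (continuous_comp (cl x) (@continuous_sin R _)).
pose K : R := ((`|u| + 1) * (4 * phi0)) * Num.sqrt (4 * pi) + 8 * phi0.
have K0 : 0 <= K.
  by rewrite addr_ge0// ?mulr_ge0 ?addr_ge0 ?sqrtr_ge0 ?(ltW (phi0_gt0 R)).
have p00 := ltW (phi0_gt0 R).
(* The interval [[- n, n]] contributes boundary values of [h], its complement a tail; both are of
   order [1 / n] because [x ^ 2 * phi x] is dominated by [wide]. *)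
have bnd (n : nat) : (0 < n)%N -> `|Rintegral mu setT dh| <= K / n%:R.
  move=> n0; have n1 : 1 <= n%:R :> R by rewrite ler1n.
  have nn : - n%:R <= n%:R :> R by lra.
  pose rest x := dh x * (1 - ivl (- n%:R) n%:R x).
  have mdh : measurable_fun setT dh by exact: continuous_measurable_fun.
  have mrest : measurable_fun setT rest.
    by apply: measurable_funM => //; apply: measurable_funB => //; exact: measurable_ivl.
  have rest_le x : `|rest x| <= ((`|u| + 1) * (4 * phi0) / n%:R) * wide x.
    rewrite /rest /ivl; case: (boolP (- n%:R <= x <= n%:R)) => [_|xn] /=.
      by rewrite subrr mulr0 normr0 !mulr_ge0 ?wide_ge0 ?addr_ge0 ?invr_ge0.
    have nx : n%:R <= `|x| by rewrite -ler_norml -ltNge in xn; exact: ltW.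
    rewrite subr0 mulr1 /dh.
    apply: (@le_trans _ _ ((`|u| + `|x|) * phi x)).
      rewrite (le_trans (ler_normB _ _))// mulrDl.
      apply: lerD; rewrite normrM.
        by rewrite ler_wpM2l// normrM [`|phi x|]ger0_norm ?phi_ge0// ler_piMl ?phi_ge0// norm_cos_le1.
      by rewrite [`|phi x|]ger0_norm ?phi_ge0// normrM ler_wpM2r ?phi_ge0// ler_piMr// norm_sin_le1.
    apply: (@le_trans _ _ ((`|u| + 1) / n%:R * (x ^+ 2 * phi x))); last first.
      have -> : (`|u| + 1) * (4 * phi0) / n%:R * wide x = (`|u| + 1) / n%:R * (4 * phi0 * wide x) by ring.
      by rewrite ler_wpM2l ?sqr_phi_le// divr_ge0// addr_ge0.
    rewrite [leRHS]mulrA ler_wpM2r ?phi_ge0// mulrAC ler_pdivlMr; last by lra.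
    have u0 := normr_ge0 u.
    have x1 : 1 <= `|x| by lra.
    have h1 : `|u| + `|x| <= (`|u| + 1) * `|x|.
      have : `|u| * 1 <= `|u| * `|x| by rewrite ler_wpM2l.
      lra.
    have -> : x ^+ 2 = `|x| * `|x| by rewrite -expr2 real_normK ?num_real.
    by rewrite mulrA ler_pM// addr_ge0.
  have [irest hrest] := Rintegral_le_wide mrest rest_le.
  pose main x := dh x * ivl (- n%:R) n%:R x.
  have mainE : main = dh \_ `[- n%:R, n%:R]%classic.
    by apply/funext => x; rewrite /main ivlE patchE indicE; case: ifPn; rewrite ?mulr1 ?mulr0.
  have imain : mu.-integrable setT (EFin \o main).
    have -> : EFin \o main = (EFin \o dh) \_ `[- n%:R, n%:R]%classic.
      by rewrite mainE; apply/funext => x; rewrite /= !patchE; case: ifP.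
    apply/(@integrable_mkcond _ _ _ mu _ _ (measurable_itv _)).
    apply: continuous_compact_integrable; first exact: segment_compact.
    exact: continuous_subspaceT.
  have -> : dh = (fun x => main x + rest x).
    by apply/funext => x; rewrite /main /rest; ring.
  rewrite RintegralD// (le_trans (ler_normD _ _))//.
  have -> : Rintegral mu setT main = h n%:R - h (- n%:R).
    by rewrite mainE -Rintegral_mkcond (FTC2R nn cdh dhE).
  have hb x : n%:R <= `|x| -> `|h x| <= 4 * phi0 / n%:R.
    move=> nx; rewrite /h normrM [`|phi x|]ger0_norm ?phi_ge0//.
    apply: (@le_trans _ _ (phi x)); first by rewrite ler_piMl ?phi_ge0// norm_sin_le1.
    rewrite ler_pdivlMr; last by lra.
    apply: (@le_trans _ _ (x ^+ 2 * phi x)).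
      rewrite mulrC ler_wpM2r ?phi_ge0// -[x ^+ 2]real_normK ?num_real//.
      have : `|x| * 1 <= `|x| * `|x| by rewrite ler_wpM2l//; lra.
      by rewrite -expr2; lra.
    apply: (le_trans (sqr_phi_le x)); rewrite ler_piMr ?mulr_ge0//.
    by rewrite /wide -expR0 ler_expR oppr_le0 divr_ge0// sqr_ge0.
  have hb1 := hb n%:R ltac:(rewrite ger0_norm//).
  have hb2 := hb (- n%:R) ltac:(rewrite normrN ger0_norm//).
  have -> : K / n%:R = (4 * phi0 / n%:R + 4 * phi0 / n%:R) +
      (`|u| + 1) * (4 * phi0) / n%:R * Num.sqrt (4 * pi).
    by rewrite /K; field; rewrite gt_eqF// ltr0n.
  by rewrite lerD// (le_trans (ler_normB _ _))// lerD.
apply/normr0_eq0/le_anti; rewrite normr_ge0 andbT leNgt; apply/negP => I0.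
set J := `|Rintegral mu setT dh| in bnd I0.
pose n := (Num.truncn (K / J)).+1.
have n0 : 0 < n%:R :> R by rewrite ltr0n.
have := bnd n (ltn0Sn _); rewrite ler_pdivlMr// mulrC -ler_pdivlMr// leNgt.
by rewrite truncnS_gt.
Qed.

Definition gchar th u := GE (fun x => cos (u * x + th)).

(** Differentiation under the integral sign, followed by Stein's identity. *)
Lemma is_derive_gchar th u : is_derive u 1 (gchar th) (- u * gchar th u).
Proof.
pose f (v x : R) := cos (v * x + th) * phi x.
have df (v x : R) : is_derive v 1 (f ^~ x) (- (x * sin (v * x + th) * phi x)).
  have H := derZ (phi x) (@is_derive_cos_lin R x th v).
  apply: (der_eq H) => [y|]; first by rewrite /f mulrC [x * y]mulrC.
  by rewrite cosDpihalf [x * v]mulrC; ring.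
have Iu : `]u - 1, u + 1[%classic u by rewrite /= in_itv/=; apply/andP; split; lra.
have intf (v : R) : `]u - 1, u + 1[%classic v -> mu.-integrable setT (EFin \o f v).
  by move=> _; have [] := Rintegral_le_wide (measurable_cos_phi v th) (cos_phi_bound v th).
have derf (v x : R) : `]u - 1, u + 1[%classic v -> setT x -> derivable (f ^~ x) v 1.
  by move=> _ _; have [] := df v x.
have G0 x : 0 <= 3 * phi0 * wide x by rewrite !mulr_ge0 ?wide_ge0 ?(ltW (phi0_gt0 R)).
have iG : mu.-integrable setT (EFin \o (fun x => 3 * phi0 * wide x)).
  exact: (@integrableZl _ _ _ mu setT measurableT (3 * phi0) _ (integrable_wide R)).
have d1E (v x : R) : partial1of2 f v x = - (x * sin (v * x + th) * phi x).
  by rewrite partial1of2E; exact: derive_val.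
have Gub (v x : R) : `]u - 1, u + 1[%classic v -> setT x -> `|partial1of2 f v x| <= 3 * phi0 * wide x.
  by move=> _ _; rewrite d1E normrN; exact: sin_phi_bound.
have D := derivable_under_integral measurableT Iu intf derf G0 iG Gub.
have E := differentiation_under_integral measurableT Iu intf derf G0 iG Gub.
have -> : - u * gchar th u = Rintegral mu setT (partial1of2 f u).
  rewrite mulNr /gchar /GE -gaussian_stein -mulN1r -RintegralZl//.
    by congr Rintegral; apply/funext => x; rewrite d1E mulN1r.
  by have [] := Rintegral_le_wide (measurable_sin_phi u th) (sin_phi_bound u th).
apply: DeriveDef; first exact: D.
by rewrite -derive1E E.
Qed.

(** By the differential equation, [expR (u ^ 2 / 2) * gchar th u] is constant, with value [cos th]
    at 0. *)
Lemma gchar_pos th u : 0 <= u -> gchar th u = expR (- (u ^+ 2 / 2)) * cos th.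
Proof.
move=> u0; pose h v := expR (v ^+ 2 / 2) * gchar th v.
have dh (v : R) : is_derive v 1 h 0.
  have H1 := is_derive_pow 1 2^-1 v.
  have H2 := @is_derive1_comp R expR _ v _ _ (is_derive_expR _) H1.
  have H := @is_deriveM _ _ _ _ v 1 _ _ H2 (is_derive_gchar th v).
  apply: (der_eq H) => [x|]; first by rewrite /h /= [_ / 2]mulrC.
  by rewrite /GRing.scale /= expr1; field.
have ch : {within `[0, u], continuous h}.
  apply: continuous_subspaceT => z; apply: differentiable_continuous.
  by apply/derivable1_diffP; have [] := dh z.
have [c _] := @MVT_segment R h (fun=> 0) 0 u u0 (fun z _ => dh z) ch.
rewrite mul0r => /eqP; rewrite subr_eq0 /h expr0n /= mul0r expR0 mul1r => /eqP.
have -> : gchar th 0 = cos th.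
  by rewrite -[RHS](GE_cst (cos th)); apply: eq_GE => x; rewrite mul0r add0r.
by move=> <-; rewrite mulrA expRN mulVf ?mul1r// gt_eqF// expR_gt0.
Qed.

Lemma GE_cos u th : GE (fun x => cos (u * x + th)) = expR (- (u ^+ 2 / 2)) * cos th.
Proof.
have [u0|/ltW un] := leP 0 u; first exact: gchar_pos.
rewrite -[cos th]cosN -[u ^+ 2]sqrrN -gchar_pos ?oppr_ge0//.
by apply: eq_GE => x; rewrite -cosN; congr cos; ring.
Qed.

End GaussianCharacteristic.

(** * Trigonometric cutoff functions *)

Section TrigPoly.
Variable R : realType.
Implicit Types (f g : R -> R) (a b t th s : R) (p : R * nat * R) (l : seq (R * nat * R)).

(* A term [(c, j, th)] stands for [c cos (j t + th)]. *)
Definition tpe l t : R := \sum_(p <- l) p.1.1 * cos (p.1.2%:R * t + p.2).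
Definition tpn l : R := \sum_(p <- l) `|p.1.1|.

(** The two parameters are those that matter when [f] is tested with characteristic functions: the
    degree [m] says how far these must be known, the l1 norm [A] how much their error is
    magnified. *)
Definition trigp (m : nat) (A : R) f :=
  exists l, [/\ forall t, f t = tpe l t, all (fun p => p.1.2 <= m)%N l & tpn l <= A].

Lemma trigp_one : trigp 0 1 (fun=> 1).
Proof.
exists [:: (1, 0%N, 0)]; split => //.
  by move=> t; rewrite /tpe big_seq1 /= mul0r addr0 cos0 mulr1.
by rewrite /tpn big_seq1 normr1.
Qed.

(** Multiplication of a term by [(1 + cos t) / 2]. Frequencies are natural numbers, so for [j = 0]
    the term of frequency -1 is written with frequency 1 and the opposite phase. *)
Definition cosmul p : seq (R * nat * R) :=
  [:: (p.1.1 / 2, p.1.2, p.2); (p.1.1 / 4, p.1.2.+1, p.2);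
      (p.1.1 / 4, if p.1.2 is j.+1 then j else 1%N, if p.1.2 is j.+1 then p.2 else - p.2)].

Lemma cosmulE p t : tpe (cosmul p) t =
  p.1.1 * cos (p.1.2%:R * t + p.2) * ((1 + cos t) / 2).
Proof.
rewrite /tpe /cosmul !big_cons big_nil /=; case: p => -[c j] th /=.
case: j => [|j] /=.
  by rewrite mul0r add0r mul1r !cosD cosN sinN; field.
rewrite -!natr1 (_ : (j%:R + 1 + 1) * t + th = ((j%:R + 1) * t + th) + t); last by ring.
rewrite (_ : j%:R * t + th = ((j%:R + 1) * t + th) - t); last by ring.
by rewrite [in X in _ + (X + _)]cosD [in X in _ + (_ + (X + _))]cosB; field.
Qed.

Lemma cosmul_norm p : tpn (cosmul p) = `|p.1.1|.
Proof.
rewrite /tpn /cosmul !big_cons big_nil /= !normrM.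
by rewrite (@ger0_norm _ 2^-1) ?(@ger0_norm _ 4^-1) ?invr_ge0//; field.
Qed.

Lemma trigp_cosmul m A f : trigp m A f -> trigp m.+1 A (fun t => f t * ((1 + cos t) / 2)).
Proof.
case=> l [fl lm lA]; exists (flatten [seq cosmul p | p <- l]); split.
- move=> t; rewrite fl /tpe big_flatten big_map mulr_suml /=.
  by apply: eq_bigr => p _; rewrite -[RHS]/(tpe (cosmul p) t) cosmulE.
- apply/allP => q /flatten_mapP[p pl]; move/allP: lm => /(_ p pl) /= pm.
  rewrite /cosmul !inE => /or3P[] /eqP -> /=; [exact: leqW|by rewrite ltnS|].
  by case: p.1.2 pm => [//|j] h; rewrite (leq_trans _ (leqnSn m))// ltnW.
- apply: le_trans lA; rewrite /tpn big_flatten big_map /=.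
  by apply: ler_sum => p _; rewrite -[leLHS]/(tpn (cosmul p)) cosmul_norm.
Qed.

Lemma trigp_shift m A f (u : R) : trigp m A f -> trigp m A (fun t => f (t - u)).
Proof.
case=> l [fl lm lA]; exists [seq (p.1.1, p.1.2, p.2 - p.1.2%:R * u) | p <- l]; split.
- move=> t; rewrite fl /tpe big_map; apply: eq_bigr => p _ /=; congr (_ * cos _); ring.
- by rewrite all_map.
- by rewrite /tpn big_map.
Qed.

Lemma trigp_scale m A f (c : R) : trigp m A f -> trigp m (`|c| * A) (fun t => c * f t).
Proof.
case=> l [fl lm lA]; exists [seq (c * p.1.1, p.1.2, p.2) | p <- l]; split.
- by move=> t; rewrite fl /tpe big_map mulr_sumr; apply: eq_bigr => p _ /=; rewrite mulrA.
- by rewrite all_map.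
- rewrite /tpn big_map /= (eq_bigr (fun p => `|c| * `|p.1.1|)); last by move=> p _; rewrite normrM.
  by rewrite -mulr_sumr ler_wpM2l.
Qed.

Lemma trigp_sum (I : Type) (r : seq I) (Q : pred I) m A (F : I -> R -> R) : 0 <= A ->
  (forall i, trigp m A (F i)) -> trigp m ((size r)%:R * A) (fun t => \sum_(i <- r | Q i) F i t).
Proof.
move=> A0 FA; elim: r => [|i r [l [fl lm lA]]].
  by exists [::]; split => //; [move=> t; rewrite /tpe !big_nil|rewrite /tpn big_nil mul0r].
have [l' [fl' lm' lA']] := FA i; rewrite /= -natr1.
case: (boolP (Q i)) => Qi.
  exists (l' ++ l); split.
  - by move=> t; rewrite big_cons Qi /tpe big_cat /= fl fl'.
  - by rewrite all_cat lm lm'.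
  - by rewrite /tpn big_cat /= mulrDl mul1r addrC lerD.
exists l; split => //; first by move=> t; rewrite big_cons (negbTE Qi) fl.
by apply: le_trans lA _; rewrite ler_wpM2r// lerDl.
Qed.

Definition node (N : nat) (i : nat) : R := - pi + 2 * pi * i%:R / N%:R.

(* Telescoping after multiplication by [2 sin (pi j / N)]. *)
Lemma cos_node_sum (N j : nat) t th : (0 < j < N)%N ->
  \sum_(i < N) cos (j%:R * (t - node N i) + th) = 0.
Proof.
move=> /andP[j0 jN]; have N0 : N%:R != 0 :> R by rewrite pnatr_eq0; case: N jN.
pose al : R := 2 * pi * j%:R / N%:R.
pose x : R := j%:R * (t + pi) + th.
have sin_half : sin (al / 2) != 0.
  have -> : al / 2 = pi * (j%:R / N%:R) by rewrite /al; field.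
  have p0 := pi_gt0 R.
  have N0' : 0 < N%:R :> R by rewrite ltr0n; case: N jN {N0 al x}.
  rewrite gt_eqF// sin_gt0_pi//; apply/andP; split.
    by rewrite mulr_gt0// divr_gt0// ltr0n.
  by rewrite gtr_pMr// ltr_pdivrMr// mul1r ltr_nat.
have key n : 2 * sin (al / 2) * \sum_(i < n) cos (x - i%:R * al) =
    sin (x + al / 2) - sin (x + al / 2 - n%:R * al).
  elim: n => [|n IH]; first by rewrite big_ord0 mulr0 mul0r subr0 subrr.
  rewrite big_ord_recr /= mulrDr IH -[n.+1%:R]natr1.
  have -> : x + al / 2 - n%:R * al = (x - n%:R * al) + al / 2 by ring.
  have -> : x + al / 2 - (n%:R + 1) * al = (x - n%:R * al) - al / 2 by field.
  by rewrite [sin (x - _ + _)]sinD [sin (x - _ - _)]sinB; ring.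
have E i : cos (j%:R * (t - node N i) + th) = cos (x - i%:R * al).
  by congr cos; rewrite /x /al /node; field.
rewrite (eq_bigr (fun i : 'I_N => cos (x - i%:R * al))); last by move=> i _; exact: E.
apply/eqP; rewrite -(mulrI_eq0 _ (mulfI _ : GRing.lreg (2 * sin (al / 2)))); last first.
  by rewrite mulf_neq0// pnatr_eq0.
rewrite key.
have -> : x + al / 2 - N%:R * al = x + al / 2 - pi *+ 2 *+ j.
  rewrite (_ : pi *+ 2 *+ j = 2 * pi * j%:R); first by rewrite /al; field.
  by rewrite -mulrnA -[pi *+ (2 * j)]mulr_natr natrM; ring.
have per n y : sin (y - pi *+ 2 *+ n) = sin y :> R.
  elim: n => [|n IH]; first by rewrite mulr0n subr0.
  by rewrite mulrSr opprD addrA -[LHS]sinD2pi subrK IH.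
by rewrite per subrr.
Qed.

(** The frequencies from 1 to [m] are below the number of nodes and cancel; only the constant terms
    survive. *)
Lemma trigp_node_sum m A f N : trigp m A f -> (m < N)%N ->
  exists kappa : R, forall t, \sum_(i < N) f (t - node N i) = kappa.
Proof.
case=> l [fl lm _] mN; exists (\sum_(p <- l | p.1.2 == 0%N) N%:R * (p.1.1 * cos p.2)) => t.
under eq_bigr do rewrite fl /tpe.
rewrite exchange_big /= [RHS]big_mkcond /= [LHS]big_seq [RHS]big_seq.
apply: eq_bigr => p pl; rewrite -mulr_sumr; case: eqP => [->|/eqP j0].
  under eq_bigr do rewrite mul0r add0r.
  by rewrite sumr_const card_ord mulrnAr mulr_natl.
rewrite cos_node_sum ?mulr0// lt0n j0 /=; apply: leq_ltn_trans mN.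
by move/allP: lm; exact.
Qed.

(** This is [cos (t / 2) ^ (2 m)]: nonnegative, of degree [m], and concentrated at 0 with width of
    order [m ^ (-1/2)]. *)
Definition fejer (m : nat) t : R := ((1 + cos t) / 2) ^+ m.

Lemma trigp_fejer m : trigp m 1 (fejer m).
Proof.
elim: m => [|m IH]; first exact: trigp_one.
have := trigp_cosmul IH; rewrite (_ : (fun t => _) = fejer m.+1)//.
by apply/funext => t; rewrite /fejer exprSr.
Qed.

Lemma fejer_ge0 m t : 0 <= fejer m t.
Proof. by rewrite exprn_ge0// divr_ge0//; have := cos_geN1 t; lra. Qed.

Lemma cos_le_far s x : 0 <= s -> s <= x -> x <= 2 * pi - s -> cos x <= cos s.
Proof.
move=> s0 sx xs; have p0 := pi_gt0 R.
have cd y : 0 <= y -> s <= y -> y <= pi -> cos y <= cos s.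
  move=> y0 sy yp; rewrite leNgt; apply/negP => h.
  have : y < s by rewrite -ltr_cos// in_itv/= ?y0 ?yp// s0 (le_trans sy).
  by rewrite ltNge sy.
have [xp|px] := leP x pi; first by apply: cd; lra.
have -> : cos x = cos (2 * pi - x).
  by rewrite -[RHS]cosN -(cosD2pi (- (2 * pi - x))); congr cos; rewrite mulr2n; ring.
by apply: cd; lra.
Qed.

Lemma fejer_le m s x : 0 <= s -> s <= 1 -> s <= `|x| -> `|x| <= 2 * pi - s ->
  fejer m x <= expR (- (m%:R * (s ^+ 2 / 5))).
Proof.
move=> s0 s1 sx xs.
have cx : cos x <= cos s.
  rewrite (_ : cos x = cos `|x|); first exact: cos_le_far.
  by case: (ger0P x) => // _; rewrite cosN.
have cs := cos_le_quart s0.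
have s2 : s ^+ 2 <= 1 by rewrite expr_le1.
have s4 : s ^+ 4 <= s ^+ 2 by rewrite (exprD s 2 2) ler_piMr ?sqr_ge0.
have e1 := @expR_ge1Dx R (- (s ^+ 2 / 5)).
have base : (1 + cos x) / 2 <= expR (- (s ^+ 2 / 5)).
  by have := sqr_ge0 s; lra.
by rewrite -mulrN expRM_natl lerXn2r ?nnegrE ?expR_ge0//; have := cos_geN1 x; lra.
Qed.

(* The sum of the translates of the Fejer-type kernel over the nodes in [[a, b]],
   normalised by the sum over all nodes, which is constant. *)
Lemma trig_cutoff m a b s : 0 <= s -> s <= 1 -> - (pi - s) <= a -> b <= pi - s ->
  exists chi : R -> R, [/\ trigp m m.+1%:R chi, forall t, 0 <= chi t <= 1,
    forall t, `|t| <= pi -> (t <= a - s) || (b + s <= t) ->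
      chi t <= m.+1%:R * expR (- (m%:R * (s ^+ 2 / 5))) &
    forall t, `|t| <= pi -> a + s <= t <= b - s ->
      1 - m.+1%:R * expR (- (m%:R * (s ^+ 2 / 5))) <= chi t].
Proof.
move=> s0 s1 am bm; have p0 := pi_gt0 R.
set eps := m.+1%:R * expR _.
(* The least number of nodes for which the sum of the translates is constant. *)
pose N := m.+1.
have [kappa kE] := trigp_node_sum (trigp_fejer m) (ltnSn m).
have k1 : 1 <= kappa.
  rewrite -(kE (node N 0)) (bigD1 ord0)//= subrr /fejer cos0 (_ : (1 + 1) / 2 = 1); last by field.
  by rewrite expr1n lerDl; apply: sumr_ge0 => i _; exact: fejer_ge0.
have k0 : 0 < kappa by lra.
have ki : kappa^-1 <= 1 by rewrite invf_le1.
pose inab (i : 'I_N) := a <= node N i <= b.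
pose chi t := kappa^-1 * \sum_(i < N | inab i) fejer m (t - node N i).
(* The normalisation makes [1 - chi] the same sum over the complementary nodes, so both estimates of
   [chi] reduce to [small]. *)
have compl t : 1 - chi t = kappa^-1 * \sum_(i < N | ~~ inab i) fejer m (t - node N i).
  have : kappa^-1 * \sum_(i < N) fejer m (t - node N i) = 1.
    by rewrite kE mulVf// gt_eqF.
  by rewrite (bigID inab) /= mulrDr -/(chi t) => <-; rewrite addrAC subrr add0r.
have small (Q : pred 'I_N) t : (forall i, Q i -> s <= `|t - node N i| <= 2 * pi - s) ->
    kappa^-1 * \sum_(i < N | Q i) fejer m (t - node N i) <= eps.
  move=> Qs; apply: (@le_trans _ _ (\sum_(i < N | Q i) fejer m (t - node N i))).
    by rewrite ler_piMl//; apply: sumr_ge0 => i _; exact: fejer_ge0.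
  apply: (@le_trans _ _ (\sum_(i < N | Q i) expR (- (m%:R * (s ^+ 2 / 5))))).
    by apply: ler_sum => i /Qs/andP[h1 h2]; exact: fejer_le.
  rewrite sumr_const -[leLHS]mulr_natl ler_wpM2r ?expR_ge0// ler_nat.
  by apply: leq_trans (max_card _) _; rewrite card_ord.
have nodeB (i : 'I_N) : - pi <= node N i <= pi.
  have i1 : i%:R / N%:R <= 1 :> R.
    by rewrite ler_pdivrMr ?ltr0n// mul1r ler_nat ltnW.
  have i0 : 0 <= i%:R / N%:R :> R by rewrite divr_ge0.
  have h1 : pi * (i%:R / N%:R) <= pi * 1 :> R by rewrite ler_wpM2l// ltW.
  have h2 : 0 <= pi * (i%:R / N%:R) :> R by rewrite mulr_ge0// ltW.
  have -> : node N i = - pi + 2 * (pi * (i%:R / N%:R)) by rewrite /node !mulrA.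
  by apply/andP; split; lra.
exists chi; split.
- have H := @trigp_sum _ (index_enum 'I_N) inab m 1 (fun i t => fejer m (t - node N i)) ler01
    (fun i => trigp_shift (node N i) (trigp_fejer m)).
  have [l [fl lm lA]] := trigp_scale kappa^-1 H; exists l; split => //.
  apply: le_trans lA _; rewrite mulr1 ger0_norm ?invr_ge0 ?(ltW k0)//.
  by rewrite -[index_enum _]/(index_enum _) /index_enum -enumT size_enum_ord ler_piMl.
- move=> t; apply/andP; split.
    by rewrite mulr_ge0 ?invr_ge0 ?(ltW k0)//; apply: sumr_ge0 => i _; exact: fejer_ge0.
  rewrite -subr_ge0 compl mulr_ge0 ?invr_ge0 ?(ltW k0)//.
  by apply: sumr_ge0 => i _; exact: fejer_ge0.
- move=> t; rewrite ler_norml => /andP[t1 t2] far; apply: small => i /andP[ia ib].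
  case/orP: far => h.
    by rewrite ler0_norm; [apply/andP; split; lra|lra].
  by rewrite ger0_norm; [apply/andP; split; lra|lra].
move=> t _ /andP[ta tb]; suff : 1 - chi t <= eps by lra.
rewrite compl; apply: small => i; rewrite negb_and -!ltNge => far.
have /andP[n1 n2] := nodeB i.
case/orP: far => h.
  by rewrite ger0_norm; [apply/andP; split; lra|lra].
by rewrite ler0_norm; [apply/andP; split; lra|lra].
Qed.

End TrigPoly.

(** * Normal approximation on rectangles *)

Section RectCLT.
Context d (T : measurableType d) (R : realType) (P : probability T R).
Variables (U V : T -> R) (m : nat) (r s eta delta : R).
Hypotheses (mU : measurable_fun setT U) (mV : measurable_fun setT V).
Hypotheses (r1 : 1 <= r) (s0 : 0 <= s) (s1 : s <= 1/2).
Hypothesis charUV : forall u v th : R, `|u| <= m%:R / r -> `|v| <= m%:R / r ->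
  `|Ex P (fun w => cos (u * U w + v * V w + th)) - expR (- ((u ^+ 2 + v ^+ 2) / 2)) * cos th| <= eta.
Hypotheses (tailU : Pr P [set w | r <= `|U w|] <= delta)
  (tailV : Pr P [set w | r <= `|V w|] <= delta).

Let r0 : 0 < r. Proof. exact: lt_le_trans r1. Qed.

Lemma intg_cos2 (u v th : R) : intg P (fun w => cos (u * U w + v * V w + th)).
Proof.
apply: (@intg_bdd _ _ _ _ _ 1); last by move=> w; exact: norm_cos_le1.
apply: (measurableT_comp (f := @cos R)).
  exact: continuous_measurable_fun (@continuous_cos R).
apply: measurable_funD => //; apply: measurable_funD; exact: measurable_funM.
Qed.

Lemma intg_coscos (u v th th' : R) : intg P (fun w => cos (u * U w + th) * cos (v * V w + th')).
Proof.
apply: (@intg_bdd _ _ _ _ _ 1).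
  by apply: measurable_funM; apply: (@intg_meas _ _ _ P); exact: intg_cos_lin.
by move=> w; rewrite normrM mulr_ile1// norm_cos_le1.
Qed.

Lemma Ex_coscos (u v th th' : R) : `|u| <= m%:R / r -> `|v| <= m%:R / r ->
  `|Ex P (fun w => cos (u * U w + th) * cos (v * V w + th')) -
     (expR (- (u ^+ 2 / 2)) * cos th) * (expR (- (v ^+ 2 / 2)) * cos th')| <= eta.
Proof.
move=> hu hv; have hv' : `|- v| <= m%:R / r by rewrite normrN.
have h1 := charUV (th + th') hu hv; have h2 := charUV (th - th') hu hv'.
have -> : Ex P (fun w => cos (u * U w + th) * cos (v * V w + th')) =
    1/2 * Ex P (fun w => cos (u * U w + v * V w + (th + th'))) +
    1/2 * Ex P (fun w => cos (u * U w + - v * V w + (th - th'))).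
  rewrite -!ExZ; try exact: intg_cos2.
  rewrite -ExD; try by apply: intgZ; exact: intg_cos2.
  apply: eq_Ex => w.
  rewrite (_ : u * U w + v * V w + (th + th') = (u * U w + th) + (v * V w + th')); last by ring.
  rewrite (_ : u * U w + - v * V w + (th - th') = (u * U w + th) - (v * V w + th')); last by ring.
  by move: (u * U w + th) (v * V w + th') => A B; rewrite cosD cosB; field.
rewrite sqrrN cosD in h2; rewrite cosD in h1.
rewrite cosN sinN in h2.
set e := expR (- ((u ^+ 2 + v ^+ 2) / 2)) in h1 h2.
have -> : expR (- (u ^+ 2 / 2)) * cos th * (expR (- (v ^+ 2 / 2)) * cos th') =
   e * (cos th * cos th').
  rewrite /e (_ : - ((u ^+ 2 + v ^+ 2) / 2) = - (u ^+ 2 / 2) + - (v ^+ 2 / 2)); last by field.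
  by rewrite expRD; ring.
move: h1 h2; set E1 := Ex _ _; set E2 := Ex _ _ => h1 h2.
have -> : 1/2 * E1 + 1/2 * E2 - e * (cos th * cos th') =
  1/2 * (E1 - e * (cos th * cos th' - sin th * sin th')) +
  1/2 * (E2 - e * (cos th * cos th' - sin th * - sin th')) by field.
rewrite (le_trans (ler_normD _ _))// [X in X + _]normrM [X in _ + X]normrM (@ger0_norm _ (1/2)) ?divr_ge0//.
lra.
Qed.

Lemma intgm_cos (u th : R) : intgm (fun x => cos (u * x + th)).
Proof. exact: intgm_bdd (measurable_cos_lin u th) (fun x => norm_cos_le1 _). Qed.

Lemma GE_tp (l : seq (R * nat * R)) :
  intgm (fun x => tpe l (x / r)) /\
  GE (fun x => tpe l (x / r)) =
    \sum_(p <- l) p.1.1 * (expR (- ((p.1.2%:R / r) ^+ 2 / 2)) * cos p.2).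
Proof.
elim: l => [|p l [il el]].
  have -> : (fun x => tpe [::] (x / r)) = cst 0.
    by apply/funext => x; rewrite /tpe big_nil.
  rewrite big_nil GE_cst; split => //.
  by apply: (@intgm_bdd _ _ 0) => // x; rewrite normr0.
have -> : (fun x => tpe (p :: l) (x / r)) =
    (fun x => p.1.1 * cos (p.1.2%:R / r * x + p.2) + tpe l (x / r)).
  apply/funext => x; rewrite /tpe big_cons; congr (_ * cos (_ + _) + _); ring.
have ip := intgmZ p.1.1 (intgm_cos (p.1.2%:R / r) p.2).
split; first exact: intgmD.
by rewrite big_cons GE_D// el GE_Z ?GE_cos//; exact: intgm_cos.
Qed.

Lemma Ex_tp (l l' : seq (R * nat * R)) : all (fun p => p.1.2 <= m)%N l ->
  all (fun p => p.1.2 <= m)%N l' ->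
  `|Ex P (fun w => tpe l (U w / r) * tpe l' (V w / r)) -
    GE (fun x => tpe l (x / r)) * GE (fun x => tpe l' (x / r))| <= tpn l * tpn l' * eta.
Proof.
move=> lm lm'.
have E : (fun w => tpe l (U w / r) * tpe l' (V w / r)) =
  (fun w => \sum_(p <- l) \sum_(q <- l') (p.1.1 * q.1.1) *
     (cos (p.1.2%:R / r * U w + p.2) * cos (q.1.2%:R / r * V w + q.2))).
  apply/funext => w; rewrite /tpe big_distrlr /=; apply: eq_bigr => p _; apply: eq_bigr => q _.
  by rewrite mulrACA; congr (_ * (cos (_ + _) * cos (_ + _))); ring.
have ipq (p q : R * nat * R) : intg P (fun w => (p.1.1 * q.1.1) *
     (cos (p.1.2%:R / r * U w + p.2) * cos (q.1.2%:R / r * V w + q.2))).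
  by apply: intgZ; exact: intg_coscos.
rewrite E Ex_sum; last by move=> p _; apply: intg_sum => q _; exact: ipq.
rewrite (GE_tp l).2 (GE_tp l').2 big_distrlr /= -sumrB.
rewrite /tpn big_distrlr /= mulr_suml (le_trans (ler_norm_sum _ _ _))//.
rewrite big_seq [X in _ <= X]big_seq; apply: ler_sum => p pl.
rewrite Ex_sum; last by move=> q _; exact: ipq.
rewrite -sumrB mulr_suml (le_trans (ler_norm_sum _ _ _))//.
rewrite big_seq [X in _ <= X]big_seq; apply: ler_sum => q ql.
rewrite ExZ; last exact: intg_coscos.
rewrite (_ : p.1.1 * _ * (q.1.1 * _) = (p.1.1 * q.1.1) * ((expR (- ((p.1.2%:R / r) ^+ 2 / 2)) * cos p.2) *
  (expR (- ((q.1.2%:R / r) ^+ 2 / 2)) * cos q.2))); last by ring.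
rewrite -mulrBr normrM -[X in _ <= X * _]normrM ler_wpM2l//.
have fr j : (j <= m)%N -> `|j%:R / r| <= m%:R / r.
  by move=> jm; rewrite ger0_norm ?divr_ge0 ?(ltW r0)// ler_pM2r ?invr_gt0// ler_nat.
apply: Ex_coscos; apply: fr.
  by move/allP: lm; exact.
by move/allP: lm'; exact.
Qed.

(** [eps] is the error of a cutoff away from its edges. [e1] bounds the resulting error in Gaussian
    mean: the thickened edges, [eps], and the mass outside [[- r, r]], where the periodic cutoff is
    uncontrolled. *)
Let eps : R := m.+1%:R * expR (- (m%:R * (s ^+ 2 / 5))).
Let e1 : R := 4 * (r * s) + eps + 8 / r ^+ 2.

Lemma phi0_le1 : phi0 R <= 1.
Proof.
have p0 := pi_ge2 R.
rewrite -(@ler_pXn2r _ 2) ?nnegrE ?(ltW (phi0_gt0 R))// phi0_sqr expr1n invf_le1; lra.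
Qed.

Lemma gm_le_len (a b : R) : a <= b -> gm a b <= b - a.
Proof.
move=> ab; apply: le_trans (gm_le ab) _.
by rewrite ler_piMl ?subr_ge0// phi0_le1.
Qed.


Let div_le_pi (x : R) : ~~ (r < `|x|) -> `|x / r| <= pi.
Proof.
rewrite -leNgt => xr; have := pi_ge2 R.
have : `|x / r| <= 1 by rewrite normrM normfV (gtr0_norm r0) ler_pdivrMr// mul1r.
by lra.
Qed.

Let intgm_trigp (A : R) (chi : R -> R) : trigp m A chi -> intgm (fun x => chi (x / r)).
Proof.
case=> l [fl _ _]; have [il _] := GE_tp l.
by rewrite (_ : (fun x => chi (x / r)) = (fun x => tpe l (x / r)))//; apply/funext => x.
Qed.

Let gm_thicken (a b t : R) : 0 <= t -> gm (a - t) (b + t) <= gm a b + 2 * t.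
Proof.
move=> t0; have h1 := @gm_le_len (a - t) a ltac:(lra); have h2 := @gm_le_len b (b + t) ltac:(lra).
suff : gm (a - t) (b + t) <= gm a b + (gm (a - t) a + gm b (b + t)) by lra.
rewrite /gm -!GE_D; try (apply: intgmD; exact: intgm_ivl); try exact: intgm_ivl.
apply: GE_le => [| |x]; [exact: intgm_ivl|by apply: intgmD; [|apply: intgmD]; exact: intgm_ivl|].
rewrite /ivl; case: (boolP (a - t <= x <= b + t)) => [/andP[xa xb]|_] /=; last first.
  by rewrite !addr_ge0.
have [ax|xa'] := leP a x; last by rewrite xa (ltW xa') /= addrCA lerDl addr_ge0.
have [xb'|bx] := leP x b; first by rewrite lerDl addr_ge0.
by rewrite (ltW bx) xb /= addrA lerDr addr_ge0.
Qed.

Let gm_thin (a b t : R) : 0 <= t -> gm a b - 2 * t <= gm (a + t) (b - t).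
Proof.
by move=> t0; have := @gm_thicken (a + t) (b - t) t t0; rewrite addrK subrK; lra.
Qed.

(** The cutoff is built on the interval enlarged by [s] on each side in the variable [x / r]. It is
    then close to 1 on all of [[a, b]], and its transition ends within [2 r s] of it. *)
Let cutoff_upper (a b : R) : - r <= a -> b <= r -> exists chi : R -> R,
  [/\ trigp m m.+1%:R chi, forall t, 0 <= chi t <= 1,
    forall x, a <= x <= b -> 1 - eps <= chi (x / r) &
    GE (fun x => chi (x / r)) <= gm a b + e1].
Proof.
move=> ar br; have p2 := pi_ge2 R.
have ar' : - 1 <= a / r by rewrite ler_pdivlMr// mulN1r.
have br' : b / r <= 1 by rewrite ler_pdivrMr// mul1r.
have s1' : s <= 1 by have h := s1; lra.
have am : - (pi - s) <= a / r - s by have h := s1; have h0 := s0; lra.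
have bm : b / r + s <= pi - s by have h := s1; have h0 := s0; lra.
have [chi [tchi chi01 far near]] := trig_cutoff m s0 s1' am bm.
rewrite -/eps in far near.
exists chi; split => // [x /andP[ax xb]|].
  have h1 : a / r <= x / r by rewrite ler_pM2r ?invr_gt0.
  have h2 : x / r <= b / r by rewrite ler_pM2r ?invr_gt0.
  apply: near; last by apply/andP; split; lra.
  by rewrite ler_norml; apply/andP; split; lra.
have rs0 : 0 <= 2 * (r * s) by rewrite !mulr_ge0// ltW.
have := gm_thicken a b rs0; have := GE_tail r0.
have ic : intgm (fun=> eps) by apply: (@intgm_bdd _ _ `|eps|).
have io : intgm (outside r) by exact: intgm_bdd (measurable_outside r) (norm_outside_le1 r).
have ichi := intgm_trigp tchi.
have : GE (fun x => chi (x / r)) <= gm (a - 2 * (r * s)) (b + 2 * (r * s)) + (eps + GE (outside r)).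
  rewrite -{1}(GE_cst eps) /gm -!GE_D//; [|exact: intgm_ivl|exact: intgmD].
  apply: GE_le => //; first by apply: intgmD; [exact: intgm_ivl|exact: intgmD].
  have e0 : 0 <= eps by rewrite mulr_ge0// expR_ge0.
  move=> x; have /andP[c0 c1] := chi01 (x / r); rewrite /outside.
  case: (boolP (r < `|x|)) => [_|xr] /=; first by have := @ivl_ge0 R (a - 2 * (r * s)) (b + 2 * (r * s)) x; lra.
  rewrite /ivl; case: (boolP (_ <= x <= _)) => [_|xn] /=; first by lra.
  rewrite addr0 add0r; apply: far; first exact: div_le_pi.
  rewrite negb_and -!ltNge in xn; case/orP: xn => h; apply/orP; [left|right].
    by rewrite ler_pdivrMr// !mulrBl divfK ?gt_eqF//; lra.
  by rewrite ler_pdivlMr// !mulrDl divfK ?gt_eqF//; lra.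
rewrite /e1; lra.
Qed.

Let cutoff_lower (a b : R) : - r <= a -> b <= r -> exists chi : R -> R,
  [/\ trigp m m.+1%:R chi, forall t, 0 <= chi t <= 1,
    forall x, `|x| <= r -> ~~ (a <= x <= b) -> chi (x / r) <= eps &
    gm a b - e1 <= GE (fun x => chi (x / r))].
Proof.
move=> ar br; have p2 := pi_ge2 R.
have ar' : - 1 <= a / r by rewrite ler_pdivlMr// mulN1r.
have br' : b / r <= 1 by rewrite ler_pdivrMr// mul1r.
have s1' : s <= 1 by have h := s1; lra.
have am : - (pi - s) <= a / r + s by have h := s1; have h0 := s0; lra.
have bm : b / r - s <= pi - s by have h := s1; have h0 := s0; lra.
have [chi [tchi chi01 far near]] := trig_cutoff m s0 s1' am bm.
rewrite -/eps in far near.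
exists chi; split => // [x xr|].
  rewrite negb_and -!ltNge => xn; apply: far; first by apply: div_le_pi; rewrite -leNgt.
  case/orP: xn => h; apply/orP; [left|right].
    have : x / r <= a / r by rewrite ler_pM2r ?invr_gt0// ltW.
    lra.
  have : b / r <= x / r by rewrite ler_pM2r ?invr_gt0// ltW.
  lra.
have rs0 : 0 <= 2 * (r * s) by rewrite !mulr_ge0// ltW.
have := gm_thin a b rs0; have := GE_tail r0.
have ic : intgm (fun=> eps) by apply: (@intgm_bdd _ _ `|eps|).
have io : intgm (outside r) by exact: intgm_bdd (measurable_outside r) (norm_outside_le1 r).
have ichi := intgm_trigp tchi.
have : gm (a + 2 * (r * s)) (b - 2 * (r * s)) <= GE (fun x => chi (x / r)) + (eps + GE (outside r)).
  rewrite -{1}(GE_cst eps) /gm -!GE_D//; last exact: intgmD.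
  apply: GE_le; [exact: intgm_ivl|by apply: intgmD => //; exact: intgmD|].
  have e0 : 0 <= eps by rewrite mulr_ge0// expR_ge0.
  move=> x; have /andP[c0 c1] := chi01 (x / r); rewrite /outside.
  have := @ivl_le1 R (a + 2 * (r * s)) (b - 2 * (r * s)) x.
  case: (boolP (r < `|x|)) => [_|xr] /=; first by lra.
  rewrite /ivl; case: (boolP (_ <= x <= _)) => [/andP[h1 h2]|xn] /= _; last by lra.
  rewrite addr0; suff : 1 - eps <= chi (x / r) by lra.
  apply: near; first exact: div_le_pi.
  apply/andP; split.
    by rewrite ler_pdivlMr// !mulrDl divfK ?gt_eqF//; lra.
  by rewrite ler_pdivrMr// !mulrBl divfK ?gt_eqF//; lra.
rewrite /e1; lra.
Qed.

Definition rect (a b a' b' : R) : set T := [set w | a <= U w <= b] `&` [set w | a' <= V w <= b'].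

Lemma measurable_rect (a b a' b' : R) : measurable (rect a b a' b').
Proof. by apply: measurableI; exact: meas_itv. Qed.

Definition rect_err : R :=
  2 * (4 * (r * s) + m.+1%:R * expR (- (m%:R * (s ^+ 2 / 5))) + 8 / r ^+ 2) +
  m.+1%:R ^+ 2 * eta + 2 * (m.+1%:R * expR (- (m%:R * (s ^+ 2 / 5)))) + 2 * delta.

Let GE01 (chi : R -> R) : trigp m m.+1%:R chi -> (forall t, 0 <= chi t <= 1) ->
  0 <= GE (fun x => chi (x / r)) <= 1.
Proof.
move=> tc c01; have ic := intgm_trigp tc; apply/andP; split.
  rewrite -(GE_cst 0); apply: GE_le => //; first by apply: (@intgm_bdd _ _ 0) => // x; rewrite normr0.
  by move=> x; have /andP[] := c01 (x / r).
rewrite -[leRHS](GE_cst 1); apply: GE_le => //; first by apply: (@intgm_bdd _ _ 1) => // x; rewrite normr1.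
by move=> x; have /andP[] := c01 (x / r).
Qed.

Let Ex_cutoffs (chi chi' : R -> R) : trigp m m.+1%:R chi -> trigp m m.+1%:R chi' ->
  intg P (fun w => chi (U w / r) * chi' (V w / r)) /\
  `|Ex P (fun w => chi (U w / r) * chi' (V w / r)) -
    GE (fun x => chi (x / r)) * GE (fun x => chi' (x / r))| <= m.+1%:R ^+ 2 * eta.
Proof.
move=> [l [fl lm lA]] [l' [fl' lm' lA']].
have E : (fun w => chi (U w / r) * chi' (V w / r)) =
    (fun w => tpe l (U w / r) * tpe l' (V w / r)).
  by apply/funext => w; rewrite fl fl'.
have eta0 : 0 <= eta.
  apply: le_trans (@charUV 0 0 0 _ _); rewrite ?normr_ge0// normr0 divr_ge0// ltW//.
have tpn0 (k : seq (R * nat * R)) : 0 <= tpn k by apply: sumr_ge0.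
split.
  rewrite E /tpe.
  have -> : (fun w => (\sum_(p <- l) p.1.1 * cos (p.1.2%:R * (U w / r) + p.2)) *
       (\sum_(p <- l') p.1.1 * cos (p.1.2%:R * (V w / r) + p.2))) =
    (fun w => \sum_(p <- l) \sum_(q <- l') (p.1.1 * q.1.1) *
     (cos (p.1.2%:R / r * U w + p.2) * cos (q.1.2%:R / r * V w + q.2))).
    apply/funext => w; rewrite big_distrlr /=; apply: eq_bigr => p _; apply: eq_bigr => q _.
    by rewrite mulrACA; congr (_ * (cos (_ + _) * cos (_ + _))); ring.
  by apply: intg_sum => p _; apply: intg_sum => q _; apply: intgZ; exact: intg_coscos.
rewrite E (eq_GE (g := fun x => tpe l (x / r))); last by move=> x; exact: fl.
rewrite [X in _ * X](eq_GE (g := fun x => tpe l' (x / r))); last by move=> x; exact: fl'.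
apply: le_trans (Ex_tp lm lm') _.
by rewrite ler_wpM2r// expr2 ler_pM.
Qed.

Let mtail (W : T -> R) : measurable_fun setT W -> measurable [set w | r <= `|W w|].
Proof. by move=> mW; apply: meas_le => //; apply: measurableT_comp. Qed.

(** The indicator of the rectangle is squeezed between products of cutoffs. Above, the product is
    nonnegative everywhere and only [2 eps] is lost; below, the periodic cutoffs may be large
    outside [[- r, r]], and the tails of [U] and [V] cost [2 delta]. *)
Lemma rect_clt (a b a' b' : R) : - r <= a -> b <= r -> - r <= a' -> b' <= r ->
  `|Pr P (rect a b a' b') - gm a b * gm a' b'| <= rect_err.
Proof.
move=> ar br ar' br'.
have mR := measurable_rect a b a' b'.
have e0 : 0 <= eps by rewrite mulr_ge0// expR_ge0.
have iT := @intg_indic _ _ _ P _ (mtail mU); have iT' := @intg_indic _ _ _ P _ (mtail mV).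
have iR := @intg_indic _ _ _ P _ mR.
have [chi [tc c01 cin cG]] := cutoff_upper ar br.
have [chi' [tc' c01' cin' cG']] := cutoff_upper ar' br'.
have [psi [tp p01 pout pG]] := cutoff_lower ar br.
have [psi' [tp' p01' pout' pG']] := cutoff_lower ar' br'.
have [ic hc] := Ex_cutoffs tc tc'; have [ip hp] := Ex_cutoffs tp tp'.
have g0 := gm_ge0 a b; have g1 := gm_le1 a b; have g0' := gm_ge0 a' b'; have g1' := gm_le1 a' b'.
have icst : intg P (fun=> 2 * eps) by exact: intg_cst.
have icst' : intg P (fun=> eps) by exact: intg_cst.
have up : Pr P (rect a b a' b') <= Ex P (fun w => chi (U w / r) * chi' (V w / r)) + 2 * eps.
  rewrite -Ex_indic// -[X in _ + X](Ex_cst P) -ExD//; apply: Ex_le => //; first exact: intgD.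
  move=> w; have /andP[c0 c1] := c01 (U w / r); have /andP[c0' c1'] := c01' (V w / r).
  rewrite indicE; case: (boolP (w \in _)) => [|_] /=; last first.
    by rewrite addr_ge0 ?mulr_ge0//.
  rewrite inE => -[/= wU wV]; have k1 := cin _ wU; have k2 := cin' _ wV.
  have : 0 <= (1 - chi (U w / r)) * (1 - chi' (V w / r)) by rewrite mulr_ge0// subr_ge0.
  rewrite /cst; lra.
have lo : Ex P (fun w => psi (U w / r) * psi' (V w / r)) <= Pr P (rect a b a' b') + (eps + (delta + delta)).
  apply: (@le_trans _ _ (Pr P (rect a b a' b') + (eps + (Pr P [set w | r <= `|U w|] + Pr P [set w | r <= `|V w|])))); last first.
    by rewrite lerD2l lerD2l lerD.
  rewrite -!Ex_indic//; [|exact: mtail|exact: mtail].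
  have Ee : Ex P (fun=> eps) = eps := Ex_cst P eps.
  have iTT := intgD iT iT'; have iE := intgD icst' iTT; have iAll := intgD iR iE.
  rewrite -[X in _ + (X + _)]Ee -(ExD iT iT') -(ExD icst' iTT) -(ExD iR iE).
  apply: Ex_le => //.
  move=> w; have /andP[c0 c1] := p01 (U w / r); have /andP[c0' c1'] := p01' (V w / r).
  have pp1 : psi (U w / r) * psi' (V w / r) <= 1 by rewrite mulr_ile1.
  rewrite !indicE /cst.
  case: (boolP (w \in rect a b a' b')) => [_|wn] /=.
    by rewrite (le_trans pp1)// lerDl !addr_ge0.
  case: (boolP (w \in [set w | r <= `|U w|])) => [_|uT] /=.
    by rewrite (le_trans pp1)// add0r addrCA lerDl addr_ge0.
  case: (boolP (w \in [set w | r <= `|V w|])) => [_|vT] /=.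
    by rewrite (le_trans pp1)// !add0r lerDr.
  have uT' : `|U w| <= r by rewrite leNgt; apply/negP => h; move/negP: uT; apply; rewrite inE /=; exact: ltW.
  have vT' : `|V w| <= r by rewrite leNgt; apply/negP => h; move/negP: vT; apply; rewrite inE /=; exact: ltW.
  rewrite !addr0 add0r.
  case: (boolP (a <= U w <= b)) => [wU|wU].
    case: (boolP (a' <= V w <= b')) => [wV|wV].
      by move/negP: wn; case; rewrite inE.
    by apply: le_trans (pout' _ vT' wV); rewrite ler_piMl.
  by apply: le_trans (pout _ uT' wU); rewrite ler_piMr.
have /andP[G0 G1] := GE01 tc c01; have /andP[G0' G1'] := GE01 tc' c01'.
have /andP[H0 H1] := GE01 tp p01; have /andP[H0' H1'] := GE01 tp' p01'.
rewrite /rect_err -/eps -/e1.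
have e10 : 0 <= e1.
  by rewrite !addr_ge0 ?mulr_ge0 ?invr_ge0 ?sqr_ge0 ?(ltW r0).
have U1 : GE (fun x => chi (x / r)) * GE (fun x => chi' (x / r)) <= gm a b * gm a' b' + 2 * e1.
  move: cG cG' G0 G0' G1 G1'; set x := GE _; set y := GE _ => cG cG' G0 G0' G1 G1'.
  have h1 : (x - gm a b) * y <= e1.
    apply: (@le_trans _ _ (e1 * y)); first by rewrite ler_wpM2r//; lra.
    by rewrite ler_piMr.
  have h2 : gm a b * (y - gm a' b') <= e1.
    apply: (@le_trans _ _ (gm a b * e1)); first by rewrite ler_wpM2l//; lra.
    by rewrite ler_piMl.
  lra.
have L1 : gm a b * gm a' b' - 2 * e1 <= GE (fun x => psi (x / r)) * GE (fun x => psi' (x / r)).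
  move: pG pG' H0 H0' H1 H1'; set x := GE _; set y := GE _ => pG pG' H0 H0' H1 H1'.
  have h1 : (gm a b - x) * gm a' b' <= e1.
    apply: (@le_trans _ _ (e1 * gm a' b')); first by rewrite ler_wpM2r//; lra.
    by rewrite ler_piMr.
  have h2 : x * (gm a' b' - y) <= e1.
    apply: (@le_trans _ _ (x * e1)); first by rewrite ler_wpM2l//; lra.
    by rewrite ler_piMl.
  lra.
have delta0 : 0 <= delta by apply: le_trans tailU; exact: Pr_ge0.
move: hc hp; rewrite !ler_norml => /andP[_ hc] /andP[hp _].
by apply/andP; split; lra.
Qed.

End RectCLT.

(** * Wedge probabilities *)

Section Wedge.
Context d (T : measurableType d) (R : realType) (P : probability T R).
Variables (U V : T -> R) (r E : R) (D : nat).
Hypotheses (mU : measurable_fun setT U) (mV : measurable_fun setT V).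
Hypothesis rectUV : forall a b a' b' : R, - r <= a -> b <= r -> - r <= a' -> b' <= r ->
  `|Pr P (rect U V a b a' b') - gm a b * gm a' b'| <= E.
Hypotheses (D1 : (0 < D)%N) (rD : D%:R ^+ 3 <= r) (r4 : 4 <= r).

Lemma gm_superadd (a b c : R) : a <= b -> b <= c -> gm a b + gm b c <= gm a c.
Proof.
move=> ab bc.
have bb : gm b b = 0.
  by apply/le_anti; rewrite gm_ge0 andbT (le_trans (gm_le (lexx b)))// subrr mulr0.
rewrite -[leRHS]addr0 -bb /gm -!GE_D; try exact: intgm_ivl.
apply: GE_le; try (by apply: intgmD; exact: intgm_ivl).
move=> x; rewrite /ivl -!natrD ler_nat.
case: (leP a x) => xa; case: (leP x b) => xb; case: (leP b x) => bx; case: (leP x c) => xc //=;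
  rewrite ?andbF ?andbT //=; exfalso; lra.
Qed.

Let th : R := D%:R^-1.
(* The wedge is compared with unions of [S] rectangles, over the cells
   [[i th, (i + 1) th]] of the values of [V], which cover [[0, D ^ 3]]. *)
Let S : nat := (D ^ 4)%N.
Let cell i : R := i%:R * th.

Let D0 : 0 < D%:R :> R. Proof. by rewrite ltr0n. Qed.
Let th0 : 0 < th. Proof. by rewrite invr_gt0. Qed.
Let th1 : th <= 1. Proof. by rewrite invf_le1// ler1n. Qed.
Let Dth : D%:R * th = 1. Proof. by rewrite divff// gt_eqF. Qed.
Let cellS : cell S = D%:R ^+ 3.
Proof. by rewrite /cell /S natrX exprS mulrAC Dth mul1r. Qed.

Let cell_le i : (i <= S)%N -> cell i <= D%:R ^+ 3.
Proof. by move=> iS; rewrite -cellS /cell ler_wpM2r ?(ltW th0)// ler_nat. Qed.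
Let cell_ge0 i : 0 <= cell i. Proof. by rewrite /cell mulr_ge0// ltW. Qed.
Let cell_S i : cell i.+1 = cell i + th.
Proof. by rewrite /cell -[i.+1%:R]natr1 mulrDl mul1r. Qed.
Let cell_leS i : cell i <= cell i.+1. Proof. by rewrite cell_S lerDl ltW. Qed.

Let sum_gm n : \sum_(i < n) gm (cell i) (cell i.+1) <= gm 0 (cell n).
Proof.
elim: n => [|n IH]; first by rewrite big_ord0 gm_ge0.
rewrite big_ord_recr /=; apply: le_trans (gm_superadd (cell_ge0 n) (cell_leS n)).
by rewrite lerD2r.
Qed.

Let sum_gm1 n : \sum_(i < n) gm (cell i) (cell i.+1) <= 1.
Proof. exact: le_trans (sum_gm n) (gm_le1 _ _). Qed.

(** A lower sum for the integral of [x * phi x], which over the half-line equals [phi0]. *)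
Let sum_xgm_le n : \sum_(i < n) cell i * gm (cell i) (cell i.+1) <= phi0 R.
Proof.
suff : \sum_(i < n) cell i * gm (cell i) (cell i.+1) <= phi0 R - phi (cell n).
  by have := phi_ge0 (cell n); lra.
elim: n => [|n IH]; first by rewrite big_ord0 /cell mul0r phi_0 subrr.
rewrite big_ord_recr /=; have /andP[h _] := gm_xphi (cell_leS n); lra.
Qed.

Let sum_xgm_ge n : phi0 R - phi (cell n) <= \sum_(i < n) cell i.+1 * gm (cell i) (cell i.+1).
Proof.
elim: n => [|n IH]; first by rewrite big_ord0 /cell mul0r phi_0 subrr.
rewrite big_ord_recr /=; have /andP[_ h] := gm_xphi (cell_leS n); lra.
Qed.

(** The error of a rectangle is paid once per cell, that is [D ^ 4] times; this is why [D ^ -9] is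
    required of it. *)
Let S_E : E <= th ^+ 9 -> S%:R * E <= th ^+ 5.
Proof.
move=> hE; apply: (@le_trans _ _ (S%:R * th ^+ 9)); first by rewrite ler_wpM2l.
by rewrite (exprD th 4 5) mulrA /S natrX -exprMn Dth expr1n mul1r.
Qed.

Variables (kappa rho : R).
Hypotheses (k0 : 0 <= kappa) (k1 : kappa <= th ^+ 4) (rho0 : 0 <= rho) (rho1 : rho <= 3 * th ^+ 5).

Let th4 : th ^+ 4 <= 1. Proof. by rewrite exprn_ile1// ltW. Qed.
Let th5 : th ^+ 5 <= 1. Proof. by rewrite exprn_ile1// ltW. Qed.
Let th5_0 : 0 <= th ^+ 5. Proof. by rewrite exprn_ge0// ltW. Qed.

Let kcell i : (i <= S)%N -> 0 <= kappa * cell i <= th.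
Proof.
move=> iS; rewrite mulr_ge0//=; apply: (@le_trans _ _ (th ^+ 4 * D%:R ^+ 3)).
  by rewrite ler_pM// cell_le.
have -> : th ^+ 4 * D%:R ^+ 3 = (D%:R * th) ^+ 3 * th by ring.
by rewrite Dth expr1n mul1r.
Qed.

(** For [V] in a cell, [U] lies in an interval of length about [kappa V], where the density is at
    most [phi0]. Over all cells this gives [kappa * phi0] times the integral of [x * phi x], that is
    [kappa / (2 pi)], the mass of a sector of small angle [kappa]. The 9 consists of 1 for the width
    of a cell, 6 for [rho], 1 for the rectangles and 1 for [V >= D ^ 3]. *)
Lemma Pr_wedge_le : E <= th ^+ 9 -> Pr P [set w | D%:R ^+ 3 <= V w] <= th ^+ 6 ->
  Pr P [set w | [/\ 0 <= V w, - (kappa * V w + rho) <= U w & U w <= rho]] <=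
    kappa * phi0 R ^+ 2 + 9 * th ^+ 5.
Proof.
move=> hE tailV.
have mW : measurable [set w | [/\ 0 <= V w, - (kappa * V w + rho) <= U w & U w <= rho]].
  have -> : [set w | [/\ 0 <= V w, - (kappa * V w + rho) <= U w & U w <= rho]] =
      [set w | 0 <= V w] `&` ([set w | - (kappa * V w + rho) <= U w] `&` [set w | U w <= rho]).
    by apply/seteqP; split => w /=; [case|case=> ? []].
  apply: measurableI; first exact: meas_le.
  apply: measurableI; apply: meas_le => //; apply: measurableT_comp => //.
  by apply: measurable_funD => //; exact: measurable_funM.
have mT : measurable [set w | D%:R ^+ 3 <= V w] by exact: meas_le.
have mL : measurable [set w | V w < D%:R ^+ 3] by exact: meas_lt.
set W := [set w | _] in mW *.
pose B (i : 'I_S) := rect U V (- (kappa * cell i.+1 + rho)) rho (cell i) (cell i.+1).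
have cover : Pr P (W `&` [set w | V w < D%:R ^+ 3]) <= \sum_i Pr P (B i).
  apply: Pr_cover; [exact: measurableI|by move=> i; exact: measurable_rect|].
  move=> w [[V0 U1 U2] /= Vh].
  have t0 : 0 <= V w / th by rewrite divr_ge0// ltW.
  have tN : (Num.truncn (V w / th) < S)%N.
    rewrite -(ltr_nat R); apply: (@le_lt_trans _ _ (V w / th)); first by rewrite truncn_le.
    by rewrite ltr_pdivrMr// -/(cell S) cellS.
  exists (Ordinal tN); rewrite /B /=.
  set i := Num.truncn _; have /andP[m1 m2] := truncn_itv t0.
  rewrite -/i ler_pdivlMr// in m1; rewrite -/i ltr_pdivrMr// in m2.
  have m2' := ltW m2; split; rewrite /= ?m1 ?m2' ?U2 ?andbT//.
  by apply: le_trans U1; rewrite lerN2 lerD2r ler_wpM2l.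
have W_le : Pr P W <= Pr P (W `&` [set w | V w < D%:R ^+ 3]) + Pr P [set w | D%:R ^+ 3 <= V w].
  apply: Pr_setU => //; first exact: measurableI.
  by move=> w Ww; have [h|h] := leP (D%:R ^+ 3) (V w); [right|left].
have term (i : 'I_S) : Pr P (B i) <= (phi0 R * kappa) * (cell i * gm (cell i) (cell i.+1)) +
    (phi0 R * (kappa * th + 2 * rho)) * gm (cell i) (cell i.+1) + E.
  have iS := ltn_ord i; have /andP[kc0 kc1] := kcell iS.
  have c1 := cell_le iS; have c0 := cell_ge0 i; have c0' := cell_ge0 i.+1.
  have c2 := cell_leS i.
  have p1 : rho <= 3 by have := th5; have := rho1; lra.
  have := @rectUV (- (kappa * cell i.+1 + rho)) rho (cell i) (cell i.+1).
  rewrite lerN2; have r4' := r4; have rD' := rD; have th1' := th1.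
  have -> : kappa * cell i.+1 + rho <= r by lra.
  have -> : rho <= r by lra.
  have -> : - r <= cell i by lra.
  have -> : cell i.+1 <= r by lra.
  move=> /(_ isT isT isT isT); rewrite -/(B i) ler_norml => /andP[_ h].
  have g0 := gm_ge0 (cell i) (cell i.+1).
  have g1 : gm (- (kappa * cell i.+1 + rho)) rho <= phi0 R * (kappa * (cell i + th) + 2 * rho).
    have ab : - (kappa * cell i.+1 + rho) <= rho by have := rho0; lra.
    apply: le_trans (gm_le ab) _; rewrite ler_wpM2l ?(ltW (phi0_gt0 R))// -cell_S; lra.
  have := ler_wpM2r g0 g1; lra.
have sum_le : \sum_i Pr P (B i) <= (phi0 R * kappa) * phi0 R + (phi0 R * (kappa * th + 2 * rho)) + S%:R * E.
  apply: (@le_trans _ _ (\sum_(i < S) ((phi0 R * kappa) * (cell i * gm (cell i) (cell i.+1)) +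
    (phi0 R * (kappa * th + 2 * rho)) * gm (cell i) (cell i.+1) + E))).
    by apply: ler_sum => i _; exact: term.
  rewrite !big_split /= -!mulr_sumr sumr_const card_ord -[E *+ S]mulr_natl lerD2r.
  have p0 := ltW (phi0_gt0 R).
  apply: lerD.
    by rewrite ler_wpM2l ?sum_xgm_le// mulr_ge0.
  rewrite ler_piMr ?sum_gm1// mulr_ge0// addr_ge0 ?mulr_ge0// ltW//.
have kth : kappa * th <= th ^+ 5 by rewrite exprSr ler_wpM2r// ltW.
have p1 := phi0_le1 R; have p0 := phi0_gt0 R.
have a1 : phi0 R * (kappa * th + 2 * rho) <= th ^+ 5 + 6 * th ^+ 5.
  apply: (@le_trans _ _ (kappa * th + 2 * rho)); last by have := rho1; lra.
  by rewrite ler_piMl// addr_ge0 ?mulr_ge0// ltW.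
have th6 : th ^+ 6 <= th ^+ 5 by rewrite exprSr ler_piMr.
have hS := S_E hE.
have -> : kappa * phi0 R ^+ 2 = phi0 R * kappa * phi0 R by ring.
lra.
Qed.

(** The inner wedge is filled by rectangles whose common edges must not be counted twice. An edge
    [Z i] is a degenerate rectangle of Gaussian mass 0, so its removal costs a second [E] per
    cell. *)
Lemma Pr_wedge_ge : E <= th ^+ 9 ->
  kappa * phi0 R ^+ 2 - 14 * th ^+ 5 <=
  Pr P [set w | [/\ 0 <= V w, rho - kappa * V w <= U w & U w <= - rho]].
Proof.
move=> hE; set W := [set w | _].
have mW : measurable W.
  have -> : W = [set w | 0 <= V w] `&` ([set w | rho - kappa * V w <= U w] `&` [set w | U w <= - rho]).
    by apply/seteqP; split => w /=; [case|case=> ? []].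
  apply: measurableI; first exact: meas_le.
  apply: measurableI; apply: meas_le => //.
  by apply: measurable_funB => //; exact: measurable_funM.
have E0 : 0 <= E.
  have r4' := r4; have h : - r <= 0 by lra. have h' : 0 <= r by lra.
  exact: le_trans (normr_ge0 _) (rectUV h h' h h').
have -> : kappa * phi0 R ^+ 2 = phi0 R * kappa * phi0 R by ring.
pose A (i : 'I_S) := rect U V (rho - kappa * cell i) (- rho) (cell i) (cell i.+1).
pose Z (i : 'I_S) := rect U V (rho - kappa * cell i) (- rho) (cell i.+1) (cell i.+1).
pose B (i : 'I_S) := A i `&` [set w | V w < cell i.+1].
have mlt (i : 'I_S) : measurable [set w | V w < cell i.+1] by exact: meas_lt.
have mB i : measurable (B i) by apply: measurableI => //; exact: measurable_rect.
have disj : \sum_i Pr P (B i) <= Pr P W.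
  apply: Pr_disj => //.
    move=> i w [[/= /andP[U1 U2] /andP[V1 V2]] _]; split => //.
      exact: le_trans (cell_ge0 i) V1.
    by apply: le_trans U1; rewrite lerB// ler_wpM2l.
  have lt_cell (i j : nat) (x : R) : cell i <= x -> x < cell j.+1 -> (i <= j)%N.
    move=> h1 h2; have := le_lt_trans h1 h2.
    by rewrite /cell ltr_pM2r// ltr_nat ltnS.
  move=> i j w [[_ /= /andP[i1 _]] /= i2] [[_ /= /andP[j1 _]] /= j2].
  by apply/val_inj/eqP; rewrite /= eqn_leq (lt_cell _ _ _ i1 j2) (lt_cell _ _ _ j1 i2).
have AB i : Pr P (A i) <= Pr P (B i) + Pr P (Z i).
  apply: Pr_setU; [exact: measurable_rect|exact: mB|exact: measurable_rect|].
  move=> w [/= Uw /andP[V1 V2]]; have [h|h] := ltP (V w) (cell i.+1).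
    by left; split => //; split => //=; rewrite V1 V2.
  by right; split => //=; rewrite h V2.
have term (i : 'I_S) : (phi0 R * (1 - th / 2)) * (kappa * (cell i.+1 * gm (cell i) (cell i.+1))) -
    (kappa * th + 2 * rho) * gm (cell i) (cell i.+1) - 2 * E <= Pr P (B i).
  have iS := ltn_ord i; have /andP[kc0 kc1] := kcell (ltnW iS).
  have c1 := cell_le iS; have c0 := cell_ge0 i; have c0' := cell_ge0 i.+1.
  have c2 := cell_leS i.
  have p3 : rho <= 3 by have := th5; have := rho1; lra.
  have r4' := r4; have rD' := rD; have th1' := th1; have rho0' := rho0.
  have q1 : - r <= rho - kappa * cell i by lra.
  have q2 : - rho <= r by lra.
  have q3 : - r <= cell i by lra.
  have q4 : cell i.+1 <= r by lra.
  have q5 : - r <= cell i.+1 by lra.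
  have := rectUV q1 q2 q5 q4; rewrite -/(Z i).
  have -> : gm (cell i.+1) (cell i.+1) = 0.
    by apply/le_anti; rewrite gm_ge0 andbT (le_trans (gm_le (lexx _)))// subrr mulr0.
  rewrite mulr0 subr0 ler_norml => /andP[_ hZ].
  have := rectUV q1 q2 q3 q4; rewrite -/(A i) ler_norml => /andP[hA _].
  have hAB := AB i.
  have g0 := gm_ge0 (cell i) (cell i.+1).
  have p1 := phi0_le1 R; have p0 := phi0_gt0 R; have th0' := th0.
  have pt0 : 0 <= phi0 R * (1 - th / 2) by rewrite mulr_ge0 ?(ltW p0)//; lra.
  have pt1 : phi0 R * (1 - th / 2) <= 1 by rewrite mulr_ile1 ?(ltW p0)//; lra.
  (* For cells near 0 the interval may be empty; the left side is then not positive. Otherwise the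
     interval lies in [[- th, th]], where the density is at least [phi0 * (1 - th / 2)]. *)
  have g1 : phi0 R * (1 - th / 2) * (kappa * cell i - 2 * rho) <= gm (rho - kappa * cell i) (- rho).
    have [h|/ltW h] := leP (rho - kappa * cell i) (- rho).
      have := @gm_ge R (rho - kappa * cell i) (- rho) th h.
      rewrite (_ : - rho - (rho - kappa * cell i) = kappa * cell i - 2 * rho); last by ring.
      apply=> x /andP[x1 x2].
      have x3 : `|x| <= th by rewrite ler_norml; apply/andP; split; lra.
      rewrite -[x ^+ 2]real_normK ?num_real// expr2.
      apply: (@le_trans _ _ (1 * `|x|)); first by rewrite ler_wpM2r//; lra.
      by rewrite mul1r.
    apply: le_trans (gm_ge0 _ _); apply: mulr_ge0_le0 => //; lra.
  have g2 : phi0 R * (1 - th / 2) * (kappa * cell i.+1) - (kappa * th + 2 * rho) <=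
      gm (rho - kappa * cell i) (- rho).
    apply: le_trans g1; rewrite cell_S.
    have : phi0 R * (1 - th / 2) * (kappa * th + 2 * rho) <= 1 * (kappa * th + 2 * rho).
      by rewrite ler_wpM2r// addr_ge0 ?mulr_ge0// ltW.
    lra.
  have := ler_wpM2r g0 g2; lra.
have sum_ge : (phi0 R * (1 - th / 2)) * (kappa * (phi0 R - phi (D%:R ^+ 3))) -
    (kappa * th + 2 * rho) - S%:R * (2 * E) <= \sum_i Pr P (B i).
  apply: (@le_trans _ _ (\sum_(i < S) ((phi0 R * (1 - th / 2)) * (kappa * (cell i.+1 * gm (cell i) (cell i.+1))) -
    (kappa * th + 2 * rho) * gm (cell i) (cell i.+1) - 2 * E))); last first.
    by apply: ler_sum => i _; exact: term.
  rewrite !sumrB -!mulr_sumr sumr_const card_ord -[E *+ S]mulr_natl [2 * (S%:R * E)]mulrCA lerD2r.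
  have p0 := phi0_gt0 R; have th0' := th0; have th1' := th1.
  apply: lerB.
    apply: ler_wpM2l; first by rewrite mulr_ge0 ?(ltW p0)//; lra.
    by rewrite ler_wpM2l// -cellS sum_xgm_ge.
  by rewrite ler_piMr ?sum_gm1// addr_ge0 ?mulr_ge0// ltW.
have kth : kappa * th <= th ^+ 5 by rewrite exprSr ler_wpM2r// ltW.
have p1 := phi0_le1 R; have p0 := phi0_gt0 R.
have hS := S_E hE.
have phiD : phi (D%:R ^+ 3) <= 4 * th.
  have h := sqr_phi_le (D%:R ^+ 3 : R).
  have w1 : wide (D%:R ^+ 3 : R) <= 1.
    by rewrite /wide -expR0 ler_expR oppr_le0 divr_ge0// sqr_ge0.
  have h2 : (D%:R ^+ 3) ^+ 2 * phi (D%:R ^+ 3) <= 4 :> R.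
    apply: le_trans h _; rewrite -mulrA ler_piMr// mulr_ile1 ?wide_ge0// ltW//.
  have h3 : D%:R <= (D%:R ^+ 3) ^+ 2 :> R.
    by rewrite -exprM exprS ler_peMr ?(ltW D0)// exprn_ege1// ler1n.
  rewrite -(@ler_pM2l _ D%:R)// [D%:R * (4 * th)]mulrCA Dth mulr1; apply: le_trans h2.
  by rewrite ler_wpM2r ?phi_ge0.
have kk : kappa * (phi0 R * (phi0 R * (th / 2)) + phi0 R * (1 - th / 2) * phi (D%:R ^+ 3)) <= 5 * th ^+ 5.
  have th0' := th0; have th1' := th1.
  apply: (@le_trans _ _ (th ^+ 4 * (5 * th))); last by rewrite (exprSr th 4); lra.
  rewrite ler_pM//.
    by rewrite addr_ge0 ?mulr_ge0 ?phi_ge0 ?(ltW p0)//; lra.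
  have b1 : phi0 R * (phi0 R * (th / 2)) <= th / 2.
    by rewrite mulrA ler_piMl ?mulr_ile1 ?(ltW p0)//; lra.
  have b2 : phi0 R * (1 - th / 2) * phi (D%:R ^+ 3) <= 4 * th.
    apply: le_trans phiD; rewrite ler_piMl ?phi_ge0// mulr_ile1 ?(ltW p0)//; lra.
  lra.
have rr := rho1; lra.
Qed.

End Wedge.

(** * Variances of the derivatives at a point *)

Section PowerSums.
Variable R : realType.

Definition psum (n e : nat) : R := \sum_(j < n.+1) (j%:R : R) ^+ e.

Lemma pow_succ_bounds (x : R) e : 0 <= x ->
  e.+1%:R * x ^+ e <= (x + 1) ^+ e.+1 - x ^+ e.+1 <= e.+1%:R * (x + 1) ^+ e.
Proof.
move=> x0; have x1 : x <= x + 1 by rewrite lerDl.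
have x10 : 0 <= x + 1 by lra.
rewrite subrXX addrAC subrr add0r mul1r.
have S (y : R) : e.+1%:R * y = \sum_(i < e.+1) y by rewrite sumr_const card_ord mulr_natl.
rewrite !S; apply/andP; split; apply: ler_sum => i _ /=;
  have ie : (i <= e)%N by rewrite -ltnS.
  have -> : x ^+ e = x ^+ (e - i) * x ^+ i by rewrite -exprD subnK.
  by rewrite ler_wpM2r ?exprn_ge0// lerXn2r// nnegrE.
have -> : (x + 1) ^+ e = (x + 1) ^+ (e - i) * (x + 1) ^+ i by rewrite -exprD subnK.
by rewrite ler_wpM2l ?exprn_ge0// lerXn2r// nnegrE.
Qed.

Lemma psum_bounds n e : (n%:R : R) ^+ e.+1 <= e.+1%:R * psum n e <= n%:R ^+ e.+1 + e.+1%:R * n%:R ^+ e.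
Proof.
elim: n => [|n /andP[IH1 IH2]].
  by rewrite /psum big_ord_recr big_ord0 /= !add0r [0 ^+ e.+1]expr0n /= add0r lexx andbT mulr_ge0// exprn_ge0.
have E : psum n.+1 e = psum n e + n.+1%:R ^+ e by rewrite /psum big_ord_recr.
have /andP[h1 h2] := @pow_succ_bounds n%:R e (ler0n _ _).
rewrite E mulrDr; rewrite natr1 in h1 h2.
by apply/andP; split; lra.
Qed.

Lemma psum_ge0 n e : 0 <= psum n e.
Proof. by apply: sumr_ge0 => i _; rewrite exprn_ge0. Qed.

Lemma psum_gt0 n e : (0 < n)%N -> 0 < psum n e.
Proof.
move=> n0; have /andP[h _] := psum_bounds n e.
have : 0 < e.+1%:R * psum n e by apply: lt_le_trans h; rewrite exprn_gt0// ltr0n.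
by rewrite pmulr_rgt0// ltr0n.
Qed.

Lemma psum_le n e d : psum n (e + d) <= n%:R ^+ d * psum n e.
Proof.
rewrite /psum mulr_sumr; apply: ler_sum => i _; rewrite exprD mulrC ler_wpM2r ?exprn_ge0//.
by rewrite lerXn2r ?nnegrE// ler_nat -ltnS.
Qed.

End PowerSums.

(** * Second moments of the normalised derivatives *)

Section Coefficients.
Variables (R : realType) (n k : nat).
Implicit Types (a x : R).

(* With these, the derivative of order [k] of the trigonometric polynomial with
   coefficients [X] is the cosine sum with coefficients [X i * freq i ^ k]; its own
   derivative of order [m] at [a] is [\sum_i gco a m i * X i]. *)
Definition freq (i : 'I_n.+1 + 'I_n) : nat :=
  match i with inl j => j | inr j => j.+1 end.

Definition phase (i : 'I_n.+1 + 'I_n) : R :=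
  (match i with inl _ => 0 | inr _ => - (pi / 2) end) + k%:R * (pi / 2).

Definition gco a (m : nat) (i : 'I_n.+1 + 'I_n) : R :=
  (freq i)%:R ^+ (k + m) * cos ((freq i)%:R * a + phase i + m%:R * (pi / 2)).

Lemma freq_le i : (freq i <= n)%N.
Proof. by case: i => j /=; [rewrite -ltnS|]. Qed.

Lemma tsum_gco (X : 'I_n.+1 + 'I_n -> R) m a :
  tsum freq phase (fun i => X i * (freq i)%:R ^+ k) m a = \sum_i gco a m i * X i.
Proof. by apply: eq_bigr => i _; rewrite /gco exprD; ring. Qed.

Lemma trig_poly_derivE (xi : 'I_n.+1 -> R) (eta : 'I_n -> R) :
  (trig_poly xi eta)^`(k)%classic =
  tsum freq phase (fun i => sum_family xi eta i * (freq i)%:R ^+ k) 0.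
Proof.
pose ph0 (i : 'I_n.+1 + 'I_n) : R := match i with inl _ => 0 | inr _ => - (pi / 2) end.
have -> : trig_poly xi eta = tsum freq ph0 (sum_family xi eta) 0.
  apply/funext => x; rewrite /tsum /trig_poly big_sumType /=; congr (_ + _); apply: eq_bigr => i _.
    by rewrite expr0 mul1r mul0r !addr0.
  by rewrite expr0 mul1r mul0r addr0 cosBpihalf.
rewrite (deriv_familyE k (@tsum_deriv R _ freq ph0 _)).
apply/funext => x; apply: eq_bigr => i _.
by rewrite expr0 mul1r mul0r addr0 mulrA /phase addrA.
Qed.

(** The cosine and the sine of the same frequency are taken together; the frequency 0 has no
    partner. *)
Lemma sum_pairs (h : 'I_n.+1 + 'I_n -> R) (w : nat -> R) : h (inl ord0) = w 0%N ->
  (forall j : 'I_n, h (inl (lift ord0 j)) + h (inr j) = w j.+1) ->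
  \sum_i h i = \sum_(j < n.+1) w j.
Proof.
move=> h0 hS; rewrite big_sumType /= !big_ord_recl h0 -addrA -big_split /=; congr (_ + _).
by apply: eq_bigr => j _; rewrite hS.
Qed.

(** Each pair contributes [cos ^ 2 + sin ^ 2 = 1] times a power of its frequency, so the variance
    does not depend on [a]. *)
Lemma gco_sqr a m : \sum_i gco a m i ^+ 2 = psum R n (2 * (k + m)).
Proof.
apply: (@sum_pairs _ (fun j => j%:R ^+ (2 * (k + m)))) => [|j]; rewrite /gco /phase /=.
  (* The unpaired frequency 0 contributes only for [k + m = 0], where [0 ^ 0 = 1] and the cosine is
     1. *)
  rewrite mul0r !add0r; case: (posnP (k + m)) => [km0|km].
    rewrite km0 !expr0 mul1r; move: km0 => /eqP; rewrite addn_eq0 => /andP[/eqP -> /eqP ->].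
    by rewrite mul0r addr0 cos0 expr1n.
  by rewrite !expr0n muln_eq0 /= gtn_eqF// mul0r expr0n.
rewrite /bump /= add1n add0r.
set y := j.+1%:R * a + k%:R * (pi / 2) + m%:R * (pi / 2).
have -> : j.+1%:R * a + (- (pi / 2) + k%:R * (pi / 2)) + m%:R * (pi / 2) = y - pi / 2.
  by rewrite /y; ring.
rewrite cosBpihalf !exprMn -!exprM -mulrDr cos2Dsin2 mulr1 mulnC.
by [].
Qed.

(** Within a pair the two products are opposite, by the quarter turn between sine and cosine. The
    function and its derivative are thus exactly uncorrelated at every point. *)
Lemma gco_cross a : \sum_i gco a 0 i * gco a 1 i = 0.
Proof.
rewrite (@sum_pairs _ (fun=> 0)) ?sumr_const ?mul0rn//.
  have -> : gco a 1 (inl ord0) = 0 by rewrite /gco /= addn1 exprS !mul0r.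
  by rewrite mulr0.
move=> j; rewrite /gco /phase /= /bump /= add1n add0r.
set y := j.+1%:R * a + k%:R * (pi / 2).
have -> : j.+1%:R * a + (- (pi / 2) + k%:R * (pi / 2)) = y - pi / 2.
  by rewrite /y; ring.
rewrite mul0r !addr0 mul1r subrK cosDpihalf cosBpihalf; ring.
Qed.

Hypothesis n0 : (0 < n)%N.

(* [sg ^ 2] is the variance of the derivative of order [k], [n ^ m * sg] is the
   scale of its derivative of order [m], and [la ^ 2] is the variance of the next
   derivative after rescaling. *)
Definition sg : R := Num.sqrt (psum R n (2 * k)).
Definition yco a m i : R := gco a m i / (n%:R ^+ m * sg).
Definition la : R := Num.sqrt (psum R n (2 * k + 2)) / (n%:R * sg).

Let nr0 : 0 < n%:R :> R. Proof. by rewrite ltr0n. Qed.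

Lemma sg_gt0 : 0 < sg. Proof. by rewrite sqrtr_gt0 psum_gt0. Qed.
Lemma sg_sqr : sg ^+ 2 = psum R n (2 * k). Proof. by rewrite sqr_sqrtr// psum_ge0. Qed.

Lemma yco_sqr a m : \sum_i yco a m i ^+ 2 = psum R n (2 * (k + m)) / (n%:R ^+ (2 * m) * psum R n (2 * k)).
Proof.
rewrite -(gco_sqr a) mulr_suml; apply: eq_bigr => i _.
by rewrite /yco expr_div_n [(_ * sg) ^+ 2]exprMn sg_sqr -exprM mulnC.
Qed.

Lemma yco_sqr0 a : \sum_i yco a 0 i ^+ 2 = 1.
Proof. by rewrite yco_sqr addn0 expr0 mul1r divff// gt_eqF// psum_gt0. Qed.

Lemma yco_sqr_le a m : \sum_i yco a m i ^+ 2 <= 1.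
Proof.
rewrite yco_sqr ler_pdivrMr ?mulr_gt0 ?exprn_gt0 ?psum_gt0// mul1r mulnDr.
exact: psum_le.
Qed.

Lemma la_sqr : la ^+ 2 = psum R n (2 * k + 2) / (n%:R ^+ 2 * psum R n (2 * k)).
Proof. by rewrite /la expr_div_n [(_ * sg) ^+ 2]exprMn sg_sqr sqr_sqrtr// psum_ge0. Qed.

Lemma la_gt0 : 0 < la.
Proof. by rewrite divr_gt0 ?sqrtr_gt0 ?psum_gt0// mulr_gt0// sg_gt0. Qed.

Lemma yco_sqr1 a : \sum_i yco a 1 i ^+ 2 = la ^+ 2.
Proof. by rewrite yco_sqr la_sqr mulnDr. Qed.

Lemma yco_cross a : \sum_i yco a 0 i * yco a 1 i = 0.
Proof.
rewrite (eq_bigr (fun i => (gco a 0 i * gco a 1 i) * ((n%:R ^+ 0 * sg)^-1 * (n%:R ^+ 1 * sg)^-1))).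
  by rewrite -mulr_suml gco_cross mul0r.
by move=> i _; rewrite /yco mulrACA.
Qed.

Lemma la_le1 : la <= 1.
Proof.
rewrite -(@ler_pXn2r _ 2) ?nnegrE ?(ltW la_gt0)// expr1n -(yco_sqr1 0).
exact: yco_sqr_le.
Qed.

(** No coefficient dominates, since [psum n (2 k)] is at least [n ^ (2 k + 1) / (2 k + 1)]. This is
    the smallness on which the normal approximation rests. *)
Lemma yco_le a m i : `|yco a m i| ^+ 2 <= (2 * k + 1)%:R / n%:R.
Proof.
rewrite real_normK ?num_real// /yco expr_div_n [(_ * sg) ^+ 2]exprMn sg_sqr.
rewrite ler_pdivrMr ?mulr_gt0 ?exprn_gt0 ?psum_gt0//.
have g : gco a m i ^+ 2 <= (n%:R ^+ (k + m)) ^+ 2.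
  rewrite /gco -(@real_normK _ (_ * cos _)) ?num_real// lerXn2r ?nnegrE ?exprn_ge0//.
  rewrite normrM -[leRHS]mulr1 ler_pM ?norm_cos_le1//.
  by rewrite ger0_norm ?exprn_ge0// lerXn2r ?nnegrE// ler_nat freq_le.
apply: le_trans g _.
have /andP[h _] := psum_bounds R n (2 * k).
rewrite -addn1 in h.
have -> : (2 * k + 1)%:R / n%:R * ((n%:R ^+ m) ^+ 2 * psum R n (2 * k)) =
   ((2 * k + 1)%:R * psum R n (2 * k)) * ((n%:R ^+ m) ^+ 2 / n%:R) by ring.
apply: le_trans (ler_wpM2r _ h); last by rewrite divr_ge0 ?exprn_ge0.
have -> : n%:R ^+ (2 * k + 1) * ((n%:R ^+ m) ^+ 2 / n%:R) = (n%:R ^+ (k + m)) ^+ 2 :> R.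
  by rewrite addn1 exprS exprD exprMn mulnC exprM; field; rewrite gt_eqF.
by [].
Qed.

Let q : R := (2 * k + 1)%:R / (2 * k + 3)%:R.

Lemma la_sqr_near : `|la ^+ 2 - q| <= (2 * k + 1)%:R / n%:R.
Proof.
have /andP[a1 a2] := psum_bounds R n (2 * k).
have /andP[b1 b2] := psum_bounds R n (2 * k + 2).
rewrite -[(2 * k).+1]addn1 in a1 a2; rewrite -addnS in b1 b2.
rewrite la_sqr /q; set A := psum R n (2 * k) in a1 a2 *; set B := psum R n (2 * k + 2) in b1 b2 *.
have A0 : 0 < A by exact: psum_gt0.
have k1 : 1 <= (2 * k + 1)%:R :> R by rewrite ler1n addn1.
have k3 : 0 < (2 * k + 3)%:R :> R by rewrite ltr0n addn3.
set u : R := (2 * k + 1)%:R in a1 a2 k1 *; set v : R := (2 * k + 3)%:R in b1 b2 k3 *.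
have uv : u <= v by rewrite ler_nat leq_add2l.
set x : R := n%:R in a1 a2 b1 b2 *.
have x0 : 0 < x by [].
set y : R := x ^+ (2 * k).
have E1 : x ^+ (2 * k + 1) = y * x by rewrite exprD expr1.
have E3 : x ^+ (2 * k + 3) = y * x ^+ 3 by rewrite exprD.
have E2 : x ^+ (2 * k + 2) = y * x ^+ 2 by rewrite exprD.
rewrite E1 -/y in a1 a2; rewrite E3 E2 in b1 b2.
have y0 : 0 < y by rewrite exprn_gt0.
have -> : B / (x ^+ 2 * A) - u / v = (v * B - u * A * x ^+ 2) / (v * (x ^+ 2 * A)).
  by field; rewrite !gt_eqF.
have den : 0 < v * (x ^+ 2 * A) by rewrite !mulr_gt0// exprn_gt0.
rewrite normrM [`|_^-1|]gtr0_norm ?invr_gt0// ler_pdivrMr//.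
have x2 : 0 < x ^+ 2 by rewrite exprn_gt0.
have xA1 : x ^+ 2 * (y * x) <= x ^+ 2 * (u * A) by rewrite ler_pM2l.
have xA2 : x ^+ 2 * (u * A) <= x ^+ 2 * (y * x + u * y) by rewrite ler_pM2l.
have R1 : u / x * (v * (x ^+ 2 * A)) = v * (x * (u * A)).
  by field; rewrite gt_eqF.
rewrite R1.
have R2 : x * (y * x) <= x * (u * A) by rewrite ler_pM2l.
have R3 : v * (x * (y * x)) <= v * (x * (u * A)) by rewrite ler_pM2l.
have R4 : u * (x ^+ 2 * y) <= v * (x ^+ 2 * y) by rewrite ler_wpM2r// mulr_ge0// ltW.
have C1 : x ^+ 2 * (y * x) = y * x ^+ 3 by ring.
have C2 : x ^+ 2 * (y * x + u * y) = y * x ^+ 3 + u * (x ^+ 2 * y) by ring.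
have C3 : v * (x * (y * x)) = v * (x ^+ 2 * y) by ring.
have C4 : v * (y * x ^+ 2) = v * (x ^+ 2 * y) by ring.
have C5 : u * A * x ^+ 2 = x ^+ 2 * (u * A) by ring.
rewrite C1 in xA1; rewrite C2 in xA2; rewrite C3 in R3; rewrite C4 in b2; rewrite C5.
rewrite ler_norml; clear -b1 b2 xA1 xA2 R3 R4; apply/andP; split; lra.
Qed.

(** The bound on the squares is divided by [la + sqrt q], which is at least [1/3] because [q >= 1/3]
    for every [k]. *)
Lemma la_near : `|la - Num.sqrt q| <= 3 * ((2 * k + 1)%:R / n%:R).
Proof.
have k3 : 0 < (2 * k + 3)%:R :> R by rewrite ltr0n addn3.
have q0 : 1/3 <= q by rewrite /q ler_pdivlMr// (natrD _ (2 * k) 1) (natrD _ (2 * k) 3) natrM; have := ler0n R k; lra.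
have q1 : q <= 1 by rewrite /q ler_pdivrMr// mul1r ler_nat leq_add2l.
have sq0 : 0 <= Num.sqrt q by rewrite sqrtr_ge0.
have sq2 : Num.sqrt q ^+ 2 = q by rewrite sqr_sqrtr//; lra.
have sq1 : Num.sqrt q <= 1 by rewrite -(@ler_pXn2r _ 2) ?nnegrE// sq2 expr1n.
have sq3 : 1/3 <= Num.sqrt q.
  have : Num.sqrt q * Num.sqrt q <= 1 * Num.sqrt q by rewrite ler_wpM2r.
  by rewrite -expr2 sq2; lra.
have H := la_sqr_near; have l0 := la_gt0.
have E : la ^+ 2 - q = (la - Num.sqrt q) * (la + Num.sqrt q) by rewrite -{1}sq2; ring.
rewrite E normrM in H.
have : `|la - Num.sqrt q| * (1/3) <= `|la - Num.sqrt q| * `|la + Num.sqrt q|.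
  by rewrite ler_wpM2l// ger0_norm; lra.
lra.
Qed.

End Coefficients.

Lemma expRN_cube (R : realType) (y : R) : 0 < y -> expR (- y) <= 27 / y ^+ 3.
Proof.
move=> y0; rewrite expRN -[leLHS]div1r ler_pdivrMr ?expR_gt0// mulrAC ler_pdivlMr ?exprn_gt0// mul1r.
have -> : expR y = expR (y / 3) ^+ 3 by rewrite -expRM_natl; congr expR; field.
have -> : y ^+ 3 = 27 * (y / 3) ^+ 3 by field.
rewrite ler_pM2l// lerXn2r ?nnegrE ?expR_ge0//; first by rewrite divr_ge0// ltW.
by have := @expR_ge1Dx R (y / 3); lra.
Qed.

(** The constant is [5090 = 8 + 2 * 1266 + 16 + 2 * 1266 + 2]. A scale [D] above the whole
    coefficient absorbs it into one power of [D]. *)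
Lemma rect_err_sum (R : realFieldType) (A B G K F C : R) : K <= 1266 * G ->
  F <= 288 * C * G -> B <= A -> G <= A -> C * G <= C * A ->
  2 * (4 * B + K + 8 * G) + F + 2 * K + 2 * G <= (5090 + 288 * C) * A.
Proof. by move=> *; lra. Qed.

(** * Normal approximation for a function and its derivative at a point *)

Section PointRect.
Context d (T : measurableType d) (R : realType) (P : probability T R).
Variables (n k : nat) (X : 'I_n.+1 + 'I_n -> {RV P >-> R}) (p C a : R) (D : nat).
Hypotheses (iX : mutually_independent P X) (p23 : 2 < p <= 3) (C1 : 1 <= C).
Hypothesis sX : forall i, std_moments P p C (X i).
Hypotheses (n0 : (0 < n)%N).

Definition Yv (m : nat) (w : T) : R := \sum_i yco k a m i * X i w.
(** The sign [e], which is 1 or -1, reflects the pair, so that the half of the double wedge with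
    negative derivative also becomes a wedge with [Ve >= 0]. *)
Definition Ue (e : R) w := e * Yv 0 w.
Definition Ve (e : R) w := e * (Yv 1 w / la R n k).

Local Notation l := (la R n k).

Lemma measurable_Yv m : measurable_fun setT (Yv m).
Proof. exact: meas_lin. Qed.

Lemma measurable_Ue e : measurable_fun setT (Ue e).
Proof. by apply: measurable_funM => //; exact: measurable_Yv. Qed.

Lemma measurable_Ve e : measurable_fun setT (Ve e).
Proof.
apply: measurable_funM => //; apply: measurable_funM => //; exact: measurable_Yv.
Qed.

Let p23' : 2 <= p <= 3. Proof. by case/andP: p23 => /ltW -> ->. Qed.

Lemma Pr_Yv_ge m t : 0 < t -> Pr P [set w | t <= `|Yv m w|] <= (t ^+ 2)^-1.
Proof.
move=> t0; rewrite -[leRHS]mul1r.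
exact: (Pr_lin_ge iX sX t0 (yco_sqr_le k n0 a m)).
Qed.

Let ucoef (e u v : R) (i : 'I_n.+1 + 'I_n) := e * (u * yco k a 0 i + v * (yco k a 1 i / l)).

Let lin_comb e u v w : u * Ue e w + v * Ve e w = \sum_i ucoef e u v i * X i w.
Proof.
rewrite /Ue /Ve /Yv !mulr_sumr mulr_suml !mulr_sumr -big_split /=; apply: eq_bigr => i _.
by rewrite /ucoef; ring.
Qed.

Let ucoef_sqr e u v : e ^+ 2 = 1 -> \sum_i ucoef e u v i ^+ 2 = u ^+ 2 + v ^+ 2.
Proof.
move=> e2; have l0 := la_gt0 R k n0.
have -> : \sum_i ucoef e u v i ^+ 2 = u ^+ 2 * (\sum_(i : 'I_n.+1 + 'I_n) yco k a 0 i ^+ 2) +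
    (2 * u * v / l) * (\sum_(i : 'I_n.+1 + 'I_n) yco k a 0 i * yco k a 1 i) +
    (v ^+ 2 / l ^+ 2) * (\sum_(i : 'I_n.+1 + 'I_n) yco k a 1 i ^+ 2).
  rewrite !mulr_sumr -!big_split /=; apply: eq_bigr => i _.
  by rewrite /ucoef exprMn e2; field; rewrite gt_eqF.
rewrite yco_sqr0// yco_cross yco_sqr1//; field; rewrite gt_eqF//.
Qed.

Hypothesis l12 : 1/2 <= l.

Definition Mn : R := Num.sqrt ((2 * k + 1)%:R / n%:R).

Let yco_Mn m (i : 'I_n.+1 + 'I_n) : `|yco k a m i| <= Mn.
Proof.
rewrite -(@ler_pXn2r _ 2) ?nnegrE ?sqrtr_ge0// sqr_sqrtr ?divr_ge0//.
exact: yco_le.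
Qed.

Let ucoef_le e u v Om i : e ^+ 2 = 1 -> `|u| <= Om -> `|v| <= Om ->
  `|ucoef e u v i| <= 3 * Om * Mn.
Proof.
move=> e2 hu hv; have e1 : `|e| = 1 by apply/eqP; rewrite -sqrp_eq1 ?normr_ge0// real_normK ?num_real// e2.
have M0 : 0 <= Mn by rewrite sqrtr_ge0.
have Om0 : 0 <= Om by apply: le_trans hu.
rewrite normrM e1 mul1r (le_trans (ler_normD _ _))//.
rewrite [X in X + _]normrM [X in _ + X]normrM [`|_ / l|]normrM normfV.
have h1 : `|u| * `|yco k a 0 i| <= Om * Mn by rewrite ler_pM.
have h2 : `|v| * (`|yco k a 1 i| / `|l|) <= Om * (2 * Mn).
  rewrite ler_pM ?mulr_ge0 ?invr_ge0//.
  have l0 : 0 < l by have := l12; lra.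
  rewrite (gtr0_norm l0) ler_pdivrMr//.
  have : Mn * 1 <= Mn * (2 * l) by rewrite ler_wpM2l//; have := l12; lra.
  by have := yco_Mn 1 i; lra.
lra.
Qed.

(** The sum of [|c| ^ p] is at most the largest [|c| ^ (p - 2)] times the sum of squares
    [u ^ 2 + v ^ 2]. The largest coefficient is at most [3 * Om * Mn], with [1 + 2] for the two
    variables since [1 / l <= 2]; it is of order [n ^ (-1/2)]. *)
Lemma char_bound e Om u v th : e ^+ 2 = 1 -> `|u| <= Om -> `|v| <= Om -> 3 * Om * Mn <= 1 ->
  `|Ex P (fun w => cos (u * Ue e w + v * Ve e w + th)) -
    expR (- ((u ^+ 2 + v ^+ 2) / 2)) * cos th| <= 4 * C * ((3 * Om * Mn) `^ (p - 2) * (2 * Om ^+ 2)).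
Proof.
move=> e2 hu hv B1; have Om0 : 0 <= Om by apply: le_trans hu.
have B0 : 0 <= 3 * Om * Mn by rewrite !mulr_ge0// sqrtr_ge0.
have c1 i : `|ucoef e u v i| <= 1 by apply: le_trans B1; exact: ucoef_le.
have H := Ex_cos_lin_approx iX p23' C1 sX th c1 [set: 'I_n.+1 + 'I_n]%SET.
have E1 (h : 'I_n.+1 + 'I_n -> R) : \sum_(i in [set: 'I_n.+1 + 'I_n]%SET) h i = \sum_i h i.
  by apply: eq_bigl => i; rewrite inE.
rewrite !E1 ucoef_sqr// in H.
have -> : Ex P (fun w => cos (u * Ue e w + v * Ve e w + th)) =
    Ex P (fun w => cos (1 * (\sum_(i in [set: 'I_n.+1 + 'I_n]%SET) ucoef e u v i * X i w) + th)).
  by apply: eq_Ex => w; rewrite E1 mul1r lin_comb.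
apply: le_trans H _; apply: ler_wpM2l; first by rewrite mulr_ge0//; have := C1; lra.
have -> : 2 * Om ^+ 2 = Om ^+ 2 + Om ^+ 2 by ring.
apply: (@le_trans _ _ (\sum_i (3 * Om * Mn) `^ (p - 2) * ucoef e u v i ^+ 2)).
  apply: ler_sum => i _.
  have hB := ucoef_le i e2 hu hv; set c := ucoef e u v i in hB *.
  have [->|c0] := eqVneq c 0.
    by rewrite normr0 powR0 ?expr0n ?mulr0//; case/andP: p23 => h _; apply: lt0r_neq0; lra.
  have nc0 : `|c| != 0 by rewrite normr_eq0.
  have -> : `|c| `^ p = `|c| `^ ((p - 2) + 2%:R) by congr (_ `^ _); ring.
  rewrite powRD; last by rewrite nc0 implybT.
  rewrite powR_mulrn// real_normK ?num_real// ler_wpM2r ?sqr_ge0//.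
  by rewrite ge0_ler_powR ?nnegrE ?subr_ge0//; case/andP: p23' .
rewrite -mulr_sumr ucoef_sqr// ler_wpM2l ?powR_ge0//.
by apply: lerD; rewrite -[leLHS]real_normK ?num_real// lerXn2r ?nnegrE.
Qed.

Hypotheses (D1 : 5090 + 288 * C <= D%:R).
Hypothesis B_le1 : 3 * (2 * D%:R ^+ 74) * Mn <= 1.
Hypothesis B_small : (3 * (2 * D%:R ^+ 74) * Mn) `^ (p - 2) <= D%:R^-1 ^+ 340.

Let th : R := D%:R^-1.
Let Dge1 : 1 <= D%:R :> R. Proof. by have := D1; have := C1; lra. Qed.
Let D0 : 0 < D%:R :> R. Proof. by have := Dge1; lra. Qed.
Let th0 : 0 < th. Proof. by rewrite invr_gt0. Qed.
Let th1 : th <= 1. Proof. by rewrite invf_le1. Qed.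
Let Dth : D%:R * th = 1. Proof. by rewrite divff// gt_eqF. Qed.
Let th_le i j : (j <= i)%N -> th ^+ i <= th ^+ j.
Proof. by move=> ij; rewrite -(subnK ij) exprD ler_piMl ?exprn_ge0 ?(ltW th0)// exprn_ile1// ltW. Qed.
Let Dth_sub i j : D%:R ^+ i * th ^+ (i + j) = th ^+ j.
Proof. by rewrite exprD mulrA -exprMn Dth expr1n mul1r. Qed.

(** The scales are: window [r = D ^ 6], edge width [s = D ^ -17], degree [m = 2 D ^ 80]. Then
    [r s = D ^ -11] and [r ^ -2 = D ^ -12]; [m s ^ 2] is of order [D ^ 46], which makes the kernel
    error negligible; frequencies reach [m / r = 2 D ^ 74]; and the characteristic functions
    contribute, up to constants, [D ^ 160 * D ^ 148 * D ^ -340 = D ^ -32]. *)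
Let mm := (2 * D ^ 80)%N.

Let kernel_err : mm.+1%:R * expR (- (mm%:R * ((th ^+ 17) ^+ 2 / 5))) <= 1266 * th ^+ 12.
Proof.
have mmE : mm%:R = 2 * D%:R ^+ 80 :> R by rewrite natrM natrX.
have mE : mm%:R * ((th ^+ 17) ^+ 2 / 5) = 2/5 * D%:R ^+ 46.
  have DT : D%:R ^+ 34 * th ^+ 34 = 1 by rewrite -exprMn Dth expr1n.
  rewrite mmE -exprM (exprD _ 34 46).
  have -> : 2 * (D%:R ^+ 34 * D%:R ^+ 46) * (th ^+ (17 * 2) / 5) =
    2/5 * D%:R ^+ 46 * (D%:R ^+ 34 * th ^+ 34) by rewrite (_ : (17 * 2)%N = 34)//; ring.
  by rewrite DT mulr1.
rewrite mE; have y0 : 0 < 2/5 * D%:R ^+ 46 :> R by rewrite mulr_gt0 ?exprn_gt0.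
have D80 : 1 <= D%:R ^+ 80 :> R by rewrite exprn_ege1.
apply: (@le_trans _ _ (3 * D%:R ^+ 80 * (27 / (2/5 * D%:R ^+ 46) ^+ 3))).
  by rewrite ler_pM ?expR_ge0 ?expRN_cube// -natr1 mmE; lra.
have -> : 3 * D%:R ^+ 80 * (27 / (2/5 * D%:R ^+ 46) ^+ 3) = (81 * 125 / 8) * th ^+ 58.
  have -> : (2/5 * D%:R ^+ 46) ^+ 3 = 8/125 * (D%:R ^+ 80 * D%:R ^+ 58) :> R.
    by rewrite exprMn -exprM -exprD; field.
  by rewrite /th exprVn; field; rewrite gt_eqF.
have t12 : 0 <= th ^+ 12 by rewrite exprn_ge0// ltW.
have := th_le (isT : (12 <= 58)%N); lra.
Qed.

Lemma rect_est e (x y x' y' : R) : e ^+ 2 = 1 ->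
  - D%:R ^+ 6 <= x -> y <= D%:R ^+ 6 -> - D%:R ^+ 6 <= x' -> y' <= D%:R ^+ 6 ->
  `|Pr P (rect (Ue e) (Ve e) x y x' y') - gm x y * gm x' y'| <= th ^+ 9.
Proof.
move=> e2 hx hy hx' hy'.
have r1 : 1 <= D%:R ^+ 6 :> R by rewrite exprn_ege1.
have s0 : 0 <= th ^+ 17 by rewrite exprn_ge0// ltW.
have D2 : 2 <= D%:R :> R by have := D1; have := C1; lra.
have th12 : th <= 1/2 by rewrite /th -div1r ler_pdivrMr//; lra.
have s1 : th ^+ 17 <= 1/2 by have := th_le (isT : (1 <= 17)%N); rewrite expr1; lra.
have OmE : mm%:R / D%:R ^+ 6 = 2 * D%:R ^+ 74 :> R.
  by rewrite natrM natrX (exprD _ 74 6); field; rewrite gt_eqF.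
pose eta := 4 * C * ((3 * (2 * D%:R ^+ 74) * Mn) `^ (p - 2) * (2 * (2 * D%:R ^+ 74) ^+ 2)).
have ch (u v t : R) : `|u| <= mm%:R / D%:R ^+ 6 -> `|v| <= mm%:R / D%:R ^+ 6 ->
  `|Ex P (fun w => cos (u * Ue e w + v * Ve e w + t)) -
    expR (- ((u ^+ 2 + v ^+ 2) / 2)) * cos t| <= eta.
  by rewrite OmE => hu hv; exact: char_bound.
have ne : `|e| = 1 by apply/eqP; rewrite -sqrp_eq1 ?normr_ge0// real_normK ?num_real// e2.
have r0 : 0 < D%:R ^+ 6 :> R by rewrite exprn_gt0.
have tU : Pr P [set w | D%:R ^+ 6 <= `|Ue e w|] <= ((D%:R ^+ 6) ^+ 2)^-1.
  by under eq_fun do rewrite /Ue normrM ne mul1r; exact: Pr_Yv_ge.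
have tV : Pr P [set w | D%:R ^+ 6 <= `|Ve e w|] <= ((D%:R ^+ 6) ^+ 2)^-1.
  have E w : Ve e w = \sum_i ucoef e 0 1 i * X i w.
    by rewrite -lin_comb mul0r add0r mul1r.
  under eq_fun do rewrite E; rewrite -[leRHS]mul1r; apply: (Pr_lin_ge iX sX r0).
  by rewrite ucoef_sqr// expr0n expr1n add0r.
have := @rect_clt _ _ _ P (Ue e) (Ve e) mm (D%:R ^+ 6) (th ^+ 17) eta ((D%:R ^+ 6) ^+ 2)^-1
  (measurable_Ue e) (measurable_Ve e) r1 s0 s1 ch tU tV x y x' y' hx hy hx' hy'.
move=> /le_trans; apply; rewrite /rect_err.
have kerr := kernel_err; set K := mm.+1%:R * expR _ in kerr *.
have rs : D%:R ^+ 6 * th ^+ 17 = th ^+ 11 by exact: (Dth_sub 6 11).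
have r2 : ((D%:R ^+ 6) ^+ 2)^-1 = th ^+ 12 by rewrite -exprM -exprVn.
rewrite rs r2.
have m1 : mm.+1%:R ^+ 2 <= 9 * D%:R ^+ 160 :> R.
  have D80 : 1 <= D%:R ^+ 80 :> R by rewrite exprn_ege1.
  have -> : 9 * D%:R ^+ 160 = (3 * D%:R ^+ 80) ^+ 2 :> R by rewrite exprMn -exprM; ring.
  rewrite lerXn2r ?nnegrE ?mulr_ge0 ?exprn_ge0 ?(ltW D0)// -natr1 natrM natrX; lra.
have eta1 : eta <= 32 * C * (th ^+ 340 * D%:R ^+ 148).
  rewrite /eta (_ : 32 * C * (th ^+ 340 * D%:R ^+ 148) = 4 * C * (th ^+ 340 * (2 * (2 * D%:R ^+ 74) ^+ 2))).
    rewrite ler_wpM2l; [by []|by rewrite mulr_ge0//; have := C1; lra|].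
    by rewrite ler_wpM2r// mulr_ge0// sqr_ge0.
  by rewrite exprMn -exprM; ring.
have eta2 : mm.+1%:R ^+ 2 * eta <= 288 * C * th ^+ 12.
  have c0 : 0 <= C by have := C1; lra.
  apply: (@le_trans _ _ (9 * D%:R ^+ 160 * (32 * C * (th ^+ 340 * D%:R ^+ 148)))).
    have eta0 : 0 <= eta by rewrite /eta !mulr_ge0 ?powR_ge0 ?sqr_ge0.
    by rewrite ler_pM ?sqr_ge0.
  have -> : 9 * D%:R ^+ 160 * (32 * C * (th ^+ 340 * D%:R ^+ 148)) =
      288 * C * (D%:R ^+ 308 * th ^+ (308 + 32)) by rewrite (exprD _ 160 148); ring.
  have c288 : 0 <= 288 * C by have := C1; lra.
  by rewrite (Dth_sub 308 32); exact: (ler_wpM2l c288 (th_le (isT : (12 <= 32)%N))).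
have t11 := th_le (isT : (10 <= 11)%N); have t12 := th_le (isT : (10 <= 12)%N).
have t10 : 0 <= th ^+ 10 by rewrite exprn_ge0// ltW.
have Ct : C * th ^+ 12 <= C * th ^+ 10 by rewrite ler_wpM2l//; have := C1; lra.
apply: (@le_trans _ _ ((5090 + 288 * C) * th ^+ 10)).
  exact: rect_err_sum kerr eta2 t11 t12 Ct.
apply: (@le_trans _ _ (D%:R * th ^+ 10)); first by rewrite ler_wpM2r.
by have := Dth_sub 1 9; rewrite expr1 => ->.
Qed.

End PointRect.

(** * Excluding many zeros in a short interval *)

Section LacunaryParams.
Variables (n A0 : nat).
Hypotheses (n0 : (0 < n)%N) (A00 : (0 < A0)%N).

(* The frequencies [jl l], for [l < Kl], decrease along an arithmetic progression
   inside [[n/2, n]]; since [ml] is large, their powers of exponent [ml] are lacunary.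
   The [el] roots left after [ml] differentiations make the derivative of order
   [ml] small. *)
Definition L1 := (trunc_log 2 n).+1.
Definition Kl := (A0 * L1)%N.
Definition wl := (4 * L1 + 4)%N.
Definition gl := (n %/ (2 * Kl))%N.
Definition ml := (4 * Kl * wl)%N.
Definition el (k : nat) := (k + ml + 6 + 4 * L1)%N.
Definition jl (l : nat) := (n - l * gl)%N.

Lemma Kl_gt0 : (0 < Kl)%N. Proof. by rewrite muln_gt0 A00. Qed.

Lemma n_lt_L1 : (n < 2 ^ L1)%N. Proof. exact: trunc_log_ltn. Qed.

Hypothesis Kn : (2 * Kl <= n)%N.

Lemma gl_bounds : (0 < gl)%N /\ (n <= 4 * Kl * gl)%N /\ (2 * Kl * gl <= n)%N.
Proof.
have K0 := Kl_gt0; have K20 : (0 < 2 * Kl)%N by rewrite muln_gt0.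
have g0 : (0 < gl)%N by rewrite divn_gt0.
split => //; split; last by rewrite mulnC leq_divM.
have := ltn_ceil n K20; rewrite -/gl => h.
have : (2 * Kl <= 2 * Kl * gl)%N by rewrite leq_pmulr.
by move: h; rewrite mulSn; lia.
Qed.

Lemma jl_bounds l : (l < Kl)%N -> (n <= 2 * jl l)%N /\ (0 < jl l <= n)%N.
Proof.
have [g0 [_ g2]] := gl_bounds; move=> lK.
have : (l * gl <= Kl * gl)%N by rewrite leq_pmul2r// ltnW.
by rewrite /jl; lia.
Qed.

Lemma jlS l : (l.+1 < Kl)%N -> jl l = (jl l.+1 + gl)%N.
Proof.
have [g0 [_ g2]] := gl_bounds; move=> lK.
have : (l.+1 * gl <= Kl * gl)%N by rewrite leq_pmul2r// ltnW.
by rewrite /jl mulSn; lia.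
Qed.

Lemma jl_inj l l' : (l < Kl)%N -> (l' < Kl)%N -> jl l = jl l' -> l = l'.
Proof.
have [g0 [_ g2]] := gl_bounds; move=> lK l'K.
have h1 : (l * gl <= Kl * gl)%N by rewrite leq_pmul2r// ltnW.
have h2 : (l' * gl <= Kl * gl)%N by rewrite leq_pmul2r// ltnW.
move=> E; have : (l * gl = l' * gl)%N by move: E; rewrite /jl; lia.
by move/eqP; rewrite eqn_pmul2r// => /eqP.
Qed.

Lemma bernoulli_ge (R : realType) (x : R) (N : nat) : 0 <= x -> 1 + N%:R * x <= (1 + x) ^+ N.
Proof.
move=> x0; elim: N => [|N IH]; first by rewrite mul0r addr0 expr0.
rewrite exprS -natr1.
have : (1 + x) * (1 + N%:R * x) <= (1 + x) * (1 + x) ^+ N by rewrite ler_wpM2l// addr_ge0.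
have : 0 <= N%:R * x * x by rewrite !mulr_ge0.
lra.
Qed.

(** Consecutive frequencies have ratio at least [1 + 1 / (4 Kl)]. Its power [4 Kl] is at least 2 by
    Bernoulli's inequality, so its power [ml] is at least [2 ^ wl], and [wl = 4 L1 + 4] makes this
    at least [16 n ^ 4]. *)
Lemma jl_ratio (R : realType) k l : (l.+1 < Kl)%N ->
  16 * n%:R ^+ 4 * (jl l.+1)%:R ^+ (k + ml) <= (jl l)%:R ^+ (k + ml) :> R.
Proof.
move=> lK; have [g0 [g1 _]] := gl_bounds; have [_ /andP[j0 jn]] := jl_bounds lK.
have K0 := Kl_gt0; rewrite (jlS lK) natrD.
have j0' : 0 < (jl l.+1)%:R :> R by rewrite ltr0n.
have K0' : 0 < (4 * Kl)%:R :> R by rewrite ltr0n muln_gt0.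
pose x : R := (4 * Kl)%:R^-1.
have x0 : 0 <= x by rewrite invr_ge0 ltW.
have jx : (jl l.+1)%:R * (1 + x) <= (jl l.+1)%:R + gl%:R.
  rewrite mulrDr mulr1 lerD2l /x ler_pdivrMr// -natrM ler_nat mulnC.
  exact: leq_trans jn g1.
have pw : 2 ^+ wl <= (1 + x) ^+ ml.
  rewrite /ml exprM lerXn2r ?nnegrE ?exprn_ge0 ?addr_ge0//.
  apply: le_trans (bernoulli_ge _ x0); rewrite /x divff ?gt_eqF//.
have n16 : 16 * n%:R ^+ 4 <= 2 ^+ wl :> R.
  have h : n%:R <= 2 ^+ L1 :> R by rewrite -natrX ler_nat ltnW// n_lt_L1.
  rewrite /wl exprD mulrC (_ : 2 ^+ 4 = 16 :> R); last by ring.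
  by rewrite ler_wpM2r// mulnC exprM lerXn2r ?nnegrE ?exprn_ge0.
apply: (@le_trans _ _ ((jl l.+1)%:R ^+ k * ((jl l.+1)%:R * (1 + x)) ^+ ml)).
  rewrite exprMn exprD mulrC -mulrA; apply: ler_wpM2l; first exact: exprn_ge0.
  by apply: ler_wpM2l; [exact: exprn_ge0|exact: le_trans pw].
rewrite exprD ler_pM ?exprn_ge0 ?mulr_ge0 ?addr_ge0//.
  by rewrite lerXn2r ?nnegrE ?addr_ge0// lerDl.
by rewrite lerXn2r ?nnegrE ?mulr_ge0 ?addr_ge0.
Qed.

End LacunaryParams.

(** * Probability of the exceptional event *)

Section BadEvent.
Context d (T : measurableType d) (R : realType) (P : probability T R).
Variables (n k : nat) (X : 'I_n.+1 + 'I_n -> {RV P >-> R}) (p C a q : R) (A0 : nat).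
Hypotheses (iX : mutually_independent P X) (p23 : 2 <= p <= 3) (C1 : 1 <= C).
Hypothesis sX : forall i, std_moments P p C (X i).
Hypotheses (q01 : 0 < q < 1) (qA0 : q ^+ A0 <= 16^-1) (A00 : (0 < A0)%N).
Hypothesis qX : forall i x, Pr P [set w | `|X i w - x| <= 1/2] <= q.
Hypotheses (n0 : (0 < n)%N) (Kn : (2 * Kl n A0 <= n)%N).

Local Notation m := (ml n A0).
Local Notation e := (el n A0 k).

Lemma cos_or_sin_large (y : R) : 1/2 <= `|cos y| \/ 1/2 <= `|sin y|.
Proof.
have [h|h] := leP (1/2) `|cos y|; first by left.
right; rewrite leNgt; apply/negP => h'.
have := cos2Dsin2 y; rewrite -(@real_normK _ (cos y)) ?num_real// -(@real_normK _ (sin y)) ?num_real//.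
have b (z : R) : 0 <= z -> z < 1/2 -> z ^+ 2 <= 1/4.
  move=> z0 z1; rewrite expr2; have : z * z <= 1/2 * (1/2) by rewrite ler_pM// ltW.
  lra.
have := b _ (normr_ge0 _) h; have := b _ (normr_ge0 _) h'; lra.
Qed.

(** At a given [a] one term of a frequency may vanish, but its partner is then large; one of the two
    keeps at least half of the full size. *)
Lemma gco_large (mm j : nat) : (0 < j <= n)%N ->
  exists i : 'I_n.+1 + 'I_n, freq i = j /\ j%:R ^+ (k + mm) / 2 <= `|gco k a mm i|.
Proof.
case: j => // j /andP[_ jn].
set y := j.+1%:R * a + k%:R * (pi / 2) + mm%:R * (pi / 2).
have big (c : R) : 1/2 <= `|c| -> j.+1%:R ^+ (k + mm) / 2 <= `|j.+1%:R ^+ (k + mm) * c|.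
  by move=> h; rewrite normrM (@ger0_norm _ (_ ^+ _)) ?exprn_ge0// ler_wpM2l ?exprn_ge0// -div1r.
case: (cos_or_sin_large y) => h.
  exists (inl (inord j.+1)); rewrite /gco /phase /= inordK ?ltnS// add0r.
  by split => //; exact: big.
exists (inr (Ordinal jn)); rewrite /gco /phase /=; split => //.
rewrite (_ : j.+1%:R * a + (- (pi / 2) + k%:R * (pi / 2)) + mm%:R * (pi / 2) = y - pi / 2); last by rewrite /y; ring.
by rewrite cosBpihalf; exact: big.
Qed.

(** The threshold is a lower bound for the one in [Pr_anticoncentration], a quarter of the last
    chosen coefficient, which itself is at least half of [(n / 2) ^ (k + m)]. *)
Definition badF : set T := [set w | `|\sum_i gco k a m i * X i w| <= (n%:R / 2) ^+ (k + m) / 8].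
Definition badX : set T := [set w | exists i, n%:R ^+ 3 < `|X i w|].

Lemma measurable_badF : measurable badF.
Proof. by apply: meas_le => //; apply: measurableT_comp => //; exact: meas_lin. Qed.

Lemma measurable_badX : measurable badX.
Proof.
have -> : badX = \bigcup_(i in [set: 'I_n.+1 + 'I_n]) [set w | n%:R ^+ 3 < `|X i w|].
  by apply/seteqP; split => w /=; [case=> i h; exists i|case=> i _ h; exists i].
apply: fin_bigcup_measurable; first exact: finite_finset.
by move=> i _; apply: meas_lt => //; apply: measurableT_comp.
Qed.

Let n1 : 1 <= n%:R :> R. Proof. by rewrite ler1n. Qed.
Let nr0 : 0 < n%:R :> R. Proof. by rewrite ltr0n. Qed.

Lemma Pr_badF : Pr P badF <= q ^+ Kl n A0 + (n%:R ^+ 6)^-1 / (1 - q).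
Proof.
have K0 := Kl_gt0 n A00.
have ex l : exists i : 'I_n.+1 + 'I_n, (l < Kl n A0)%N ->
    freq i = jl n A0 l /\ (jl n A0 l)%:R ^+ (k + m) / 2 <= `|gco k a m i|.
  have [lK|_] := ltnP l (Kl n A0); last by exists (inl ord0).
  have [_ jb] := jl_bounds n0 A00 Kn lK.
  by have [i hi] := gco_large m jb; exists i.
have [il ilP] := choice ex.
have n3 : 0 <= n%:R ^+ 3 :> R by rewrite exprn_ge0.
have q01' : 0 <= q < 1 by case/andP: q01 => /ltW -> ->.
have t0 : 0 <= (n%:R ^+ 6)^-1 :> R by rewrite invr_ge0 exprn_ge0.
have jpos l : (l < Kl n A0)%N -> 0 < (jl n A0 l)%:R ^+ (k + m) :> R.
  by move=> lK; have [_ /andP[j0 _]] := jl_bounds n0 A00 Kn lK; rewrite exprn_gt0// ltr0n.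
have gub i : `|gco k a m i| <= (freq i)%:R ^+ (k + m).
  by rewrite /gco normrM ger0_norm ?exprn_ge0// ler_piMr ?exprn_ge0// norm_cos_le1.
have tX i : Pr P [set w | n%:R ^+ 3 < `|X i w|] <= (n%:R ^+ 6)^-1.
  have b0 : 0 < n%:R ^+ 3 :> R by rewrite exprn_gt0.
  by have := Pr_coef_gt sX i b0; rewrite -exprM.
have H := @Pr_anticoncentration _ T R P _ X (gco k a m) il (Kl n A0) q (n%:R ^+ 3) (n%:R ^+ 6)^-1
  iX K0 _ n3 q01' t0 qX tX _ _.
have {H} : Pr P [set w | `|\sum_j gco k a m j * X j w| <= `|gco k a m (il (Kl n A0).-1)| / 4] <=
   q ^+ Kl n A0 + (n%:R ^+ 6)^-1 / (1 - q).
  apply: H.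
  - move=> l l' lK l'K E; apply: (jl_inj n0 A00 Kn lK l'K).
    by have [<- _] := ilP l lK; have [<- _] := ilP l' l'K; rewrite E.
  - move=> l lK; have [_ h] := ilP l lK; rewrite -normr_gt0; apply: lt_le_trans h.
    by rewrite divr_gt0// jpos.
  (* With [beta = n ^ 3], the factor [4 beta + 1] is at most [8 n ^ 4]. [jl_ratio] provides twice
     that, which makes up for the half lost in [gco_large]. *)
  - move=> l lK; have [f1 _] := ilP _ lK; have [_ h] := ilP _ (ltnW lK).
    apply: le_trans h; have := jl_ratio n0 A00 Kn R k lK; rewrite -f1 => hr.
    have g1 := gub (il l.+1); have f0 : 0 <= (freq (il l.+1))%:R ^+ (k + m) :> R by rewrite exprn_ge0.
    have n34 : 4 * n%:R ^+ 3 + 1 <= 8 * n%:R ^+ 4 :> R.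
      have h3 : 1 <= n%:R ^+ 3 :> R by rewrite exprn_ege1.
      have : n%:R ^+ 3 * 1 <= n%:R ^+ 3 * n%:R :> R by rewrite ler_wpM2l.
      by rewrite -exprSr; lra.
    apply: (@le_trans _ _ (8 * n%:R ^+ 4 * (freq (il l.+1))%:R ^+ (k + m))).
      by rewrite ler_pM ?addr_ge0 ?mulr_ge0.
    lra.
apply: le_trans; apply: Pr_mono; [exact: measurable_badF| |].
  by apply: meas_le => //; apply: measurableT_comp => //; exact: meas_lin.
move=> w /=; rewrite /badF /= => /le_trans; apply.
have Kp : ((Kl n A0).-1 < Kl n A0)%N by rewrite prednK.
have [_ h] := ilP _ Kp; have [h2 _] := jl_bounds n0 A00 Kn Kp.
have : (n%:R / 2) ^+ (k + m) <= (jl n A0 (Kl n A0).-1)%:R ^+ (k + m) :> R.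
  rewrite lerXn2r ?nnegrE ?divr_ge0// ler_pdivrMr// -natrM ler_nat mulnC//.
lra.
Qed.

Lemma Pr_badX : Pr P badX <= 3 * n%:R * (n%:R ^+ 6)^-1.
Proof.
have b0 : 0 < n%:R ^+ 3 :> R by rewrite exprn_gt0.
apply: (@le_trans _ _ (\sum_i Pr P [set w | n%:R ^+ 3 < `|X i w|])).
  apply: Pr_cover => //; first exact: measurable_badX.
  by move=> i; apply: meas_lt => //; apply: measurableT_comp.
apply: (@le_trans _ _ (\sum_(i : 'I_n.+1 + 'I_n) (n%:R ^+ 6)^-1)).
  by apply: ler_sum => i _; have := Pr_coef_gt sX i b0; rewrite -exprM.
rewrite sumr_const card_sum !card_ord -[leLHS]mulr_natl ler_wpM2r ?invr_ge0 ?exprn_ge0//.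
by rewrite natrD -natr1; have := n1; lra.
Qed.

Lemma Pr_bad : Pr P (badF `|` badX) <= (4 + (1 - q)^-1) * (n%:R ^+ 4)^-1.
Proof.
have mU : measurable (badF `|` badX).
  by apply: measurableU; [exact: measurable_badF|exact: measurable_badX].
have := @Pr_setU _ _ _ P _ _ _ mU measurable_badF measurable_badX (fun w => id).
have hF := Pr_badF; have hX := Pr_badX.
have q0 : 0 <= q by case/andP: q01 => /ltW.
have qi : 0 < (1 - q)^-1 by rewrite invr_gt0; case/andP: q01 => _; lra.
(* From [Kl = A0 * L1], [q ^ A0 <= 1/16] and [n < 2 ^ L1]. *)
have hq : q ^+ Kl n A0 <= (n%:R ^+ 4)^-1.
  rewrite /Kl exprM; apply: (@le_trans _ _ (16^-1 ^+ L1 n)).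
    by rewrite lerXn2r ?nnegrE ?exprn_ge0.
  rewrite exprVn lef_pV2 ?posrE ?exprn_gt0//.
  rewrite (_ : 16 = 2 ^+ 4 :> R); last by ring.
  rewrite -exprM mulnC exprM lerXn2r ?nnegrE ?exprn_ge0// -natrX ler_nat.
  exact: ltnW (n_lt_L1 n).
have h64 : (n%:R ^+ 6)^-1 <= (n%:R ^+ 4)^-1 :> R.
  by rewrite lef_pV2 ?posrE ?exprn_gt0// ler_weXn2l.
have h54 : 3 * n%:R * (n%:R ^+ 6)^-1 <= 3 * (n%:R ^+ 4)^-1 :> R.
  rewrite -mulrA ler_pM2l//.
  have -> : n%:R * (n%:R ^+ 6)^-1 = (n%:R ^+ 5)^-1 :> R by field; rewrite gt_eqF.
  by rewrite lef_pV2 ?posrE ?exprn_gt0// ler_weXn2l.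
have : (n%:R ^+ 6)^-1 / (1 - q) <= (1 - q)^-1 * (n%:R ^+ 4)^-1 by rewrite mulrC ler_wpM2l// ltW.
lra.
Qed.

(** With that many zeros, [e] consecutive orders starting at [m] all vanish somewhere, so the
    derivative of order [m] at [a] is at most [(h / n) ^ e] times a bound of the order [m + e]. The
    powers [n ^ e] cancel and [h ^ e] remains. *)
Lemma not_bad_few_zeros (h : R) w : 0 <= h -> h <= 1/2 -> ~ (badF `|` badX) w ->
  ~ zeros_ge (tsum (@freq n) (@phase R n k) (fun i => X i w * (freq i)%:R ^+ k)) a (a + h / n%:R) (m + e).
Proof.
move=> h0 h12 /not_orP[nF nX] zg.
set F := tsum _ _ _ in zg.
have dF : deriv_family F by exact: tsum_deriv.
have ab : a <= a + h / n%:R by rewrite lerDl divr_ge0.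
have cB i : `|X i w * (freq i)%:R ^+ k| <= n%:R ^+ 3 * n%:R ^+ k.
  rewrite normrM ler_pM//.
    by rewrite leNgt; apply/negP => hh; apply: nX; exists i.
  by rewrite ger0_norm ?exprn_ge0// lerXn2r ?nnegrE// ler_nat freq_le.
have FB z : a <= z <= a + h / n%:R ->
    `|F (m + e)%N z| <= #|{: 'I_n.+1 + 'I_n}|%:R * (n%:R ^+ 3 * n%:R ^+ k) * n%:R ^+ (m + e).
  by move=> _; apply: tsum_le => // i; exact: freq_le.
have zz i : (i < e)%N -> exists2 z, a <= z <= a + h / n%:R & F (m + i)%N z = 0.
  by move=> ie; apply: (zeros_ge_deriv_root dF zg); rewrite ltn_add2l.
have aa : a <= a <= a + h / n%:R by rewrite lexx.
have := deriv_family_zeros_bound (deriv_family_shift m dF) ab zz FB (leq0n e) aa.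
rewrite addn0 subn0 addrC addKr card_sum !card_ord.
have -> : F m a = \sum_i gco k a m i * X i w by exact: tsum_gco.
apply/negP; rewrite -ltNge; apply: lt_le_trans (ltW _); last first.
  by rewrite ltNge; apply/negP; exact: nF.
have E : (h / n%:R) ^+ e * ((n.+1 + n)%:R * (n%:R ^+ 3 * n%:R ^+ k) * n%:R ^+ (m + e)) =
    h ^+ e * ((n.+1 + n)%:R * n%:R ^+ 3 * n%:R ^+ (k + m)).
  have ne : n%:R ^+ e != 0 :> R by rewrite expf_neq0// gt_eqF.
  rewrite expr_div_n (exprD _ m e) (exprD _ k m).
  by move: (n%:R ^+ e) ne => y ne; field.
rewrite E.
(* The choice of [el]: [2 ^ - (k + m)] turns [n] into [n / 2], [2 ^ - (4 L1)] absorbs [n ^ 4], and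
   [2 ^ -6] leaves the factor [3 / 64], below [1 / 8]. *)
have he : h ^+ e <= (2^-1 ^+ (k + m)) * (2^-1 ^+ 6 * (2^-1 ^+ (4 * L1 n))).
  rewrite -!exprD addnA -/(el n A0 k) lerXn2r ?nnegrE//; have := h12; lra.
have nL : 2^-1 ^+ (4 * L1 n) * n%:R ^+ 4 <= 1 :> R.
  rewrite exprVn ler_pdivrMl ?exprn_gt0// mulr1 mulnC exprM lerXn2r ?nnegrE ?exprn_ge0//.
  by rewrite -natrX ler_nat ltnW// n_lt_L1.
have i3 : (n.+1 + n)%:R <= 3 * n%:R :> R by rewrite natrD -natr1; have := n1; lra.
pose Z : R := (n%:R / 2) ^+ (k + m).
have Z0 : 0 < Z by rewrite exprn_gt0// divr_gt0.
apply: (@le_lt_trans _ _ (3 / 64 * Z)); last by rewrite -/Z; lra.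
apply: (@le_trans _ _ ((2^-1 ^+ (k + m)) * (2^-1 ^+ 6 * (2^-1 ^+ (4 * L1 n))) * (3 * n%:R * n%:R ^+ 3 * n%:R ^+ (k + m)))).
  by rewrite ler_pM ?exprn_ge0 ?mulr_ge0 ?exprn_ge0// ler_wpM2r ?exprn_ge0// ler_wpM2r ?exprn_ge0.
have -> : (2^-1 ^+ (k + m)) * (2^-1 ^+ 6 * (2^-1 ^+ (4 * L1 n))) * (3 * n%:R * n%:R ^+ 3 * n%:R ^+ (k + m)) =
    (3 / 64 * Z) * (2^-1 ^+ (4 * L1 n) * n%:R ^+ 4) :> R.
  by rewrite /Z expr_div_n !exprVn; field; rewrite !expf_neq0.
by rewrite ler_piMr// mulr_ge0// ltW.
Qed.

End BadEvent.

(** * Zeros in one short interval *)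

Section PieceDet.
Variables (R : realType) (n k : nat) (x : 'I_n.+1 + 'I_n -> R) (a : R) (D m0 : nat).
Hypotheses (n0 : (0 < n)%N) (D2 : (2 <= D)%N).

Local Notation F := (tsum (@freq n) (@phase R n k) (fun i => x i * (freq i)%:R ^+ k)).
Local Notation th := (D%:R^-1 : R).
Local Notation h := (D%:R^-1 ^+ 4 : R).
Local Notation tau := (D%:R^-1 ^+ 4 / n%:R : R).
Local Notation s := (sg R n k).
Definition Yd m := \sum_i yco k a m i * x i.

Let nr0 : 0 < n%:R :> R. Proof. by rewrite ltr0n. Qed.
Let s0 : 0 < s. Proof. exact: sg_gt0. Qed.
Let D0 : 0 < D%:R :> R. Proof. by rewrite ltr0n; apply: leq_trans D2. Qed.
Let th0 : 0 < th. Proof. by rewrite invr_gt0. Qed.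
Let th12 : th <= 2^-1. Proof. by rewrite lef_pV2 ?posrE// ler_nat. Qed.
Let th1 : th <= 1. Proof. by apply: le_trans th12 _; rewrite invf_le1// ler1n. Qed.
Let h0 : 0 < h. Proof. by rewrite exprn_gt0. Qed.
Let h12 : h <= 2^-1.
Proof. by apply: le_trans th12; rewrite exprS ler_piMr ?(ltW th0)// exprn_ile1// ltW. Qed.
Let t0 : 0 < tau. Proof. by rewrite divr_gt0. Qed.
Let ns0 m : 0 <= n%:R ^+ m * s. Proof. by rewrite mulr_ge0 ?exprn_ge0 ?(ltW s0). Qed.
Let dF : deriv_family F. Proof. exact: tsum_deriv. Qed.
Let aa : a <= a <= a + tau. Proof. by rewrite lexx lerDl ltW. Qed.

Lemma F_at_point m : F m a = n%:R ^+ m * s * Yd m.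
Proof.
rewrite tsum_gco /Yd mulr_sumr; apply: eq_bigr => i _; rewrite /yco.
have nm : n%:R ^+ m * s != 0 by rewrite gt_eqF// mulr_gt0// exprn_gt0.
by rewrite mulrA [_ * (_ / _)]mulrC divfK.
Qed.

Hypothesis x_le : forall i, `|x i| <= n%:R ^+ 3.
Hypothesis Y_le : forall i, (i < m0)%N -> `|Yd (2 + i)| <= D%:R ^+ 3.
Hypothesis m0_big : h ^+ m0 * (3 * n%:R ^+ 4 * (2 * k + 1)%:R) <= 2^-1.

Local Notation Z := (3 * n%:R ^+ 4 * (2 * k + 1)%:R : R).

Let nk_le : n%:R ^+ k <= (2 * k + 1)%:R * s.
Proof.
have /andP[hp _] := psum_bounds R n (2 * k).
have k1 : 1 <= (2 * k + 1)%:R :> R by rewrite ler1n addn1.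
rewrite -(@ler_pXn2r _ 2) ?nnegrE ?mulr_ge0 ?exprn_ge0 ?(ltW s0)// exprMn sg_sqr.
rewrite -[(2 * k).+1]addn1 exprD expr1 in hp.
have n1 : 1 <= n%:R :> R by rewrite ler1n.
have e1 : (n%:R ^+ k) ^+ 2 <= n%:R ^+ (2 * k) * n%:R :> R.
  by rewrite -exprM mulnC ler_peMr// exprn_ge0.
apply: le_trans e1 (le_trans hp _).
by rewrite expr2 -mulrA ler_peMl// mulr_ge0 ?psum_ge0.
Qed.

Let F_top y : `|F (2 + m0)%N y| <= n%:R ^+ (2 + m0) * s * Z.
Proof.
have cB i : `|x i * (freq i)%:R ^+ k| <= n%:R ^+ 3 * n%:R ^+ k.
  rewrite normrM ler_pM//.
  by rewrite ger0_norm ?exprn_ge0// lerXn2r ?nnegrE// ler_nat freq_le.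
apply: le_trans (tsum_le _ _ _ (@freq_le n) cB) _.
rewrite card_sum !card_ord [leLHS]mulrC -[leRHS]mulrA ler_wpM2l ?exprn_ge0//.
have i3 : (n.+1 + n)%:R <= 3 * n%:R :> R.
  by rewrite natrD -natr1; have : 1 <= n%:R :> R by [rewrite ler1n|]; lra.
apply: (@le_trans _ _ (3 * n%:R * (n%:R ^+ 3 * ((2 * k + 1)%:R * s)))).
  by rewrite ler_pM ?mulr_ge0 ?exprn_ge0// ler_wpM2l// exprn_ge0.
by rewrite le_eqVlt; apply/orP; left; apply/eqP; ring.
Qed.

(** Downward induction from the order [2 + m0], where only the crude bound [Z] is known, to the
    order 2. In normalised terms, one order less multiplies the bound by [h] and adds the value at
    [a], at most [D ^ 3]; as [h <= 1/2], the first part stays below [2 D ^ 3] while [Z] gains a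
    factor [h] each time. *)
Let F_mid j i y : (i + j = m0)%N -> a <= y <= a + tau ->
  `|F (2 + i)%N y| <= n%:R ^+ (2 + i) * s * (2 * D%:R ^+ 3 + h ^+ j * Z).
Proof.
elim: j i y => [|j IH] i y ij yI.
  rewrite addn0 in ij; rewrite ij expr0 mul1r; apply: le_trans (F_top y) _.
  rewrite ler_wpM2l ?ns0//.
  have : 0 <= D%:R ^+ 3 :> R by rewrite exprn_ge0.
  lra.
have B z : a <= z <= a + tau -> `|F (2 + i).+1 z| <= n%:R ^+ (2 + i).+1 * s * (2 * D%:R ^+ 3 + h ^+ j * Z).
  by move=> zI; have := IH i.+1 z; rewrite addnS; apply => //; rewrite -ij addnS.
have L := deriv_family_lip dF B yI aa.
have iM : (i < m0)%N by rewrite -ij -addSnnS leq_addr.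
have ya : `|y - a| <= tau.
  by move: yI => /andP[y1 y2]; rewrite ger0_norm ?subr_ge0// lerBlDr addrC.
set W := 2 * D%:R ^+ 3 + h ^+ j * Z in B L *.
have W0 : 0 <= W by rewrite addr_ge0 ?mulr_ge0 ?exprn_ge0 ?(ltW D0) ?(ltW h0).
have -> : F (2 + i)%N y = F (2 + i)%N a + (F (2 + i)%N y - F (2 + i)%N a) by ring.
apply: le_trans (ler_normD _ _) _.
have A1 : `|F (2 + i)%N a| <= n%:R ^+ (2 + i) * s * D%:R ^+ 3.
  rewrite F_at_point normrM ger0_norm ?ns0//.
  by rewrite ler_wpM2l ?ns0// Y_le.
have A2 : `|F (2 + i)%N y - F (2 + i)%N a| <= n%:R ^+ (2 + i) * s * (h * W).
  apply: le_trans L _; apply: (@le_trans _ _ (n%:R ^+ (2 + i).+1 * s * W * tau)).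
    by rewrite ler_wpM2l// mulr_ge0// ns0.
  by rewrite le_eqVlt; apply/orP; left; apply/eqP; rewrite [n%:R ^+ (2 + i).+1]exprS; field; rewrite !gt_eqF.
apply: le_trans (lerD A1 A2) _.
rewrite -mulrDr ler_wpM2l ?ns0//.
have : h * (2 * D%:R ^+ 3) <= 2^-1 * (2 * D%:R ^+ 3).
  by rewrite ler_wpM2r// mulr_ge0// exprn_ge0// ltW.
rewrite mulKf// /W [h ^+ j.+1]exprS [h * (_ + _)]mulrDr -[h * h ^+ j * Z]mulrA.
set u := h * (h ^+ j * Z); set v := h * (2 * _); lra.
Qed.

Local Notation S2 := (n%:R ^+ 2 * s * (5 / 2 * D%:R ^+ 3) : R).

Lemma F2_le y : a <= y <= a + tau -> `|F 2 y| <= S2.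
Proof.
move=> yI; have := @F_mid m0 0%N y (add0n _) yI; rewrite addn0 => /le_trans; apply.
rewrite ler_wpM2l ?ns0//.
have : 1 <= D%:R ^+ 3 :> R by rewrite exprn_ege1// ler1n ltnW.
have := m0_big; lra.
Qed.

Let tS2 : tau ^+ 2 * S2 = s * (5 / 2 * th ^+ 5).
Proof. by rewrite !exprVn; field; rewrite !gt_eqF. Qed.

Let tS1 : tau * S2 = n%:R * s * (5 / 2 * th).
Proof. by rewrite !exprVn; field; rewrite !gt_eqF. Qed.

Lemma F1_near y : a <= y <= a + tau -> `|F 1 y - F 1 a| <= n%:R * s * (5 / 2 * th).
Proof.
move=> yI; have := deriv_family_lip dF F2_le yI aa => /le_trans; apply.
rewrite -tS1 mulrC ler_wpM2r ?mulr_ge0 ?exprn_ge0 ?(ltW s0) ?(ltW D0)//.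
by move: yI => /andP[y1 y2]; rewrite ger0_norm ?subr_ge0// lerBlDr addrC.
Qed.

(** The remainder of the tangent is at most [tau] times the oscillation of the first derivative,
    which [F2_le] controls. *)
Lemma F0_near u : 0 <= u <= 1 ->
  `|F 0 (a + u * tau) - s * (Yd 0 + u * (h * Yd 1))| <= s * (5 / 2 * th ^+ 5).
Proof.
move=> /andP[u0 u1].
have uI : a <= a + u * tau <= a + tau by rewrite lerDl lerD2l mulr_ge0 ?(ltW t0)//= ler_piMl// ltW.
have au : a <= a + u * tau by case/andP: uI.
have [c cI E] := @MVT_segment R (F 0) (F 1) a (a + u * tau) au (fun z _ => dF 0%N z)
  (continuous_subspaceT (deriv_family_continuous (m := 0%N) dF)).
rewrite in_itv/= in cI; move: cI => /andP[c1 c2].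
have cI : a <= c <= a + tau by rewrite c1 (le_trans c2)//; case/andP: uI.
have -> : F 0 (a + u * tau) - s * (Yd 0 + u * (h * Yd 1)) = (F 1 c - F 1 a) * (u * tau).
  have -> : F 0 (a + u * tau) = F 0 a + F 1 c * (u * tau).
    by have := E; rewrite addrAC subrr add0r => <-; ring.
  by rewrite !F_at_point expr0 expr1; field; rewrite !gt_eqF.
rewrite normrM [`|u * tau|]ger0_norm ?mulr_ge0 ?(ltW t0)//.
apply: (@le_trans _ _ (n%:R * s * (5 / 2 * th) * tau)).
  apply: ler_pM => //; [by rewrite mulr_ge0// ltW|exact: F1_near|by rewrite ler_piMl// ltW].
by rewrite -tS1 mulrAC -expr2 tS2.
Qed.

Lemma root_wedge : (exists2 y, a <= y <= a + tau & F 0 y = 0) ->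
  exists2 u, 0 <= u <= 1 & `|Yd 0 + u * (h * Yd 1)| <= 5 / 2 * th ^+ 5.
Proof.
move=> [y /andP[y1 y2] Fy]; pose u := (y - a) / tau.
have uI : 0 <= u <= 1.
  by rewrite divr_ge0 ?subr_ge0 ?(ltW t0)//= ler_pdivrMr// mul1r lerBlDr addrC.
exists u => //; have := F0_near uI.
rewrite (_ : a + u * tau = y); last by rewrite /u divfK ?gt_eqF// addrC subrK.
by rewrite Fy sub0r normrN normrM (gtr0_norm s0) ler_pM2l.
Qed.

(** The second root gives a root of the derivative. The slope at [a] is therefore small, and then so
    is the value. *)
Lemma two_roots_small : zeros_ge F a (a + tau) 2 ->
  `|Yd 1| <= 5 / 2 * th /\ `|Yd 0| <= 5 * th ^+ 5.
Proof.
move=> zg.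
have [y1 y1I Fy1] := zeros_ge_deriv_root dF zg (isT : (1 < 2)%N).
have Y1 : `|Yd 1| <= 5 / 2 * th.
  have := F1_near y1I; rewrite Fy1 sub0r normrN F_at_point expr1 normrM.
  by rewrite (gtr0_norm (mulr_gt0 nr0 s0)) ler_pM2l// mulr_gt0.
split => //.
have [u /andP[u0 u1] hu] := root_wedge (zeros_ge_root zg).
have -> : Yd 0 = (Yd 0 + u * (h * Yd 1)) - u * (h * Yd 1) by ring.
apply: le_trans (ler_normB _ _) _.
have : `|u * (h * Yd 1)| <= h * (5 / 2 * th).
  rewrite normrM (ger0_norm u0) -[leRHS]mul1r ler_pM// normrM (gtr0_norm h0).
  by rewrite ler_wpM2l// ltW.
have -> : h * (5 / 2 * th) = 5 / 2 * th ^+ 5 by ring.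
lra.
Qed.

(* The strict inequality [5/2 < 3] makes the sign change strict. *)
Lemma sign_change (e : R) : e ^+ 2 = 1 -> e * Yd 0 <= - (3 * th ^+ 5) ->
  3 * th ^+ 5 <= e * (Yd 0 + h * Yd 1) ->
  (exists2 y, a < y < a + tau & F 0 y = 0) /\ ~ (forall y, F 0 y = 0).
Proof.
move=> e2 l1 l2.
have t5 : 0 < th ^+ 5 by rewrite exprn_gt0.
have e1 : `|e| = 1 by apply/eqP; rewrite -sqrp_eq1 ?normr_ge0// real_normK ?num_real// e2.
have F0a : F 0 a = s * Yd 0 by rewrite F_at_point expr0 mul1r.
have na : e * F 0 a < 0.
  rewrite F0a mulrCA pmulr_rlt0//; lra.
have nb : 0 < e * F 0 (a + tau).
  have := @F0_near 1; rewrite lexx ler01 !mul1r => /(_ isT).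
  set v := F 0 (a + tau); set z := Yd 0 + h * Yd 1 in l2 *.
  move=> H; have : `|e * (v - s * z)| <= s * (5 / 2 * th ^+ 5) by rewrite normrM e1 mul1r.
  rewrite ler_norml => /andP[hv _].
  have : s * (3 * th ^+ 5) <= s * (e * z) by rewrite ler_pM2l.
  have : 0 < s * th ^+ 5 by rewrite mulr_gt0.
  have E : e * (v - s * z) = e * v - s * (e * z) by ring.
  move: hv; rewrite E; move: (th ^+ 5) (e * v) (e * z) => T ev ez.
  set sz := s * ez; rewrite (_ : s * (5 / 2 * T) = 5 / 2 * (s * T)); last by ring.
  rewrite (_ : s * (3 * T) = 3 * (s * T)); last by ring.
  move: (s * T) sz => u v'; lra.
have eF y : e * F 0 y = 0 -> F 0 y = 0.
  by move=> /eqP; rewrite mulf_eq0 -normr_eq0 e1 oner_eq0 /= => /eqP.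
have cF : continuous (fun y => e * F 0 y).
  move=> y; apply: cvgM; first exact: cvg_cst.
  exact: (deriv_family_continuous (m := 0%N) dF).
have ab : a <= a + tau by rewrite lerDl ltW.
have [|y yI Fy] := @IVT R (fun y => e * F 0 y) a (a + tau) 0 ab (continuous_subspaceT cF).
  by rewrite ge_min le_max (ltW na) (ltW nb) orbT.
split; last by move=> Z; rewrite Z mulr0 ltxx in na.
rewrite in_itv/= in yI; move: yI => /andP[y1 y2].
exists y; last exact: eF.
rewrite !lt_neqAle y1 y2 !andbT; apply/andP; split; apply/eqP => E.
  by rewrite -E in Fy; rewrite Fy ltxx in na.
by rewrite E in Fy; rewrite Fy ltxx in nb.
Qed.

End PieceDet.

(** * The expected number of zeros in one short interval *)

Section PieceProb.
Context d (T : measurableType d) (R : realType) (P : probability T R).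
Variables (n k : nat) (X : 'I_n.+1 + 'I_n -> {RV P >-> R}) (p C a q : R) (A0 D m0 : nat).
Hypotheses (iX : mutually_independent P X) (p23 : 2 < p <= 3) (C1 : 1 <= C).
Hypothesis sX : forall i, std_moments P p C (X i).
Hypotheses (q01 : 0 < q < 1) (qA0 : q ^+ A0 <= 16^-1) (A00 : (0 < A0)%N).
Hypothesis qX : forall i x, Pr P [set w | `|X i w - x| <= 1/2] <= q.
Hypotheses (n0 : (0 < n)%N) (Kn : (2 * Kl n A0 <= n)%N).
Hypothesis l12 : 1/2 <= la R n k.
Hypotheses (D1 : 5090 + 288 * C <= D%:R).
Hypothesis B_le1 : 3 * (2 * D%:R ^+ 74) * Mn R n k <= 1.
Hypothesis B_small : (3 * (2 * D%:R ^+ 74) * Mn R n k) `^ (p - 2) <= D%:R^-1 ^+ 340.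
Hypothesis M_le : (ml n A0 + el n A0 k <= D)%N.
Hypothesis m0_big : (D%:R^-1 ^+ 4 : R) ^+ m0 * (3 * n%:R ^+ 4 * (2 * k + 1)%:R) <= 2^-1.
Hypothesis bad_small : 20 * n%:R ^+ 2 * ((4 + (1 - q)^-1) * (n%:R ^+ 4)^-1) <= D%:R^-1 ^+ 5.

Local Notation F w := (tsum (@freq n) (@phase R n k) (fun i => X i w * (freq i)%:R ^+ k)).
Local Notation th := (D%:R^-1 : R).
Local Notation tau := (D%:R^-1 ^+ 4 / n%:R : R).
Local Notation l := (la R n k).
Local Notation Y := (Yv k X a).
Local Notation U := (Ue k X a).
Local Notation V := (Ve k X a).

Let p23' : 2 <= p <= 3. Proof. by case/andP: p23 => /ltW -> ->. Qed.
Let D5 : 5000 <= D%:R :> R. Proof. by have := D1; have := C1; lra. Qed.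
Let D2 : (2 <= D)%N. Proof. by rewrite -(ler_nat R); have := D5; lra. Qed.
Let D0 : 0 < D%:R :> R. Proof. by have := D5; lra. Qed.
Let th0 : 0 < th. Proof. by rewrite invr_gt0. Qed.
Let th12 : th <= 1/2. Proof. by rewrite div1r lef_pV2 ?posrE//; have := D5; lra. Qed.
Let th1 : th <= 1. Proof. by have := th12; lra. Qed.
Let l0 : 0 < l. Proof. exact: la_gt0. Qed.
Let nr0 : 0 < n%:R :> R. Proof. by rewrite ltr0n. Qed.
Let n1 : 1 <= n%:R :> R. Proof. by rewrite ler1n. Qed.
Let tau0 : 0 < tau. Proof. by rewrite divr_gt0// exprn_gt0. Qed.
Let th4 : 0 < th ^+ 4. Proof. by rewrite exprn_gt0. Qed.
Let th5 : 0 < th ^+ 5. Proof. by rewrite exprn_gt0. Qed.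

(** [rho] leaves room for the remainder [5/2 * th ^ 5] of the tangent; [kap] is the slope of the
    wedge in the coordinates of unit variance. *)
Let rho : R := 3 * th ^+ 5.
Let kap : R := th ^+ 4 * l.

Let G : set T := [set w | forall i, (i < m0)%N -> `|Y (2 + i) w| < D%:R ^+ 3].
Let bad : set T := badF k X a A0 `|` badX X.
(** On good outcomes a root puts the pair into [Wp e] for one of the signs, and [Wm e] forces a sign
    change; the two differ by strips of width of order [rho]. Two roots put the pair into the box
    [Q]. *)
Let Wp e : set T := [set w | [/\ 0 <= V e w, - (kap * V e w + rho) <= U e w & U e w <= rho]].
Let Wm e : set T := [set w | [/\ 0 <= V e w, rho - kap * V e w <= U e w & U e w <= - rho]].
Let Q : set T := rect (U 1) (V 1) (- (6 * th ^+ 5)) (6 * th ^+ 5) (- (6 * th)) (6 * th).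

Let mbad : measurable bad.
Proof. by apply: measurableU; [exact: measurable_badF|exact: measurable_badX]. Qed.

Let mGc : measurable (~` G).
Proof.
have -> : ~` G = \bigcup_(i in [set i | (i < m0)%N]) [set w | D%:R ^+ 3 <= `|Y (2 + i) w|].
  apply/seteqP; split => w /=.
    move=> /existsNP[i /not_implyP[im hi]]; exists i => //=.
    by rewrite leNgt; apply/negP.
  by move=> [i im hi] g; have := g i im; rewrite ltNge hi.
apply: bigcup_measurable => i _; apply: meas_le => //.
by apply: measurableT_comp => //; exact: measurable_Yv.
Qed.

Let mWp e : measurable (Wp e).
Proof.
have mU := measurable_Ue k X a e; have mV := measurable_Ve k X a e.
have -> : Wp e = [set w | 0 <= V e w] `&` ([set w | - (kap * V e w + rho) <= U e w] `&` [set w | U e w <= rho]).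
  by apply/seteqP; split => w /=; [case|case=> ? []].
apply: measurableI; first exact: meas_le.
by apply: measurableI; apply: meas_le => //; do ?[apply: measurableT_comp => //|apply: measurable_funD => //|apply: measurable_funM => //].
Qed.

Let mWm e : measurable (Wm e).
Proof.
have mU := measurable_Ue k X a e; have mV := measurable_Ve k X a e.
have -> : Wm e = [set w | 0 <= V e w] `&` ([set w | rho - kap * V e w <= U e w] `&` [set w | U e w <= - rho]).
  by apply/seteqP; split => w /=; [case|case=> ? []].
apply: measurableI; first exact: meas_le.
by apply: measurableI; apply: meas_le => //; do ?[apply: measurable_funB => //|apply: measurable_funM => //].
Qed.

Let mQ : measurable Q.
Proof. by apply: measurable_rect; [exact: measurable_Ue|exact: measurable_Ve]. Qed.

Let Pr_Gc : Pr P (~` G) <= m0%:R * th ^+ 6.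
Proof.
apply: (@le_trans _ _ (\sum_(i < m0) Pr P [set w | D%:R ^+ 3 <= `|Y (2 + i) w|])).
  apply: Pr_cover => //.
    move=> i; apply: meas_le => //.
    by apply: measurableT_comp => //; exact: measurable_Yv.
  move=> w /existsNP[i /not_implyP[im hi]]; exists (Ordinal im) => /=.
  by rewrite leNgt; apply/negP.
apply: (@le_trans _ _ (\sum_(i < m0) th ^+ 6)); last by rewrite sumr_const card_ord mulr_natl.
apply: ler_sum => i _; have -> : th ^+ 6 = ((D%:R ^+ 3) ^+ 2)^-1 by rewrite -exprM exprVn.
have t0 : 0 < D%:R ^+ 3 :> R by rewrite exprn_gt0.
exact: (Pr_Yv_ge k a iX sX n0 (2 + i)%N t0).
Qed.

Let Pr_V e : e ^+ 2 = 1 -> Pr P [set w | D%:R ^+ 3 <= V e w] <= th ^+ 6.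
Proof.
move=> e2; have t0 : 0 < D%:R ^+ 3 :> R by rewrite exprn_gt0.
have hV : \sum_(i : 'I_n.+1 + 'I_n) (e * (yco k a 1 i / l)) ^+ 2 <= 1.
  under eq_bigr do rewrite exprMn e2 mul1r expr_div_n.
  by rewrite -mulr_suml yco_sqr1 divff// expf_neq0// gt_eqF.
have := Pr_lin_ge iX sX t0 hV; rewrite div1r -exprM -exprVn.
apply: le_trans; apply: Pr_mono.
- by apply: meas_le => //; exact: measurable_Ve.
- by apply: meas_le => //; apply: measurableT_comp => //; exact: meas_lin.
move=> w /= h; apply: le_trans h _; apply: le_trans (ler_norm _) _.
rewrite /Ve /Yv mulr_suml mulr_sumr le_eqVlt; apply/orP; left; apply/eqP; congr `|_|.
by apply: eq_bigr => i _; ring.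
Qed.

Let HR e (e2 : e ^+ 2 = 1) (x y x' y' : R) := rect_est a iX p23 C1 sX n0 l12 D1 B_le1 B_small e2 (x := x) (y := y) (x' := x') (y' := y').

Let D6 : 4 <= D%:R ^+ 6 :> R.
Proof.
have : D%:R ^+ 1 <= D%:R ^+ 6 :> R by rewrite ler_weXn2l//; have := D5; lra.
by rewrite expr1; have := D5; lra.
Qed.

Let D36 : D%:R ^+ 3 <= D%:R ^+ 6 :> R.
Proof. by rewrite ler_weXn2l//; have := D5; lra. Qed.

Let kap0 : 0 <= kap. Proof. by rewrite mulr_ge0// ltW. Qed.
Let kap1 : kap <= th ^+ 4. Proof. by rewrite ler_piMr ?(ltW th4)// la_le1. Qed.
Let rho0 : 0 <= rho. Proof. by rewrite mulr_ge0// ltW. Qed.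

Let Pr_Wp e : e ^+ 2 = 1 -> Pr P (Wp e) <= kap * phi0 R ^+ 2 + 9 * th ^+ 5.
Proof.
move=> e2; have D1' : (0 < D)%N := ltnW D2.
exact: (Pr_wedge_le (measurable_Ue k X a e) (measurable_Ve k X a e)
  (HR e2) D1' D36 D6 kap0 kap1 rho0 (lexx _) (lexx _) (Pr_V e2)).
Qed.

Let Pr_Wm e : e ^+ 2 = 1 -> kap * phi0 R ^+ 2 - 14 * th ^+ 5 <= Pr P (Wm e).
Proof.
move=> e2; have D1' : (0 < D)%N := ltnW D2.
exact: (Pr_wedge_ge (measurable_Ue k X a e) (measurable_Ve k X a e)
  (HR e2) D1' D36 D6 kap0 kap1 rho0 (lexx _) (lexx _)).
Qed.

Let Pr_Q : Pr P Q <= 145 * th ^+ 6.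
Proof.
have e2 : (1 : R) ^+ 2 = 1 by rewrite expr1n.
have t6 : 6 * th <= D%:R ^+ 6 by have := D6; have := D5; have := D36; have := th12; lra.
have t5 : 6 * th ^+ 5 <= D%:R ^+ 6.
  by apply: le_trans t6; rewrite ler_wpM2l// exprS ler_piMr ?(ltW th0)// exprn_ile1// ltW.
have := HR e2 (x := - (6 * th ^+ 5)) (x' := - (6 * th)); rewrite !lerN2 => /(_ _ _ t5 t5 t6 t6).
rewrite ler_norml => /andP[_]; rewrite -/Q.
have g1 : gm (- (6 * th ^+ 5)) (6 * th ^+ 5) <= 12 * th ^+ 5.
  by apply: le_trans (gm_le_len _) _; have := th5; lra.
have g2 : gm (- (6 * th)) (6 * th) <= 12 * th.
  by apply: le_trans (gm_le_len _) _; have := th0; lra.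
have g0 u v : 0 <= gm u v :> R by exact: gm_ge0.
have := ler_pM (g0 _ _) (g0 _ _) g1 g2.
have -> : 12 * th ^+ 5 * (12 * th) = 144 * th ^+ 6 by ring.
have : th ^+ 9 <= th ^+ 6 by rewrite ler_wiXn2l// ltW.
lra.
Qed.

(** The wedges of both signs together have mass [th ^ 4 * l / pi]. The piece has length
    [th ^ 4 / n], so this is a density of [n * l / pi] zeros. *)
Let kapphi : 2 * (kap * phi0 R ^+ 2) = th ^+ 4 * l / pi.
Proof. by rewrite phi0_sqr /kap invfM; move: (th ^+ 4 * l) pi^-1 => u v; field. Qed.

Let Pr_bad' : 20 * n%:R ^+ 2 * Pr P bad <= th ^+ 5.
Proof.
apply: le_trans bad_small; rewrite ler_wpM2l ?mulr_ge0 ?exprn_ge0//.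
exact: (Pr_bad k a iX sX q01 qA0 A00 qX n0 Kn).
Qed.

Let Pr_bad1 : Pr P bad <= th ^+ 5.
Proof.
apply: le_trans Pr_bad'; rewrite ler_peMl ?Pr_ge0//.
have : 1 <= n%:R ^+ 2 :> R by rewrite exprn_ege1.
lra.
Qed.

Let Pr_Gc5 : D%:R * Pr P (~` G) <= m0%:R * th ^+ 5.
Proof.
apply: (@le_trans _ _ (D%:R * (m0%:R * th ^+ 6))); first by rewrite ler_wpM2l// ltW.
by rewrite le_eqVlt; apply/orP; left; apply/eqP; rewrite exprVn; field; rewrite gt_eqF.
Qed.

Let Pr_Q5 : D%:R * Pr P Q <= 145 * th ^+ 5.
Proof.
apply: (@le_trans _ _ (D%:R * (145 * th ^+ 6))); first by rewrite ler_wpM2l// ltW.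
by rewrite le_eqVlt; apply/orP; left; apply/eqP; rewrite exprVn; field; rewrite gt_eqF.
Qed.

Let dF w : deriv_family (F w). Proof. exact: tsum_deriv. Qed.

Let x_le w : ~ bad w -> forall i, `|X i w| <= n%:R ^+ 3.
Proof.
move=> /not_orP[_ nX] i; rewrite leNgt; apply/negP => h; apply: nX.
by exists i.
Qed.

Let many w : ~ bad w -> (num_roots (F w 0%N) a (a + tau) <= D%:R%:E)%E.
Proof.
move=> nb; apply: num_roots_le (dF w) _ => zg.
have t4 : th ^+ 4 <= 1/2.
  by apply: le_trans th12; rewrite exprS ler_piMr ?(ltW th0)// exprn_ile1// ltW.
apply: (not_bad_few_zeros n0 (ltW th4) t4 nb).
by apply: zeros_ge_le zg; apply: leq_trans M_le _.
Qed.

Let upper_case w : G w -> ~ bad w ->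
  [\/ (num_roots (F w 0%N) a (a + tau) <= 0)%E,
      (num_roots (F w 0%N) a (a + tau) <= 1)%E /\ (Wp 1 w \/ Wp (-1) w) | Q w].
Proof.
move=> Gw nb.
have Yle i : (i < m0)%N -> `|Y (2 + i) w| <= D%:R ^+ 3 by move=> /Gw/ltW.
have [z1|z1] := pselect (zeros_ge (F w) a (a + tau) 1); last first.
  by constructor 1; exact: (num_roots_le (dF w) z1).
have [z2|z2] := pselect (zeros_ge (F w) a (a + tau) 2); last first.
  constructor 2; split; first exact: (num_roots_le (dF w) z2).
  have [u /andP[u0 u1]] := root_wedge n0 D2 (x_le nb) Yle m0_big (zeros_ge_root z1).
  rewrite -[Yd k _ a 0]/(Y 0 w) -[Yd k _ a 1]/(Y 1 w) ler_norml => /andP[h1 h2].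
  (* The sign of the slope decides which of the two wedges contains the pair. *)
  have sgn e : 0 <= e * Y 1 w -> - rho <= e * (Y 0 w + u * (th ^+ 4 * Y 1 w)) <= rho -> Wp e w.
    move=> e1 /andP[g1 g2].
    have E : kap * V e w = th ^+ 4 * (e * Y 1 w) by rewrite /kap /Ve; field; rewrite !gt_eqF.
    have hY : 0 <= th ^+ 4 * (e * Y 1 w) by rewrite mulr_ge0// ltW.
    have E2 : e * (Y 0 w + u * (th ^+ 4 * Y 1 w)) = U e w + u * (th ^+ 4 * (e * Y 1 w)).
      by rewrite /Ue; ring.
    rewrite E2 in g1 g2.
    have uh0 : 0 <= u * (th ^+ 4 * (e * Y 1 w)) by rewrite mulr_ge0.
    have uh1 : u * (th ^+ 4 * (e * Y 1 w)) <= th ^+ 4 * (e * Y 1 w) by rewrite ler_piMl.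
    split; first by rewrite /Ve mulrA divr_ge0// ltW.
      by rewrite E; move: g1 uh1; lra.
    by move: g2 uh0; lra.
  have r1 : 5 / 2 * th ^+ 5 <= rho by rewrite /rho; have := th5; lra.
  have [Y0|/ltW Y0] := leP 0 (Y 1 w); [left|right]; apply: sgn.
  - by rewrite mul1r.
  - by rewrite mul1r; apply/andP; split; [move: r1 h1|move: r1 h2]; lra.
  - by rewrite mulN1r oppr_ge0.
  - by rewrite mulN1r; apply/andP; split; [move: r1 h2|move: r1 h1]; lra.
constructor 3.
have [] := two_roots_small n0 D2 (x_le nb) Yle m0_big z2.
rewrite -[Yd k _ a 0]/(Y 0 w) -[Yd k _ a 1]/(Y 1 w) => b1 b0.
split => /=; rewrite -ler_norml /Ue /Ve mul1r.
  by apply: le_trans b0 _; have := th5; lra.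
rewrite normrM normfV (gtr0_norm l0) ler_pdivrMr//.
apply: le_trans b1 _; have : 6 * th * (1/2) <= 6 * th * l by rewrite ler_wpM2l ?mulr_ge0// ltW.
by have := th0; lra.
Qed.

Let lower_case e w : e ^+ 2 = 1 -> Wm e w -> G w -> ~ bad w ->
  (exists2 y, a < y < a + tau & F w 0%N y = 0) /\ ~ (forall y, F w 0%N y = 0).
Proof.
move=> e2 [V0 U1 U2] Gw nb.
have Yle i : (i < m0)%N -> `|Y (2 + i) w| <= D%:R ^+ 3 by move=> /Gw/ltW.
apply: (sign_change n0 D2 (x_le nb) Yle m0_big e2); first exact: U2.
have E : kap * V e w = th ^+ 4 * (e * Y 1 w) by rewrite /kap /Ve; field; rewrite !gt_eqF.
rewrite -[Yd k _ a 0]/(Y 0 w) -[Yd k _ a 1]/(Y 1 w).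
move: U1; rewrite E /Ue -/rho => h.
have -> : e * (Y 0 w + th ^+ 4 * Y 1 w) = e * Y 0 w + th ^+ 4 * (e * Y 1 w) by ring.
by move: h; lra.
Qed.

Let cap : R := 20 * n%:R ^+ 2.
(* At most one root on the wedges, at most [D] on [Q] and off [G], and the
   deterministic bound [cap] on [bad]. *)
Let up (w : T) : R := \1_(Wp 1) w + (\1_(Wp (-1)) w +
  (D%:R * \1_Q w + (D%:R * \1_(~` G) w + cap * \1_bad w))).
(** At most 1, and positive only on one of the inner wedges outside the exceptional events, where a
    root exists. *)
Let lo (w : T) : R := \1_(Wm 1) w + \1_(Wm (-1)) w - (\1_(~` G) w + \1_bad w).

Let ind0 (A : set T) w : 0 <= \1_A w :> R. Proof. by rewrite indicE. Qed.

Let ind1 (A : set T) w : A w -> \1_A w = 1 :> R.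
Proof. by move=> Aw; rewrite indicE mem_set. Qed.

Let indN (A : set T) w : ~ A w -> \1_A w = 0 :> R.
Proof. by move=> Aw; rewrite indicE memNset. Qed.

Let iup : intg P up.
Proof. by do ?[apply: intgD|apply: intgZ|apply: intg_indic]. Qed.

Let ilo : intg P lo.
Proof. by apply: intgB; apply: intgD; apply: intg_indic. Qed.

Let Ex_up : Ex P up <= th ^+ 4 * l / pi + (164 + m0%:R) * th ^+ 5.
Proof.
have i1 := intg_indic P (mWp 1); have i2 := intg_indic P (mWp (-1)).
have j3 := intg_indic P mQ; have j4 := intg_indic P mGc; have j5 := intg_indic P mbad.
have i3 := intgZ D%:R j3; have i4 := intgZ D%:R j4; have i5 := intgZ cap j5.
have k4 := intgD i4 i5; have k3 := intgD i3 k4; have k2 := intgD i2 k3.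
rewrite /up (ExD i1 k2) (ExD i2 k3) (ExD i3 k4) (ExD i4 i5) !ExZ// !Ex_indic//.
have o1 : (1 : R) ^+ 2 = 1 by rewrite expr1n.
have o2 : (-1 : R) ^+ 2 = 1 by rewrite sqrrN expr1n.
have := Pr_Wp o1; have := Pr_Wp o2; have := Pr_Q5; have := Pr_Gc5; have := Pr_bad'.
rewrite -kapphi -/cap; lra.
Qed.

Let Ex_lo : th ^+ 4 * l / pi - (164 + m0%:R) * th ^+ 5 <= Ex P lo.
Proof.
rewrite /lo ExB; [|by apply: intgD; apply: intg_indic|by apply: intgD; apply: intg_indic].
rewrite !ExD; do ?exact: intg_indic.
rewrite !Ex_indic//.
have o1 : (1 : R) ^+ 2 = 1 by rewrite expr1n.
have o2 : (-1 : R) ^+ 2 = 1 by rewrite sqrrN expr1n.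
have g1 : Pr P (~` G) <= D%:R * Pr P (~` G) by rewrite ler_peMl ?Pr_ge0//; have := D5; lra.
have := Pr_Wm o1; have := Pr_Wm o2; have := Pr_Gc5; have := Pr_bad1; have := th5.
rewrite -kapphi; lra.
Qed.

(** The lower function is tied to a root in the open interval: closed pieces share endpoints,
    whereas roots in the interiors of different pieces are distinct. *)
Lemma piece_bounds : exists up lo : T -> R,
  [/\ intg P up /\ intg P lo,
    Ex P up <= th ^+ 4 * l / pi + (164 + m0%:R) * th ^+ 5,
    th ^+ 4 * l / pi - (164 + m0%:R) * th ^+ 5 <= Ex P lo,
    forall w, (num_roots (F w 0%N) a (a + tau) <= (up w)%:E)%E &
    forall w, lo w <= 1 /\ (0 < lo w ->
      (exists2 y, a < y < a + tau & F w 0%N y = 0) /\ ~ (forall y, F w 0%N y = 0))].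
Proof.
exists up, lo; split => // w.
  have i1 := ind0 (Wp 1) w; have i2 := ind0 (Wp (-1)) w.
  have i3 : 0 <= D%:R * \1_Q w :> R by rewrite mulr_ge0 ?(ltW D0).
  have i4 : 0 <= D%:R * \1_(~` G) w :> R by rewrite mulr_ge0 ?(ltW D0).
  have i5 : 0 <= cap * \1_bad w :> R by rewrite mulr_ge0 ?mulr_ge0 ?exprn_ge0.
  have [bw|nb] := pselect (bad w).
    have aa : a <= a + tau by rewrite lerDl ltW.
    apply: le_trans (num_roots_tsum _ _ n0 (@freq_le n) aa) _; rewrite lee_fin.
    apply: (@le_trans _ _ cap); last first.
      by rewrite /up (ind1 bw) mulr1; move: i1 i2 i3 i4; lra.
    have -> : (a + tau - a) * (4 * n%:R ^+ 2) + 1 = 4 * th ^+ 4 * n%:R + 1 by field; rewrite !gt_eqF.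
    have t4 : th ^+ 4 <= 1 by rewrite exprn_ile1// ltW.
    have c1 : 4 * th ^+ 4 * n%:R + 1 <= 5 * n%:R.
      have : th ^+ 4 * n%:R <= 1 * n%:R by rewrite ler_wpM2r.
      by have := n1; lra.
    have c2 : (2 * n.+1)%:R <= 3 * n%:R + n%:R :> R by rewrite natrM -[n.+1%:R]natr1; have := n1; lra.
    apply: (@le_trans _ _ (5 * n%:R * (4 * n%:R))).
      have p0 : 0 <= 4 * th ^+ 4 * n%:R + 1.
        by rewrite addr_ge0 ?mulr_ge0 ?(ltW th4)//; have := n1; lra.
      have c3 : (2 * n.+1)%:R <= 4 * n%:R :> R by move: c2; lra.
      exact: (ler_pM p0 (ler0n _ _) c1 c3).
    by rewrite /cap le_eqVlt; apply/orP; left; apply/eqP; ring.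
  have [Gw|nG] := pselect (G w); last first.
    apply: le_trans (many nb) _; rewrite lee_fin /up.
    by rewrite [\1_(~` G) w]ind1// mulr1; move: i1 i2 i3 i5; lra.
  case: (upper_case Gw nb) => [h|[h hW]|h]; apply: le_trans.
  - exact: h.
  - by rewrite lee_fin /up; move: i1 i2 i3 i4 i5; lra.
  - exact: h.
  - rewrite lee_fin /up; move: i1 i2 i3 i4 i5.
    by case: hW => hW; rewrite (ind1 hW); lra.
  - exact: (many nb).
  - by rewrite lee_fin /up (ind1 h) mulr1; move: i1 i2 i4 i5; lra.
have j1 := ind0 (~` G) w; have j2 := ind0 bad w.
have ind_le A : \1_A w <= 1 :> R by rewrite indicE; case: (_ \in _).
have [W1|W1] := pselect (Wm 1 w).
  have nW2 : ~ Wm (-1) w.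
    case: W1 => _ _ h1 [_ _ h2]; move: h1 h2; rewrite /Ue /rho mul1r mulN1r.
    by have := th5; lra.
  rewrite /lo (ind1 W1) (indN nW2); split; first by move: j1 j2; lra.
  have [bw|nb] := pselect (bad w); first by rewrite (ind1 bw); move: j1; lra.
  have [Gw|nG] := pselect (G w); last by rewrite [\1_(~` G) w]ind1//; move: j2; lra.
  by move=> _; apply: lower_case W1 Gw nb; rewrite expr1n.
rewrite /lo (indN W1); split; first by move: j1 j2 (ind_le (Wm (-1))); lra.
have [W2|W2] := pselect (Wm (-1) w); last by rewrite (indN W2); move: j1 j2; lra.
have [bw|nb] := pselect (bad w); first by rewrite (ind1 bw) (ind1 W2); move: j1; lra.
have [Gw|nG] := pselect (G w); last by rewrite [\1_(~` G) w]ind1// (ind1 W2); move: j2; lra.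
by move=> _; apply: lower_case W2 Gw nb; rewrite sqrrN expr1n.
Qed.

End PieceProb.

(** * From short intervals to an arbitrary interval *)

Section Sandwich.
Context d (T : measurableType d) (R : realType) (P : probability T R).

(* The integral of a nonnegative function is a supremum over simple functions
   below it, so it is monotone without any measurability. *)
Lemma le_integral_nonmeas (f g : T -> \bar R) : (forall w, 0 <= f w)%E -> (forall w, f w <= g w)%E ->
  (\int[P]_w f w <= \int[P]_w g w)%E.
Proof.
move=> f0 fg; have g0 w : (0 <= g w)%E by exact: le_trans (fg w).
rewrite !ge0_integralTE//; apply: ereal_sup_le => _ [h hf <-]; exists h => // x.
exact: le_trans (fg x).
Qed.

Lemma integral_sandwich (f : T -> \bar R) (lo up : T -> R) :
  intg P lo -> intg P up -> (forall w, 0 <= f w)%E ->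
  (forall w, (lo w)%:E <= f w)%E -> (forall w, f w <= (up w)%:E)%E ->
  ((Ex P lo)%:E <= \int[P]_w f w)%E /\ (\int[P]_w f w <= (Ex P up)%:E)%E.
Proof.
move=> il iu f0 lf fu; split; last by rewrite -ExE//; exact: le_integral_nonmeas.
(* [lo] may be negative, so it is replaced by its positive part [(lo + |lo|) / 2], still below [f]
   because [f >= 0]. *)
have i2 : intg P (fun w => 2^-1 * (lo w + `|lo w|)).
  by apply: intgZ; apply: intgD => //; exact: intg_norm.
have le2 w : lo w <= 2^-1 * (lo w + `|lo w|) by have := ler_norm (lo w); lra.
apply: le_trans (_ : (Ex P (fun w => 2^-1 * (lo w + `|lo w|)))%:E <= _)%E.
  by rewrite lee_fin; exact: Ex_le.
rewrite -ExE//; apply: le_integral_nonmeas => w.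
  by rewrite lee_fin mulr_ge0// addrC -lerBlDr sub0r -normrN ler_norm.
have [l0|l0] := leP 0 (lo w).
  by apply: le_trans (lf w); rewrite lee_fin ger0_norm//; lra.
by rewrite ltr0_norm// subrr mulr0.
Qed.

End Sandwich.

Lemma num_roots_mono (R : realType) (f : R -> R) (a b c : R) : b <= c ->
  (num_roots f a b <= num_roots f a c)%E.
Proof.
move=> bc; rewrite /num_roots; case: asboolP => // _.
apply: ereal_sup_le => _ [A [finA AS] <-]; exists A => //; split => // x /AS[/andP[ax xb] fx].
by split => //; rewrite ax (le_trans xb).
Qed.

(** [x] is the rescaled length of the pieces inside the interval, [L] that of the interval, and [t4]
    that of one piece, which is all by which the lower and the upper count differ in length. *)
Lemma count_error (R : realFieldType) (x t4 th L ka Cm v : R) : 0 <= x -> 0 <= t4 -> 0 <= th -> t4 <= th ->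
  th <= 1 -> 0 <= ka -> ka <= 1 -> 0 <= Cm -> x <= L -> L < x + t4 ->
  x * (ka - Cm * th) <= v -> v <= (x + t4) * (ka + Cm * th) ->
  `|v - L * ka| <= (Cm + 1) * th * (L + 1).
Proof.
move=> x0 t40 th0 t4h th1 ka0 ka1 Cm0 xL Lx vl vu.
have c0 : 0 <= Cm * th by rewrite mulr_ge0.
have h1 : x * (Cm * th) <= L * (Cm * th) by rewrite ler_wpM2r.
have h2 : (L - t4) * ka <= x * ka by rewrite ler_wpM2r//; lra.
have h3 : t4 * ka <= th by rewrite -[leRHS]mulr1 ler_pM.
have h4 : x * ka <= L * ka by rewrite ler_wpM2r.
have h5 : t4 * (Cm * th) <= 1 * (Cm * th) by rewrite ler_wpM2r//; lra.
have h6 : 0 <= th * L by rewrite mulr_ge0//; lra.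
have -> : (Cm + 1) * th * (L + 1) = L * (Cm * th) + Cm * th + th * L + th by ring.
move: vl vu h1 h2 h3 h4 h5 h6 c0; rewrite !mulrDl !mulrDr mulrN mulNr.
set u1 := x * ka; set u2 := L * (_ * _); set u3 := th * L; set u4 := t4 * (_ * _).
set u5 := t4 * ka; set u6 := x * (_ * _); set u7 := Cm * th; set u8 := L * ka => *.
by rewrite ler_distl; apply/andP; split; lra.
Qed.

Section Interval.
Context d (T : measurableType d) (R : realType) (P : probability T R).
Variables (n k : nat) (X : 'I_n.+1 + 'I_n -> {RV P >-> R}) (p C q : R) (A0 D m0 : nat).
Hypotheses (iX : mutually_independent P X) (p23 : 2 < p <= 3) (C1 : 1 <= C).
Hypothesis sX : forall i, std_moments P p C (X i).
Hypotheses (q01 : 0 < q < 1) (qA0 : q ^+ A0 <= 16^-1) (A00 : (0 < A0)%N).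
Hypothesis qX : forall i x, Pr P [set w | `|X i w - x| <= 1/2] <= q.
Hypotheses (n0 : (0 < n)%N) (Kn : (2 * Kl n A0 <= n)%N).
Hypothesis l12 : 1/2 <= la R n k.
Hypotheses (D1 : 5090 + 288 * C <= D%:R).
Hypothesis B_le1 : 3 * (2 * D%:R ^+ 74) * Mn R n k <= 1.
Hypothesis B_small : (3 * (2 * D%:R ^+ 74) * Mn R n k) `^ (p - 2) <= D%:R^-1 ^+ 340.
Hypothesis M_le : (ml n A0 + el n A0 k <= D)%N.
Hypothesis m0_big : (D%:R^-1 ^+ 4 : R) ^+ m0 * (3 * n%:R ^+ 4 * (2 * k + 1)%:R) <= 2^-1.
Hypothesis bad_small : 20 * n%:R ^+ 2 * ((4 + (1 - q)^-1) * (n%:R ^+ 4)^-1) <= D%:R^-1 ^+ 5.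

Local Notation F w := (tsum (@freq n) (@phase R n k) (fun i => X i w * (freq i)%:R ^+ k) 0).
Local Notation th := (D%:R^-1 : R).
Local Notation tau := (D%:R^-1 ^+ 4 / n%:R : R).
Local Notation l := (la R n k).
Local Notation Cm := (164 + m0%:R : R).

Variables (a b : R).
Hypothesis ab : a <= b.

Let D0 : 0 < D%:R :> R. Proof. by have := D1; have := C1; lra. Qed.
Let th0 : 0 < th. Proof. by rewrite invr_gt0. Qed.
Let th1 : th <= 1. Proof. by rewrite invf_le1//; have := D1; have := C1; lra. Qed.
Let nr0 : 0 < n%:R :> R. Proof. by rewrite ltr0n. Qed.
Let tau0 : 0 < tau. Proof. by rewrite divr_gt0// exprn_gt0. Qed.
Let l0 : 0 < l. Proof. exact: la_gt0. Qed.
Let t (i : nat) := a + i%:R * tau.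
Let N := Num.truncn ((b - a) / tau).

Let tS i : t i.+1 = t i + tau. Proof. by rewrite /t -[i.+1%:R]natr1; ring. Qed.

Let N_le : N%:R * tau <= b - a.
Proof. by rewrite -ler_pdivlMr// truncn_le// divr_ge0 ?subr_ge0// ltW. Qed.

Let N_gt : b - a < N.+1%:R * tau.
Proof. by rewrite -ltr_pdivrMr// truncnS_gt. Qed.

Let piece_spec i (ul : (T -> R) * (T -> R)) :=
  [/\ intg P ul.1 /\ intg P ul.2,
    Ex P ul.1 <= th ^+ 4 * l / pi + Cm * th ^+ 5,
    th ^+ 4 * l / pi - Cm * th ^+ 5 <= Ex P ul.2,
    forall w, (num_roots (F w) (t i) (t i.+1) <= (ul.1 w)%:E)%E &
    forall w, ul.2 w <= 1 /\ (0 < ul.2 w ->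
      (exists2 y, t i < y < t i.+1 & F w y = 0) /\ ~ (forall y, F w y = 0))].

Let pieces : exists ul : nat -> (T -> R) * (T -> R), forall i, piece_spec i (ul i).
Proof.
have H i : exists ul, piece_spec i ul.
  have [up [lo H]] := piece_bounds (t i) iX p23 C1 sX q01 qA0 A00 qX n0 Kn l12 D1 B_le1 B_small M_le m0_big bad_small.
  by exists (up, lo); rewrite /piece_spec tS.
by have [f Hf] := choice H; exists f.
Qed.

(** One root is chosen in each piece where [lo i w] is positive. These roots are distinct, and each
    term of the sum is at most 1. *)
Let lower_count (lo : nat -> T -> R) w :
  (forall i, lo i w <= 1 /\ (0 < lo i w ->
      (exists2 y, t i < y < t i.+1 & F w y = 0) /\ ~ (forall y, F w y = 0))) ->
  ((\sum_(i < N) lo i w)%:E <= num_roots (F w) a b)%E.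
Proof.
move=> H; have [y Hy] : exists y : nat -> R, forall i, 0 < lo i w ->
    [/\ t i < y i < t i.+1, F w (y i) = 0 & ~ (forall z, F w z = 0)].
  have H' i : exists y, 0 < lo i w -> [/\ t i < y < t i.+1, F w y = 0 & ~ (forall z, F w z = 0)].
    have [li|li] := pselect (0 < lo i w); last by exists 0 => /li.
    by have [_ /(_ li)[[y y1 y2] nz]] := H i; exists y.
  by have [f Hf] := choice H'; exists f.
pose s := [seq i <- iota 0 N | 0 < lo i w].
have sumle : \sum_(i < N) lo i w <= (size s)%:R.
  rewrite -(big_mkord xpredT (fun i => lo i w)) /index_iota subn0 -sum1_size natr_sum big_filter.
  rewrite [leRHS]big_mkcond/=; apply: ler_sum => i _; case: ltP => // _.
  by have [] := H i.
apply: (@le_trans _ _ (size s)%:R%:E); first by rewrite lee_fin.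
have [->|[i0 i0s]] : s = [::] \/ exists i, i \in s.
- by case: (s) => [|i s']; [left|right; exists i; rewrite mem_head].
- exact: num_roots_ge0.
have nz : ~ (forall z, F w z = 0) by move: i0s; rewrite mem_filter => /andP[/Hy[]].
rewrite -(size_map y); apply: num_roots_ge_seq => //.
  rewrite map_inj_in_uniq ?filter_uniq ?iota_uniq// => i j.
  rewrite !mem_filter => /andP[li _] /andP[lj _] yij.
  have [/andP[i1 i2] _ _] := Hy _ li; have [/andP[j1 j2] _ _] := Hy _ lj.
  have tlt u v : t u < t v -> (u < v)%N by rewrite /t ltrD2l ltr_pM2r// ltr_nat.
  have := tlt _ _ (lt_trans i1 (_ : y i < t j.+1)); rewrite {1}yij => /(_ j2).
  have := tlt _ _ (lt_trans j1 (_ : y j < t i.+1)); rewrite -{1}yij => /(_ i2).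
  by rewrite !ltnS => h1 h2; apply/eqP; rewrite eqn_leq h1 h2.
move=> z /mapP[i]; rewrite mem_filter mem_iota add0n => /and3P[li _ iN] ->.
have [/andP[y1 y2] Fy _] := Hy _ li; split => //.
have ti : a <= t i by rewrite lerDl mulr_ge0// ltW.
have tb : t i.+1 <= b.
  apply: (@le_trans _ _ (a + N%:R * tau)); last by have := N_le; lra.
  by rewrite lerD2l ler_pM2r// ler_nat.
by rewrite (le_trans ti (ltW y1)) (le_trans (ltW y2) tb).
Qed.

(** [N] pieces fit inside [[a, b]] and [N + 1] cover it. *)
Lemma interval_bound :
  (`| \int[P]_w num_roots (F w) a b - (l * ((b - a) * n%:R / pi))%:E | <=
   ((Cm + 1) * th * ((b - a) * n%:R + 1))%:E)%E.
Proof.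
have [ul H] := pieces.
have [hlo hup] : ((Ex P (fun w => \sum_(i < N) (ul i).2 w))%:E <= \int[P]_w num_roots (F w) a b)%E /\
    (\int[P]_w num_roots (F w) a b <= (Ex P (fun w => \sum_(i < N.+1) (ul i).1 w))%:E)%E.
  apply: integral_sandwich.
  - by apply: intg_sum => i _; have [[]] := H i.
  - by apply: intg_sum => i _; have [[]] := H i.
  - by move=> w; exact: num_roots_ge0.
  - by move=> w; apply: (@lower_count (fun i => (ul i).2)) => i; have [_ _ _ _ /(_ w)] := H i.
  move=> w; apply: (@le_trans _ _ (num_roots (F w) a (t N.+1))).
    by apply: num_roots_mono; rewrite /t; have := N_gt; lra.
  have -> : num_roots (F w) a (t N.+1) = num_roots (F w) (t 0%N) (t N.+1) by rewrite /t mul0r addr0.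
  rewrite -sumEFin; apply: (@num_roots_pieces _ _ t N.+1 (fun i => ((ul i).1 w)%:E)) => // i _.
  by have [_ _ _ /(_ w)] := H i.
rewrite Ex_sum in hlo; last by move=> i _; have [[]] := H i.
rewrite Ex_sum in hup; last by move=> i _; have [[]] := H i.
have Ifin : (\int[P]_w num_roots (F w) a b)%E \is a fin_num.
  by rewrite fin_numE -ltNye -ltey (lt_le_trans _ hlo) ?ltNyr// (le_lt_trans hup)// ltry.
move: hlo hup; rewrite -(fineK Ifin) !lee_fin; set v := fine _ => hlo hup.
have sumE M (c : R) : \sum_(i < M) c = M%:R * c by rewrite sumr_const card_ord mulr_natl.
have hlo' : N%:R * (th ^+ 4 * l / pi - Cm * th ^+ 5) <= v.
  apply: le_trans hlo; rewrite -sumE.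
  by apply: ler_sum => i _; have [] := H i.
have hup' : v <= N.+1%:R * (th ^+ 4 * l / pi + Cm * th ^+ 5).
  apply: le_trans hup _; rewrite -sumE.
  by apply: ler_sum => i _; have [] := H i.
change (`|v - l * ((b - a) * n%:R / pi)| <= (Cm + 1) * th * ((b - a) * n%:R + 1)).
rewrite (_ : l * _ = (b - a) * n%:R * (l / pi)); last by ring.
have pi2 : 2 <= pi :> R by exact: pi_ge2.
have k1 : l / pi <= 1.
  by rewrite ler_pdivrMr ?pi_gt0// mul1r (le_trans (la_le1 R k n0))//; lra.
have t4 : th ^+ 4 <= th by rewrite exprS ler_piMr ?exprn_ile1// ltW.
have n'0 := nr0; have N1 := N_le; have N2 := N_gt.
have x1 : N%:R * th ^+ 4 <= (b - a) * n%:R.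
  by move: N1; rewrite mulrA ler_pdivrMr.
have x2 : (b - a) * n%:R < N%:R * th ^+ 4 + th ^+ 4.
  move: N2; rewrite mulrA ltr_pdivlMr// => /lt_le_trans; apply.
  by rewrite -[N.+1%:R]natr1; lra.
have t40 : 0 <= th ^+ 4 by rewrite exprn_ge0// ltW.
have k0 : 0 <= l / pi by rewrite divr_ge0 ?pi_ge0// ltW.
have Cm0 : 0 <= Cm by rewrite addr_ge0.
apply: (count_error (mulr_ge0 (ler0n _ N) t40) t40 (ltW th0) t4 th1 k0 k1 Cm0 x1 x2).
- by apply: le_trans hlo'; rewrite le_eqVlt; apply/orP; left; apply/eqP; ring.
- apply: le_trans hup' _; rewrite -[N.+1%:R]natr1 le_eqVlt; apply/orP; left; apply/eqP; ring.
Qed.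

End Interval.

(** * Choice of the scales *)

Lemma pow_floor K n : (0 < K)%N -> exists D, (D ^ K <= n < D.+1 ^ K)%N.
Proof.
move=> K0; have ex0 : exists D, (D ^ K <= n)%N by exists 0%N; rewrite exp0n.
have bd D : (D ^ K <= n)%N -> (D <= n)%N.
  by apply: leq_trans; case: D => // D; rewrite -{1}(expn1 D.+1) leq_pexp2l.
case: (ex_maxnP ex0 bd) => D h1 h2; exists D; rewrite h1 /= ltnNge; apply/negP => h.
by have := h2 _ h; rewrite ltnn.
Qed.

Lemma cube_le_pow2 s : ((s + 2) ^ 3 <= 64 * 2 ^ s)%N.
Proof.
elim: s => // s IH; case: s IH => // s IH; case: s IH => // s IH.
rewrite (expnS 2) mulnCA (leq_trans _ (leq_mul (leqnn 2) IH))//.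
rewrite !expnS expn0; nia.
Qed.

Lemma sqr_le_pow2 c s : (64 * c <= s + 2)%N -> (c * (s + 2) ^ 2 <= 2 ^ s)%N.
Proof.
move=> cs; rewrite -(@leq_pmul2l 64)// mulnA; apply: leq_trans (cube_le_pow2 s).
by rewrite [((s + 2) ^ 3)%N]expnS leq_mul2r cs orbT.
Qed.

(** The left side is of order [L1 ^ 2], and [L1] is at most about [K] times the logarithm of [D];
    beyond an explicit threshold [D] is larger than such a square. *)
Lemma ml_el_le A0 k K n D : (0 < n)%N -> (0 < D)%N -> (n < D.+1 ^ K)%N ->
  (2 ^ (64 * ((64 * A0 + k + 10) * K ^ 2)) <= D)%N -> (ml n A0 + el n A0 k <= D)%N.
Proof.
move=> n0 D0 nD; set c := (_ * K ^ 2)%N => hD.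
pose s := trunc_log 2 D.
have sD : (2 ^ s <= D)%N by apply: trunc_logP.
have Ds : (D < 2 ^ s.+1)%N by apply: trunc_log_ltn.
have cs : (64 * c <= s)%N by apply: trunc_log_max.
have K0 : (0 < K)%N by case: (K) nD => //; rewrite expn0 ltnS leqNgt n0.
have LK : (L1 n <= (s + 2) * K)%N.
  rewrite /L1 -(@ltn_exp2l 2)//; apply: leq_ltn_trans (trunc_logP _ n0) _ => //.
  apply: leq_trans nD _; apply: (@leq_trans ((2 ^ s.+2) ^ K)).
    by rewrite leq_exp2r//; apply: leq_trans Ds _; rewrite leq_exp2l.
  by rewrite -expnM addn2.
apply: leq_trans sD; apply: leq_trans (sqr_le_pow2 (leq_trans cs (leq_addr 2 s))).
have L0 : (0 < L1 n)%N by [].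
rewrite /c -mulnA -expnMn [(K * _)%N]mulnC.
apply: (@leq_trans ((64 * A0 + k + 10) * L1 n ^ 2)); last by rewrite leq_mul2l leq_exp2r// LK orbT.
rewrite /el /ml /wl /Kl; move: (L1 n) L0 => L L0; rewrite expnS expn1; nia.
Qed.

Lemma geom_small (R : realType) (q : R) : 0 < q < 1 -> exists A0, (0 < A0)%N /\ q ^+ A0 <= 16^-1.
Proof.
move=> /andP[q0 q1]; pose x := q^-1 - 1.
have x0 : 0 < x by rewrite subr_gt0 invf_gt1.
pose N := (Num.truncn (16 / x)).+1; exists N; split => //.
have hN : 16 < N%:R * x by rewrite -ltr_pdivrMr// truncnS_gt.
have := bernoulli_ge N (ltW x0); rewrite (_ : 1 + x = q^-1) => [|]; last by rewrite /x addrC subrK.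
rewrite exprVn => h.
rewrite -[q ^+ N]invrK lef_pV2 ?posrE ?invr_gt0 ?exprn_gt0//.
by apply: le_trans h; lra.
Qed.

Section LargeN.
Variables (R : realType) (k : nat) (p C q : R) (A0 J n D : nat).
Hypotheses (p23 : 2 < p <= 3) (C1 : 1 <= C).
Hypotheses (q01 : 0 < q < 1) (qA0 : q ^+ A0 <= 16^-1) (A00 : (0 < A0)%N).
Hypothesis Jp : 340 <= J%:R * (p - 2).
Local Notation K := (2 * (J + 75))%N.
Hypotheses (Dn : (D ^ K <= n)%N) (nD : (n < D.+1 ^ K)%N).
Hypothesis D1 : 5090 + 288 * C + (60 * (2 * k + 1) * 2 ^ (4 * K))%:R + 20 * (4 + (1 - q)^-1) +
  (2 ^ (64 * ((64 * A0 + k + 10) * K ^ 2)))%:R <= D%:R.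

(** All summands of the threshold are nonnegative, so [D] exceeds each of them. *)
Let terms : [/\ 5090 + 288 * C <= D%:R, (60 * (2 * k + 1) * 2 ^ (4 * K) <= D)%N,
  20 * (4 + (1 - q)^-1) <= D%:R & (2 ^ (64 * ((64 * A0 + k + 10) * K ^ 2)) <= D)%N].
Proof.
have q0 : 0 < (1 - q)^-1 by rewrite invr_gt0 subr_gt0; case/andP: q01.
have h := D1; have c := C1; move: h.
rewrite -(ler_nat R (60 * _ * _) D) -(ler_nat R (2 ^ (64 * _)) D).
set u := (60 * _ * _)%:R; set v := (2 ^ (64 * _))%:R.
have u0 : 0 <= u by rewrite ler0n.
have v0 : 0 <= v by rewrite ler0n.
by move=> h; split; lra.
Qed.

Let D2 : 2 <= D%:R :> R. Proof. by have [h _ _ _] := terms; have := C1; lra. Qed.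
Let Dr0 : 0 < D%:R :> R. Proof. by have := D2; lra. Qed.
Let D0 : (0 < D)%N. Proof. by rewrite -(ltr0n R). Qed.
Let n0 : (0 < n)%N. Proof. by apply: leq_trans Dn; rewrite expn_gt0 D0. Qed.
Let nr0 : 0 < n%:R :> R. Proof. by rewrite ltr0n. Qed.

Let Dn_le e : (e <= K)%N -> D%:R ^+ e <= n%:R :> R.
Proof.
move=> eK; rewrite -natrX ler_nat; apply: leq_trans Dn.
by rewrite leq_pexp2l.
Qed.

Let K3 : (3 <= K)%N. Proof. by rewrite mulnDr; apply: leq_trans (leq_addl _ _). Qed.

Let Dk : 60 * (2 * k + 1)%:R <= D%:R :> R.
Proof.
have [_ h _ _] := terms; rewrite -natrM ler_nat; apply: leq_trans h.
by rewrite leq_pmulr// expn_gt0.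
Qed.

Let nk : 3 * ((2 * k + 1)%:R / n%:R) <= 1/20 :> R.
Proof.
have := Dn_le (ltnW (ltnW K3)); rewrite expr1 => h.
rewrite mulrA ler_pdivrMr//; have := Dk; lra.
Qed.

(** The limit is at least [sqrt (1/3) > 11/20], and by [nk] the error is at most [1/20]. *)
Let la12 : 1/2 <= la R n k.
Proof.
have h := la_near R k n0; have h2 := nk.
have : 11/20 <= Num.sqrt ((2 * k + 1)%:R / (2 * k + 3)%:R) :> R.
  rewrite -(@ler_pXn2r _ 2) ?nnegrE ?sqrtr_ge0// sqr_sqrtr ?divr_ge0//.
  rewrite ler_pdivlMr ?ltr0n ?addn_gt0 ?orbT// (natrD _ (2 * k) 3) (natrD _ (2 * k) 1).
  by have : 0 <= (2 * k)%:R :> R by []; rewrite expr2; lra.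
by move: h; rewrite ler_distl => /andP[]; lra.
Qed.

(** The origin of [K = 2 (J + 75)]: in [D ^ (J + 75) <= sqrt n], the part [D ^ 74] covers the
    frequencies, one [D] pays for the constant [6 (2 k + 1)], and [D ^ J] is the gain. Its power
    [p - 2] reaches [D ^ 340] because [J (p - 2) >= 340]. *)
Let base_le : 3 * (2 * D%:R ^+ 74) * Mn R n k <= D%:R^-1 ^+ J.
Proof.
rewrite /Mn; set x := Num.sqrt _.
have x0 : 0 <= x by exact: sqrtr_ge0.
have k1 : 1 <= (2 * k + 1)%:R :> R by rewrite ler1n addn1.
have hx : x * D%:R ^+ (J + 75) <= (2 * k + 1)%:R.
  have eK : (D%:R ^+ (J + 75)) ^+ 2 = D%:R ^+ K :> R by rewrite -exprM mulnC.
  have m0 : 0 <= x * D%:R ^+ (J + 75) by rewrite mulr_ge0 ?exprn_ge0.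
  rewrite -(@ler_pXn2r _ 2) ?nnegrE// exprMn eK sqr_sqrtr ?divr_ge0//.
  rewrite mulrAC ler_pdivrMr//; apply: (@le_trans _ _ ((2 * k + 1)%:R * n%:R)).
    by rewrite ler_wpM2l// Dn_le.
  by rewrite ler_wpM2r// expr2 ler_peMl.
rewrite exprVn -[leRHS]mul1r ler_pdivlMr ?exprn_gt0//.
have -> : 3 * (2 * D%:R ^+ 74) * x * D%:R ^+ J = 6 * (x * D%:R ^+ (J + 75)) / D%:R.
  by rewrite exprD [D%:R ^+ 75]exprS; field; rewrite gt_eqF.
rewrite ler_pdivrMr// mul1r; have := Dk; lra.
Qed.

Let base_ge0 : 0 <= 3 * (2 * D%:R ^+ 74) * Mn R n k.
Proof. by rewrite !mulr_ge0 ?exprn_ge0 ?sqrtr_ge0. Qed.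

Let thJ : D%:R^-1 ^+ J <= 1 :> R.
Proof. by rewrite exprn_ile1 ?invr_ge0// invf_le1//; have := D2; lra. Qed.

Let base_pow : (3 * (2 * D%:R ^+ 74) * Mn R n k) `^ (p - 2) <= D%:R^-1 ^+ 340.
Proof.
have p0 : 0 <= p - 2 by move: p23; lra.
have t0 : 0 <= D%:R^-1 ^+ J :> R by rewrite exprn_ge0 ?invr_ge0.
have i0 : 0 < D%:R^-1 :> R by rewrite invr_gt0.
apply: (le_trans (ge0_ler_powR p0 _ _ base_le)); rewrite ?nnegrE//.
rewrite -!powR_mulrn ?invr_ge0// -powRrM.
rewrite ger_powR//; last by rewrite i0 invf_le1//; have := D2; lra.
Qed.

(** Since [n < (2 D) ^ K], the power [D ^ (4 (K + 1))] exceeds [n ^ 4] by at least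
    [D ^ 4 / 2 ^ (4 K)], which covers the constants. Thus [m0 = K + 1] derivatives suffice, a number
    independent of [n]. *)
Let m0_cond : (D%:R^-1 ^+ 4 : R) ^+ K.+1 * (3 * n%:R ^+ 4 * (2 * k + 1)%:R) <= 2^-1.
Proof.
have nle : n%:R ^+ 4 <= 2 ^+ (4 * K) * D%:R ^+ (4 * K) :> R.
  rewrite -!natrX -natrM ler_nat -expnMn [(4 * K)%N]mulnC expnM leq_exp2r//.
  apply: leq_trans (ltnW nD) _; rewrite leq_exp2r ?muln_gt0 ?addn_gt0 ?orbT//.
  by rewrite mul2n -addnn -addn1 leq_add2l.
have [_ h _ _] := terms.
have h2 : 6 * ((2 * k + 1)%:R * 2 ^+ (4 * K)) <= D%:R ^+ 4 :> R.
  apply: (@le_trans _ _ D%:R); last first.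
    by rewrite -[leLHS]expr1 ler_weXn2l//; have := D2; lra.
  rewrite -natrX -!natrM ler_nat; apply: leq_trans h; rewrite mulnA.
  by rewrite leq_mul2r leq_mul2r !orbT.
rewrite -exprM exprVn mulrC ler_pdivrMr ?exprn_gt0//.
apply: (@le_trans _ _ (3 * (2 ^+ (4 * K) * D%:R ^+ (4 * K)) * (2 * k + 1)%:R)).
  by rewrite ler_wpM2r// ler_wpM2l.
have -> : (4 * K.+1 = 4 * K + 4)%N by rewrite mulnS addnC.
rewrite [D%:R ^+ (4 * K + 4)]exprD.
have d0 : 0 <= D%:R ^+ (4 * K) :> R by rewrite exprn_ge0.
have := ler_wpM2l d0 h2; set u := D%:R ^+ (4 * K); set v := 2 ^+ _; set w := D%:R ^+ 4.
set z := (2 * k + 1)%:R => hh.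
have -> : 3 * (v * u) * z = 2^-1 * (u * (6 * (z * v))) by field.
by apply: ler_wpM2l hh; rewrite invr_ge0.
Qed.

Let bad_cond : 20 * n%:R ^+ 2 * ((4 + (1 - q)^-1) * (n%:R ^+ 4)^-1) <= D%:R^-1 ^+ 5.
Proof.
have [_ _ h _] := terms.
have n3 : D%:R ^+ 6 <= n%:R ^+ 2 :> R.
  by rewrite (exprM _ 3 2) lerXn2r ?nnegrE ?exprn_ge0// Dn_le// K3.
have -> : 20 * n%:R ^+ 2 * ((4 + (1 - q)^-1) * (n%:R ^+ 4)^-1) = (20 * (4 + (1 - q)^-1)) / n%:R ^+ 2 :> R.
  by move: (1 - q)^-1 => u; field; rewrite gt_eqF.
rewrite ler_pdivrMr ?exprn_gt0//; apply: le_trans h _.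
apply: (@le_trans _ _ (D%:R^-1 ^+ 5 * D%:R ^+ 6)); last by rewrite ler_wpM2l// exprn_ge0// invr_ge0.
by rewrite exprVn le_eqVlt; apply/orP; left; apply/eqP; field; rewrite gt_eqF.
Qed.

Let Mle : (ml n A0 + el n A0 k <= D)%N.
Proof. by have [_ _ _ h] := terms; exact: ml_el_le nD h. Qed.

Let Kn : (2 * Kl n A0 <= n)%N.
Proof.
apply: (@leq_trans D); last by rewrite -(ler_nat R) -[D%:R]expr1 Dn_le// ltnW// ltnW.
apply: leq_trans Mle; apply: leq_trans (leq_addr _ _).
apply: (@leq_trans (4 * Kl n A0)); first by rewrite leq_mul2r orbT.
by rewrite leq_pmulr// /wl addn_gt0 orbT.
Qed.

Lemma large_n_bound d (T : measurableType d) (P : probability T R)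
    (X : 'I_n.+1 + 'I_n -> {RV P >-> R}) (a b : R) :
  mutually_independent P X -> (forall i, std_moments P p C (X i)) ->
  (forall i x, Pr P [set w | `|X i w - x| <= 1/2] <= q) -> a <= b ->
  (`| \int[P]_w num_roots
         (tsum (@freq n) (@phase R n k) (fun i => (X i w * (freq i)%:R ^+ k)%R) 0%N) a b -
      (Num.sqrt ((2 * k + 1)%N%:R / (2 * k + 3)%N%:R) * ((b - a) * n%:R / pi))%:E | <=
   ((165 + K.+1%:R + 3 * (2 * k + 1)%:R) * D%:R^-1 * ((b - a) * n%:R + 1))%:E)%E.
Proof.
move=> iX sX qX ab; have [D1' _ _ _] := terms.
have B1 : 3 * (2 * D%:R ^+ 74) * Mn R n k <= 1 := le_trans base_le thJ.
have := interval_bound iX p23 C1 sX q01 qA0 A00 qX n0 Kn la12 D1' B1 base_pow Mle m0_cond bad_cond ab.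
set I := (\int[P]_w _)%E; set L := (b - a) * n%:R; set s := Num.sqrt _ => h.
have L0 : 0 <= L by rewrite mulr_ge0// subr_ge0.
have Ifin : I \is a fin_num.
  have : (`|I - (la R n k * (L / pi))%:E| < +oo)%E by apply: le_lt_trans h _; rewrite ltry.
  by rewrite -ge0_fin_numE// fin_num_abs abse_id -fin_num_abs fin_numD => /andP[].
move: h; rewrite -(fineK Ifin); set v := fine I => h.
have {}h : `|v - la R n k * (L / pi)| <= (164 + K.+1%:R + 1) * D%:R^-1 * (L + 1) by rewrite -lee_fin.
change (`|v - s * (L / pi)| <= (165 + K.+1%:R + 3 * (2 * k + 1)%:R) * D%:R^-1 * (L + 1)).
have pi1 : 1 <= pi :> R by have := @pi_ge2 R; lra.
(* Replacing [la] by its limit costs a multiple of [1 / n], and [n >= D]. *)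
have near : `|la R n k * (L / pi) - s * (L / pi)| <= 3 * (2 * k + 1)%:R * D%:R^-1 * (L + 1).
  rewrite -mulrBl normrM [`|L / pi|]ger0_norm ?divr_ge0 ?pi_ge0//.
  apply: ler_pM; rewrite ?divr_ge0 ?pi_ge0//.
    apply: le_trans (la_near R k n0) _; rewrite -mulrA ler_wpM2l// ler_wpM2l//.
    by rewrite lef_pV2 ?posrE// -[leLHS]expr1 Dn_le// ltnW// ltnW.
  by rewrite ler_pdivrMr ?pi_gt0// -[leLHS]mulr1 ler_pM//; lra.
apply: le_trans (ler_distD (la R n k * (L / pi)) _ _) _.
apply: le_trans (lerD h near) _; rewrite le_eqVlt; apply/orP; left; apply/eqP.
by move: D%:R^-1 K.+1%:R (2 * k + 1)%:R => x y z; ring.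
Qed.

End LargeN.

(** From [n < (D + 1) ^ K <= (2 D) ^ K]. *)
Lemma scale_le_rate (R : realType) (n D K : nat) : (0 < n)%N -> (0 < D)%N -> (0 < K)%N ->
  (n < D.+1 ^ K)%N -> D%:R^-1 <= 2 * n%:R `^ (- K%:R^-1) :> R.
Proof.
move=> n0 D0 K0 nD; have D0' : 0 < D%:R :> R by rewrite ltr0n.
have np : 0 < n%:R `^ K%:R^-1 :> R by rewrite powR_gt0// ltr0n.
have h : n%:R `^ K%:R^-1 <= 2 * D%:R :> R.
  apply: (@le_trans _ _ ((D.+1 ^ K)%:R `^ K%:R^-1)).
    by apply: ge0_ler_powR; rewrite ?nnegrE ?invr_ge0// ler_nat ltnW.
  rewrite natrX -powR_mulrn// -powRrM divff ?pnatr_eq0 -?lt0n// powRr1//.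
  by rewrite -natrM ler_nat mul2n -addnn -addn1 leq_add2l.
by rewrite powRN -ler_pdivrMr ?invr_gt0// invrK -mulrC ler_pdivrMr// mulrC.
Qed.

Lemma inv_le_rate (R : realType) (n K : nat) : (0 < n)%N -> (0 < K)%N ->
  n%:R^-1 <= n%:R `^ (- K%:R^-1) :> R.
Proof.
move=> n0 K0; rewrite -powR_inv1//; apply: ler_powR; first by rewrite ler1n.
by rewrite lerN2 invf_le1 ?ltr0n// ler1n.
Qed.

Lemma small_n_bound (R : realType) d (T : measurableType d) (P : probability T R) (n k : nat)
    (X : 'I_n.+1 + 'I_n -> {RV P >-> R}) (a b s : R) : (0 < n)%N -> a <= b -> 0 <= s <= 1 ->
  (`| \int[P]_w num_roots
         (tsum (@freq n) (@phase R n k) (fun i => (X i w * (freq i)%:R ^+ k)%R) 0%N) a b -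
      (s * ((b - a) * n%:R / pi))%:E | <=
   (17 * n%:R ^+ 2 * ((b - a) * n%:R + 1))%:E)%E.
Proof.
move=> n0 ab /andP[s0 s1]; set F := fun w => num_roots _ a b.
pose B : R := ((b - a) * (4 * n%:R ^+ 2) + 1) * (2 * n.+1)%:R.
have [h1 h2] : ((Ex P (cst 0))%:E <= \int[P]_w F w)%E /\ (\int[P]_w F w <= (Ex P (cst B))%:E)%E.
  apply: integral_sandwich; [exact: intg_cst|exact: intg_cst| | |] => w.
  - exact: num_roots_ge0.
  - exact: num_roots_ge0.
  - exact: num_roots_tsum n0 (@freq_le n) ab.
have Ifin : (\int[P]_w F w)%E \is a fin_num.
  by rewrite fin_numE -ltNye -ltey (lt_le_trans _ h1) ?ltNyr// (le_lt_trans h2)// ltry.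
move: h1 h2; rewrite !Ex_cst -(fineK Ifin) !lee_fin; set v := fine _ => h1 h2.
set L := (b - a) * n%:R.
change (`|v - s * (L / pi)| <= 17 * n%:R ^+ 2 * (L + 1)).
have n1 : 1 <= n%:R :> R by rewrite ler1n.
have L0 : 0 <= L by rewrite mulr_ge0// subr_ge0.
have pi1 : 1 <= pi :> R by have := @pi_ge2 R; lra.
have LL : L / pi <= L by rewrite ler_pdivrMr ?pi_gt0// ler_peMr.
have L00 : 0 <= L / pi by rewrite divr_ge0 ?pi_ge0.
have sL : 0 <= s * (L / pi) <= L.
  by rewrite mulr_ge0//= (le_trans _ LL)// ler_piMl.
have BL : B <= 16 * n%:R ^+ 2 * (L + 1).
  have e1 : (b - a) * (4 * n%:R ^+ 2) + 1 <= 4 * n%:R * (L + 1).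
    have -> : (b - a) * (4 * n%:R ^+ 2) = 4 * n%:R * L by rewrite /L; ring.
    by rewrite mulrDr mulr1 lerD2l; lra.
  have e2 : (2 * n.+1)%:R <= 4 * n%:R :> R by rewrite natrM -[n.+1%:R]natr1; lra.
  have e0 : 0 <= (b - a) * (4 * n%:R ^+ 2) + 1.
    by rewrite addr_ge0// mulr_ge0 ?subr_ge0// mulr_ge0// exprn_ge0.
  have := ler_pM e0 (ler0n _ _) e1 e2; rewrite -/B => /le_trans; apply.
  by rewrite le_eqVlt; apply/orP; left; apply/eqP; ring.
have n2 : 1 <= n%:R ^+ 2 :> R by rewrite exprn_ege1.
have nL : L <= n%:R ^+ 2 * (L + 1).
  by apply: (@le_trans _ _ (1 * (L + 1))); [lra|rewrite ler_wpM2r//; lra].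
have bb : B + L <= 17 * n%:R ^+ 2 * (L + 1).
  by move: BL nL; rewrite -!mulrA; set u := n%:R ^+ 2 * (L + 1); lra.
have B0 : 0 <= B by exact: le_trans h2.
by rewrite ler_distl; move: sL => /andP[]; move: bb h1 h2 B0; set u := 17 * _ * _ => *; apply/andP; split; lra.
Qed.


Theorem corollary3p8 (R : realType) (k : nat) (C eps : R)
    (C_gt0 : 0 < C) (eps_gt0 : 0 < eps) :
  exists c C' : R, [/\ 0 < c, 0 < C' &
    forall (n : nat), (0 < n)%N ->
    forall (d : measure_display) (T : measurableType d) (P : probability T R)
      (xi : 'I_n.+1 -> {RV P >-> R}) (eta : 'I_n -> {RV P >-> R}),
    mutually_independent P (sum_family xi eta) ->
    (forall i, [/\ ('E_P[xi i] = 0)%E, ('V_P[xi i] = 1)%E &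
       ('E_P[fun w => (`|xi i w| `^ (2 + eps))%R] <= C%:E)%E]) ->
    (forall j, [/\ ('E_P[eta j] = 0)%E, ('V_P[eta j] = 1)%E &
       ('E_P[fun w => (`|eta j w| `^ (2 + eps))%R] <= C%:E)%E]) ->
    forall a b : R, a < b ->
    (`| \int[P]_w num_roots
            ((trig_poly (fun i => xi i w) (fun j => eta j w))^`(k))%classic a b
        - (Num.sqrt ((2 * k + 1)%N%:R / (2 * k + 3)%N%:R)
             * ((b - a) * n%:R / pi))%:E |
      <= (C' * n%:R `^ (- c) * ((b - a) * n%:R + 1))%:E)%E].
Proof.
pose p := Num.min (2 + eps) 3.
have p23 : 2 < p <= 3.
  by rewrite /p lt_min ge_min lexx orbT andbT; apply/andP; split; lra.
have C1 : 1 <= 1 + C by lra.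
have [p2 p3] := andP p23.
have [q q01 Hq] := Pr_concentration p2 C1.
have [A0 [A00 qA0]] := geom_small q01.
pose J := (Num.truncn (340 / (p - 2))).+1.
have Jp : 340 <= J%:R * (p - 2).
  by rewrite -ler_pdivrMr ?subr_gt0// ltW// truncnS_gt.
pose K := (2 * (J + 75))%N.
have K0 : (0 < K)%N by rewrite muln_gt0 addn_gt0 orbT.
pose thr : R := 5090 + 288 * (1 + C) + (60 * (2 * k + 1) * 2 ^ (4 * K))%:R + 20 * (4 + (1 - q)^-1) +
  (2 ^ (64 * ((64 * A0 + k + 10) * K ^ 2)))%:R.
pose D0 := (Num.truncn thr).+1.
pose M := (165 + K.+1%:R + 3 * (2 * k + 1)%:R : R).
have M0 : 0 <= M by rewrite /M addr_ge0 ?mulr_ge0// addr_ge0.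
(* If the scale [D] of [n] is below [D0], then [n < (D + 1) ^ K <= N0]. *)
pose N0 : R := (D0 ^ K)%:R.
have N00 : 0 <= N0 by rewrite ler0n.
(* [2 M] serves large [n], through [D ^ -1 <= 2 n ^ (-1/K)]. [17 N0 ^ 3] serves [n <= N0], through
   [n ^ 2 <= N0 ^ 3 / n] and [1 / n <= n ^ (-1/K)]. The 1 makes the constant positive. *)
exists K%:R^-1, (17 * N0 ^+ 3 + 2 * M + 1); split.
- by rewrite invr_gt0 ltr0n.
- by rewrite ltr_wpDl// addr_ge0 ?mulr_ge0 ?exprn_ge0.
move=> n n0 d T P xi eta ind hxi heta a b /ltW ab.
have sX i : std_moments P p (1 + C) (sum_family xi eta i).
  case: i => j /=; [have [h1 h2 h3] := hxi j|have [h1 h2 h3] := heta j]; exact: std_moments_intro.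
have qX i x : Pr P [set w | `|sum_family xi eta i w - x| <= 1/2] <= q by exact: Hq (sX i) x.
set I := (\int[P]_w _)%E.
have -> : I = (\int[P]_w num_roots (tsum (@freq n) (@phase R n k)
    (fun i => (sum_family xi eta i w * (freq i)%:R ^+ k)%R) 0%N) a b)%E.
  rewrite /I; apply: eq_integral => w _; rewrite trig_poly_derivE.
  congr (num_roots (tsum _ _ _ _) _ _); apply/funext => -[] //.
have L1 : 0 <= (b - a) * n%:R + 1 by rewrite addr_ge0// mulr_ge0// subr_ge0.
have [D /andP[Dn nD]] := pow_floor n K0.
have r0 : 0 <= n%:R `^ (- K%:R^-1) :> R by exact: powR_ge0.
have [DD|DD] := leqP D0 D.
  have thrD : thr <= D%:R by rewrite (le_trans (ltW (truncnS_gt _)))// ler_nat.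
  apply: le_trans (large_n_bound p23 C1 q01 qA0 A00 Jp Dn nD thrD ind sX qX ab) _.
  rewrite lee_fin ler_wpM2r//.
  have Dp : (0 < D)%N by apply: leq_trans DD.
  apply: (@le_trans _ _ (M * (2 * n%:R `^ (- K%:R^-1)))).
    by rewrite ler_wpM2l// scale_le_rate.
  rewrite mulrA ler_wpM2r// [M * 2]mulrC -addrA addrCA lerDl.
  by rewrite addr_ge0// mulr_ge0 ?exprn_ge0.
have s01 : 0 <= Num.sqrt ((2 * k + 1)%N%:R / (2 * k + 3)%N%:R : R) <= 1.
  rewrite sqrtr_ge0 /= -[leRHS]sqrtr1 ler_wsqrtr// ler_pdivrMr ?ltr0n ?addn_gt0 ?orbT//.
  by rewrite mul1r ler_nat leq_add2l.
apply: le_trans (small_n_bound k (sum_family xi eta) n0 ab s01) _.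
rewrite lee_fin ler_wpM2r//.
have nN : n%:R <= N0.
  by rewrite /N0 ler_nat (leq_trans (ltnW nD))// leq_exp2r.
have n0' : 0 < n%:R :> R by rewrite ltr0n.
apply: (@le_trans _ _ (17 * N0 ^+ 3 * n%:R `^ (- K%:R^-1))); last first.
  by rewrite ler_wpM2r// -addrA lerDl addr_ge0// mulr_ge0.
apply: (@le_trans _ _ (17 * N0 ^+ 3 * n%:R^-1)); last first.
  by rewrite ler_wpM2l ?inv_le_rate// mulr_ge0// exprn_ge0.
by rewrite ler_pdivlMr// -mulrA -exprSr ler_wpM2l// lerXn2r// nnegrE// ltW.
Qed.
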